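(* Let $1<p<\infty$. The Bergman space $B_p$ embeds almost isometrically into $\ell_p$, and $\mathcal{K}(B_p)$ is an $M$-ideal in $\mathcal{L}(B_p)$.
   Context: $B_p$ is the space of all analytic functions $f$ on the open unit disk $\mathbb{D}\subset\mathbb{C}$ with $\int_{\mathbb{D}}|f(x+iy)|^p\,dx\,dy<\infty$, with the norm of $L_p(\mathbb{D},dx\,dy)$, of which it is a closed subspace. Scalars are complex. $X$ embeds almost isometrically into $Z$ if for every $\varepsilon>0$ there is a subspace $Z_\varepsilon$ of $Z$ whose Banach–Mazur distance to $X$ is less than $1+\varepsilon$. $\mathcal{L}(X)$ is the Banach space of bounded linear operators on $X$, $\mathcal{K}(X)$ its subspace of compact operators. A closed subspace $J$ of a Banach space $E$ is an $M$-ideal in $E$ if there is a subspace $V\subset E^*$ with $E^*=J^\perp\oplus_1 V$, i.e. every $e^*\in E^*$ is uniquely $e^*=j+v$ with $j\in J^\perp$ (annihilator of $J$), $v\in V$, and $\|e^*\|=\|j\|+\|v\|$. *)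

(* Defs.v *)
From HB Require Import structures.
From mathcomp Require Import all_boot all_order all_algebra.
From mathcomp Require Import all_classical all_reals all_analysis.
From mathcomp Require Import measurable_realfun complex ring lra.

Set Implicit Arguments.
Unset Strict Implicit.
Unset Printing Implicit Defensive.

Import Order.TTheory GRing.Theory Num.Theory.
Import numFieldNormedType.Exports.

Local Open Scope classical_set_scope.
Local Open Scope complex_scope.
Local Open Scope ring_scope.

Section RealNorm.
Variable R : realType.
Implicit Type V : normedModType R[i].

(* The norm of a normedModType over R[i] is R[i]-valued; rnorm is the same
   number in R, see rnormE. *)
Definition rnorm V (x : V) : R := complex.Re `|x|.

Lemma rnormE V (x : V) : `|x| = (rnorm x)%:C.
Proof. by rewrite /rnorm RRe_real// normr_real. Qed.

Lemma rnorm_ge0 V (x : V) : 0 <= rnorm x.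
Proof. by rewrite -ler0c -rnormE. Qed.

Lemma rnormD V (x y : V) : rnorm (x + y) <= rnorm x + rnorm y.
Proof. by rewrite -lecR rmorphD/= -!rnormE ler_normD. Qed.

Lemma rnormZ V (a : R[i]) (x : V) :
  rnorm (a *: x) = rnorm (a : R[i]^o) * rnorm x.
Proof. by apply: complexI; rewrite rmorphM/= -!rnormE normrZ. Qed.

Lemma rnorm_eq0 V (x : V) : rnorm x = 0 -> x = 0.
Proof. by move=> x0; apply/normr0_eq0; rewrite rnormE x0. Qed.

End RealNorm.

Section NormedSubmodules.
Variable R : realType.

(* A linear subspace of L carrying a norm that is defined on the subspace only;
   the values of ns_norm outside ns_carrier are irrelevant. *)
Record normed_submod (L : lmodType R[i]) := NormedSubmod {
  ns_carrier : {pred L};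
  ns_closed : submod_closed ns_carrier;
  ns_norm : L -> R;
  ns_normD : {in ns_carrier &, forall x y,
    ns_norm (x + y) <= ns_norm x + ns_norm y};
  ns_normZ : forall a, {in ns_carrier, forall x,
    ns_norm (a *: x) = rnorm (a : R[i]^o) * ns_norm x};
  ns_norm_eq0 : {in ns_carrier, forall x, ns_norm x = 0 -> x = 0} }.

Variables (L : lmodType R[i]) (N : normed_submod L).

HB.instance Definition _ :=
  GRing.isSubmodClosed.Build R[i] L (ns_carrier N) (ns_closed N).

Record ns_type := NsElt {
  ns_val :> L;
  ns_valP : ns_val \in ns_carrier N }.

HB.instance Definition _ := [isSub for ns_val].
HB.instance Definition _ := [Choice of ns_type by <:].
HB.instance Definition _ := [SubChoice_isSubLmodule of ns_type by <:].

Definition ns_elt_norm (x : ns_type) : R[i] := (ns_norm N (val x))%:C.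

Lemma ns_elt_normD x y : ns_elt_norm (x + y) <= ns_elt_norm x + ns_elt_norm y.
Proof. by rewrite /ns_elt_norm -rmorphD lecR raddfD ns_normD ?ns_valP. Qed.

Lemma ns_elt_normZ (a : R[i]) x : ns_elt_norm (a *: x) = `|a| * ns_elt_norm x.
Proof.
rewrite /ns_elt_norm linearZ/= ns_normZ ?ns_valP//.
by rewrite rmorphM/= (rnormE (a : R[i]^o)).
Qed.

Lemma ns_elt_norm_eq0 x : ns_elt_norm x = 0 -> x = 0.
Proof.
by move=> /complexI x0; apply/val_inj/(ns_norm_eq0 (ns_valP x) x0).
Qed.

HB.instance Definition _ := @Lmodule_isNormed.Build R[i] ns_type
  ns_elt_norm ns_elt_normD ns_elt_normZ ns_elt_norm_eq0.

End NormedSubmodules.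

Section Operators.
Variable R : realType.
Variables X Y : normedModType R[i].

Definition bounded_linear : {pred X -> Y} := fun f =>
  `[< linear f /\ exists M : R, forall x, rnorm (f x) <= M * rnorm x >].

Definition unit_ball : set X := [set x | `|x| <= 1].

Definition opnorm (f : X -> Y) : R := sup [set rnorm (f x) | x in unit_ball].

Lemma unit_ballE x : unit_ball x <-> rnorm x <= 1.
Proof. by rewrite /unit_ball/= rnormE -lecR. Qed.

Lemma unit_ball0 : unit_ball 0.
Proof. by rewrite /unit_ball/= normr0. Qed.

Lemma bounded_linearP f : f \in bounded_linear ->
  linear f /\ exists M : R, forall x, rnorm (f x) <= M * rnorm x.
Proof. by move=> /asboolP. Qed.

Lemma bounded_linear_closed : submod_closed bounded_linear.
Proof.
split.
  apply/asboolP; split=> [a u v|].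
    by change (0 = a *: 0 + 0 :> Y); rewrite scaler0 addr0.
  exists 0 => x; change (rnorm (0 : Y) <= 0 * rnorm x).
  by rewrite mul0r /rnorm normr0.
move=> a f g /bounded_linearP[lf [M hM]] /bounded_linearP[lg [N hN]].
apply/asboolP; split=> [b u v|].
  change (a *: f (b *: u + v) + g (b *: u + v) =
    b *: (a *: f u + g u) + (a *: f v + g v)).
  rewrite lf lg !scalerDr !scalerA (mulrC b) -!addrA; congr (_ + _).
  by rewrite addrCA.
exists (rnorm (a : R[i]^o) * M + N) => x.
change (rnorm (a *: f x + g x) <= (rnorm (a : R[i]^o) * M + N) * rnorm x).
rewrite (le_trans (rnormD _ _))// mulrDl lerD// rnormZ -mulrA.
by rewrite ler_wpM2l// rnorm_ge0.
Qed.

Lemma opnorm_has_sup f : f \in bounded_linear ->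
  has_sup [set rnorm (f x) | x in unit_ball].
Proof.
move=> /bounded_linearP[lf [M hM]]; split.
  by exists (rnorm (f 0)), 0 => //; exact: unit_ball0.
exists `|M| => _ [x /unit_ballE x1 <-]; rewrite (le_trans (hM x))//.
rewrite (le_trans (ler_norm _))// normrM (ger0_norm (rnorm_ge0 x)).
by rewrite ler_piMr.
Qed.

Lemma opnorm_ub f x : f \in bounded_linear -> unit_ball x ->
  rnorm (f x) <= opnorm f.
Proof.
by move=> bf x1; apply: ub_le_sup; [case: (opnorm_has_sup bf)|exists x].
Qed.

Lemma opnorm_le f r : (forall x, unit_ball x -> rnorm (f x) <= r) ->
  opnorm f <= r.
Proof.
move=> fr; apply: ge_sup.
  by exists (rnorm (f 0)), 0 => //; exact: unit_ball0.
by move=> _ [x x1 <-]; exact: fr.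
Qed.

Lemma opnormD : {in bounded_linear &, forall f g,
  opnorm (f + g) <= opnorm f + opnorm g}.
Proof.
move=> f g bf bg; apply: opnorm_le => x x1.
by rewrite (le_trans (rnormD _ _))// lerD// opnorm_ub.
Qed.

Lemma opnormZ a : {in bounded_linear, forall f,
  opnorm (a *: f) = rnorm (a : R[i]^o) * opnorm f}.
Proof.
move=> f bf.
have le b g : g \in bounded_linear ->
    opnorm (b *: g) <= rnorm (b : R[i]^o) * opnorm g.
  move=> bg; apply: opnorm_le => x x1.
  change (rnorm (b *: g x) <= rnorm (b : R[i]^o) * opnorm g).
  rewrite rnormZ.
  by rewrite ler_wpM2l ?rnorm_ge0// opnorm_ub.
apply/le_anti/andP; split; first exact: le.
have [->|a0] := eqVneq a 0.
  rewrite scale0r {1}/rnorm normr0 mul0r.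
  by apply: le_trans (opnorm_ub _ unit_ball0); rewrite ?rnorm_ge0//;
    case: bounded_linear_closed.
have baf : a *: f \in bounded_linear.
  case: bounded_linear_closed => b0 bD.
  by have := bD a f 0 bf b0; rewrite addr0.
have := le a^-1 _ baf; rewrite scalerA mulVf// scale1r => h.
have ra : 0 < rnorm (a : R[i]^o).
  rewrite lt_neqAle rnorm_ge0 andbT eq_sym; apply: contra a0 => /eqP.
  by move=> /(@rnorm_eq0 R R[i]^o) ->.
rewrite -ler_pdivlMl//; apply: (le_trans h); rewrite le_eqVlt; apply/orP; left.
apply/eqP; congr (_ * _); apply: complexI.
by rewrite fmorphV -!(@rnormE R R[i]^o) normfV.
Qed.

Lemma opnorm_eq0 : {in bounded_linear, forall f, opnorm f = 0 -> f = 0}.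
Proof.
move=> f bf f0; apply/funext => x; apply: rnorm_eq0.
have [lf _] := bounded_linearP bf.
have fZ a y : f (a *: y) = a *: f y.
  have g0 : f 0 = 0.
    by have := lf (-1) 0 0; rewrite scaler0 addr0 scaleN1r addNr.
  by have := lf a y 0; rewrite !addr0 g0 addr0.
have [->|x0] := eqVneq x 0.
  by rewrite -(scale0r (0 : X)) fZ scale0r /rnorm normr0.
have xn : `|x| != 0 by rewrite normr_eq0.
have : unit_ball (`|x|^-1 *: x).
  by rewrite /unit_ball/= normrZ normfV normr_id mulVf.
move=> /(opnorm_ub bf); rewrite f0 fZ => h.
have : rnorm (`|x|^-1 *: f x) = 0 by apply/le_anti; rewrite h rnorm_ge0.
move=> /rnorm_eq0 /eqP; rewrite scaler_eq0 invr_eq0 (negbTE xn)/= => /eqP ->.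
by rewrite /rnorm normr0.
Qed.

Definition operators : normed_submod (X -> Y) :=
  NormedSubmod bounded_linear_closed opnormD opnormZ opnorm_eq0.

End Operators.

Lemma rnorm_ns (R : realType) (L : lmodType R[i]) (N : normed_submod L)
  (x : ns_type N) : rnorm x = ns_norm N (ns_val x).
Proof. by []. Qed.

Definition bounded_op (R : realType) (X Y : normedModType R[i]) : Type :=
  ns_type (operators X Y).

HB.instance Definition _ (R : realType) (X Y : normedModType R[i]) :=
  NormedModule.copy (bounded_op X Y) (ns_type (operators X Y)).

Definition op_fun (R : realType) (X Y : normedModType R[i])
  (T : bounded_op X Y) : X -> Y := ns_val T.
Coercion op_fun : bounded_op >-> Funclass.

Lemma rnorm_op (R : realType) (X Y : normedModType R[i])
  (T : bounded_op X Y) : rnorm T = opnorm T.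
Proof. by []. Qed.

Lemma op_linear (R : realType) (X Y : normedModType R[i])
  (T : bounded_op X Y) : linear T.
Proof. by case: (bounded_linearP (ns_valP T)). Qed.

Section BanachSpaceNotions.
Variable R : realType.
Implicit Types X Y Z E : normedModType R[i].

Local Notation dual E := (bounded_op E R[i]^o).

Definition annihilator E (J : set E) : set (dual E) :=
  [set e : dual E | forall x, J x -> e x = 0].

(* E^* is the l_1-direct sum of the annihilator of J and V. *)
Definition M_ideal E (J : set E) : Prop :=
  [/\ submod_closed (mem J), closed J &
    exists2 V : set (dual E), submod_closed (mem V) &
      forall e : dual E, exists2 jv : dual E * dual E,
        unique (fun w => [/\ annihilator J w.1, V w.2 & e = w.1 + w.2]) jv &
        `|e| = `|jv.1| + `|jv.2|].

Definition compact_operators X : set (bounded_op X X) :=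
  [set T | precompact (T @` @unit_ball R X)].

(* +oo when X and Y are not isomorphic. *)
Definition banach_mazur X Y : \bar R :=
  ereal_inf [set d | exists (T : bounded_op X Y) (S : bounded_op Y X),
    [/\ cancel T S, cancel S T & d = (rnorm T * rnorm S)%:E]].

Lemma sub_normD Z (W : set Z) : {in mem W &, forall x y : Z,
  rnorm (x + y) <= rnorm x + rnorm y}.
Proof. by move=> x y _ _; exact: rnormD. Qed.

Lemma sub_normZ Z (W : set Z) (a : R[i]) : {in mem W, forall x : Z,
  rnorm (a *: x) = rnorm (a : R[i]^o) * rnorm x}.
Proof. by move=> x _; exact: rnormZ. Qed.

Lemma sub_norm_eq0 Z (W : set Z) : {in mem W, forall x : Z,
  rnorm x = 0 -> x = 0}.
Proof. by move=> x _; exact: rnorm_eq0. Qed.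

Definition linear_subspace Z (W : set Z) (hW : submod_closed (mem W)) :
    normedModType R[i] :=
  ns_type (NormedSubmod hW (@sub_normD Z W) (@sub_normZ Z W)
    (@sub_norm_eq0 Z W)).

Definition embeds_almost_isometrically X Z : Prop :=
  forall e : R, 0 < e ->
    exists (W : set Z) (hW : submod_closed (mem W)),
      (banach_mazur X (linear_subspace hW) < (1 + e)%:E)%E.

End BanachSpaceNotions.

HB.lock Definition pint d (T : measurableType d) (R : realType)
    (mu : {measure set T -> \bar R}) (p : R) (g : T -> R) : \bar R :=
  (\int[mu]_x (g x `^ p)%:E)%E.

Section PNorm.
Context d (T : measurableType d) (R : realType).
Variables (mu : {measure set T -> \bar R}) (p : R).
Hypothesis p1 : 1 <= p.
Implicit Types g h k : T -> R.

Let p0 : 0 < p. Proof. exact: lt_le_trans p1. Qed.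

Let pn0 : p != 0. Proof. by rewrite gt_eqF. Qed.

Local Notation pint := (pint mu p).

Let nonneg g := forall x, 0 <= g x.

Lemma pint_ge0 g : (0 <= pint g)%E.
Proof.
by rewrite pint.unlock; apply: integral_ge0 => x _; rewrite lee_fin powR_ge0.
Qed.

Lemma measurable_powRp g : measurable_fun setT g ->
  measurable_fun setT (fun x => g x `^ p).
Proof. exact: (@measurableT_comp _ _ _ _ _ _ (@powR R ^~ p)). Qed.

Lemma pint_Lnorm g : nonneg g -> (pint g `^ p^-1 = 'N[mu]_p%:E[EFin \o g])%E.
Proof.
move=> g0; rewrite Lnorm.unlock.
rewrite pint.unlock.
apply: (f_equal (fun t : \bar R => (t `^ p^-1)%E)).
apply: eq_integral => x _.
by rewrite /= ger0_norm.
Qed.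

Lemma pint_fine g : (pint g < +oo)%E ->
  (fine (pint g) `^ p^-1)%:E = (pint g `^ p^-1)%E.
Proof.
by move=> goo; rewrite -poweR_EFin fineK// ge0_fin_numE// pint_ge0.
Qed.

Lemma pint_triangle g h k :
  measurable_fun setT g -> measurable_fun setT h -> measurable_fun setT k ->
  nonneg g -> nonneg h -> nonneg k -> (forall x, k x <= g x + h x) ->
  (pint g < +oo)%E -> (pint h < +oo)%E ->
  (pint k < +oo)%E /\
  fine (pint k) `^ p^-1 <= fine (pint g) `^ p^-1 + fine (pint h) `^ p^-1.
Proof.
move=> mg mh mk g0 h0 k0 kgh goo hoo.
have gh0 : nonneg (g \+ h) by move=> x /=; rewrite addr_ge0.
have le1 : (pint k `^ p^-1 <= pint g `^ p^-1 + pint h `^ p^-1)%E.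
  apply: (@le_trans _ _ (pint (g \+ h)%R `^ p^-1)%E).
    have pV0 : 0 <= p^-1 by rewrite invr_ge0 ltW.
    apply: (gt0_ler_poweR pV0).
    - by rewrite in_itv/= pint_ge0 leey.
    - by rewrite in_itv/= pint_ge0 leey.
    have a1 x : [set: T] x -> (0 <= (k x `^ p)%:E)%E.
      by rewrite lee_fin powR_ge0.
    have a2 := (measurable_EFinP _ _).2 (measurable_powRp mk).
    have a3 := (measurable_EFinP _ _).2
      (measurable_powRp (measurable_funD mg mh)).
    rewrite !pint.unlock.
    apply: (ge0_le_integral mu measurableT a1 a2 a3) => x _.
    by rewrite lee_fin ge0_ler_powR ?nnegrE ?(ltW p0) ?gh0.
  rewrite (pint_Lnorm gh0) (pint_Lnorm g0) (pint_Lnorm h0).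
  exact: minkowski_EFin.
have koo : (pint k < +oo)%E.
  apply: (@lty_poweRy _ _ p^-1); first by rewrite invr_neq0.
  by rewrite (le_lt_trans le1)// lte_add_pinfty// poweR_lty.
split; first exact: koo.
by rewrite -lee_fin EFinD (pint_fine koo) (pint_fine goo) (pint_fine hoo).
Qed.

Lemma pint_scale (c : R) g : measurable_fun setT g -> nonneg g -> 0 <= c ->
  (pint g < +oo)%E ->
  (pint (fun x => c * g x)%R < +oo)%E /\
  fine (pint (fun x => c * g x)%R) `^ p^-1 = c * fine (pint g) `^ p^-1.
Proof.
move=> mg g0 c0 goo.
have E : pint (fun x => c * g x) = ((c `^ p)%:E * pint g)%E.
  rewrite !pint.unlock -ge0_integralZl//.
  - by apply: eq_integral => x _; rewrite powRM// EFinM.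
  - exact/measurable_EFinP/(measurable_powRp mg).
  - by move=> x _; rewrite lee_fin powR_ge0.
  - by rewrite lee_fin powR_ge0.
have fg : pint g \is a fin_num by rewrite ge0_fin_numE ?pint_ge0.
rewrite E; split; first by rewrite lte_mul_pinfty ?lee_fin ?powR_ge0.
rewrite fineM// powRM ?powR_ge0 ?fine_ge0 ?pint_ge0//=.
by rewrite -powRrM mulfV// powRr1.
Qed.

End PNorm.

Section LittleLp.
Variables (R : realType) (p : R).
Hypothesis p1 : 1 <= p.

Definition lp_series (x : nat -> R[i]^o) : \bar R :=
  (\sum_(k <oo) (rnorm (x k) `^ p)%:E)%E.

Definition p_summable : {pred nat -> R[i]^o} := fun x =>
  `[< (lp_series x < +oo)%E >].

Definition lp_norm (x : nat -> R[i]^o) : R := fine (lp_series x) `^ p^-1.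

Let cnt x : lp_series x = pint counting p (fun k => rnorm (x k)).
Proof.
by rewrite pint.unlock ge0_integral_count// => k; rewrite lee_fin powR_ge0.
Qed.

Let rn0 (x : nat -> R[i]^o) k : 0 <= rnorm (x k). Proof. exact: rnorm_ge0. Qed.

Lemma lp_add x y : x \in p_summable -> y \in p_summable ->
  x + y \in p_summable /\ lp_norm (x + y) <= lp_norm x + lp_norm y.
Proof.
move=> /asboolP xoo /asboolP yoo; rewrite /lp_norm !cnt in xoo yoo *.
have [] := @pint_triangle _ _ _ counting p p1 _ _
  (fun k => rnorm ((x + y) k)) _ _ _
  (rn0 x) (rn0 y) (rn0 (x + y)) _ xoo yoo => //.
  by move=> k; exact: rnormD.
by move=> h ?; split=> //; apply/asboolP; rewrite cnt.
Qed.

Lemma lp_scale a x : x \in p_summable ->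
  a *: x \in p_summable /\ lp_norm (a *: x) = rnorm (a : R[i]^o) * lp_norm x.
Proof.
move=> /asboolP xoo; rewrite /lp_norm !cnt in xoo *.
have [] := @pint_scale _ _ _ counting p p1 (rnorm (a : R[i]^o)) _ _ (rn0 x)
  (rnorm_ge0 _) xoo => //.
have -> : (fun k => rnorm (a : R[i]^o) * rnorm (x k)) =
    (fun k => rnorm ((a *: x) k)).
  by apply/funext => k; rewrite -rnormZ.
by move=> h ?; split=> //; apply/asboolP; rewrite cnt.
Qed.

Lemma p_summable_closed : submod_closed p_summable.
Proof.
split.
  apply/asboolP; rewrite /lp_series eseries0 ?ltry// => k _ _.
  by rewrite /rnorm normr0/= powR0// gt_eqF// (lt_le_trans _ p1).
move=> a x y xp yp; have [axp _] := lp_scale a xp.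
by have [] := lp_add axp yp.
Qed.

Lemma lp_normD : {in p_summable &, forall x y,
  lp_norm (x + y) <= lp_norm x + lp_norm y}.
Proof. by move=> x y xp yp; have [] := lp_add xp yp. Qed.

Lemma lp_normZ a : {in p_summable, forall x,
  lp_norm (a *: x) = rnorm (a : R[i]^o) * lp_norm x}.
Proof. by move=> x xp; have [] := lp_scale a xp. Qed.

Lemma lp_norm_eq0 : {in p_summable, forall x, lp_norm x = 0 -> x = 0}.
Proof.
move=> x /asboolP xoo /powR_eq0_eq0.
have s0 : (0 <= lp_series x)%E by rewrite cnt pint_ge0.
move=> /eqP; rewrite fine_eq0 ?ge0_fin_numE// => /eqP x0.
apply/funext => k; apply: rnorm_eq0; apply: (@powR_eq0_eq0 _ _ p).
have : ((rnorm (x k) `^ p)%:E <= 0)%E.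
  rewrite -x0; apply: le_trans (nneseries_lim_ge k.+1 _).
    rewrite big_nat_recr//= leeDr// sume_ge0// => i _.
    by rewrite lee_fin powR_ge0.
  by move=> i _ _; rewrite lee_fin powR_ge0.
rewrite lee_fin => h; apply/le_anti; rewrite h powR_ge0//.
Qed.

Definition lp : normed_submod (nat -> R[i]^o) :=
  NormedSubmod p_summable_closed lp_normD lp_normZ lp_norm_eq0.

Definition lp_space : normedModType R[i] := ns_type lp.

End LittleLp.

Section Analytic.
Variables (R : realType).
Local Notation C := R[i].
Local Notation rn z := (rnorm (z : C^o)).

Lemma rnM (z w : C) : rn (z * w) = rn z * rn w.
Proof. exact: (@rnormZ R C^o z w). Qed.

Lemma rn1 : rn 1 = 1.
Proof. by apply: complexI; rewrite -(@rnormE R C^o) normr1. Qed.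

Lemma rnX (z : C) k : rn (z ^+ k) = rn z ^+ k.
Proof. by elim: k => [|k ih]; rewrite ?expr0 ?rn1// !exprS rnM ih. Qed.

Lemma rnC (x : R) : 0 <= x -> rn x%:C = x.
Proof.
by move=> x0; apply: complexI; rewrite -(@rnormE R C^o) ger0_norm ?ler0c.
Qed.

Lemma rn_lt (z : C) (e : R) : (`|z| < e%:C) = (rn z < e).
Proof. by rewrite (@rnormE R C^o) ltcR. Qed.

Lemma rn_le (z : C) (e : R) : (`|z| <= e%:C) = (rn z <= e).
Proof. by rewrite (@rnormE R C^o) lecR. Qed.

Lemma rn_pair (x y : R) : rn (x +i* y) <= `|x| + `|y|.
Proof.
rewrite /rnorm normc_def/=.
rewrite -(@ler_pXn2r _ 2)// ?nnegrE ?sqrtr_ge0 ?addr_ge0//.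
rewrite sqr_sqrtr ?addr_ge0 ?sqr_ge0// sqrrD !real_normK ?num_real//.
by rewrite lerD2r lerDl mulrn_wge0// mulr_ge0.
Qed.

Definition analytic_on (A : set C) (f : C -> C^o) : Prop :=
  forall z0, A z0 -> exists (r : R) (a : nat -> C), 0 < r /\
    forall z, `|z - z0| < r%:C ->
      [series a k * (z - z0) ^+ k : C^o]_k @ \oo --> f z.

Lemma cvg_rnP (u : nat -> C^o) (l : C^o) : u @ \oo --> l <->
  forall e : R, 0 < e -> exists N, forall n, (N <= n)%N -> rn (l - u n) < e.
Proof.
split=> [ul e e0|h].
  have e0' : 0 < e%:C by rewrite -ltcR in e0.
  have /cvgrPdist_lt /(_ _ e0') [N _ hN] := ul.
  by exists N => n Nn; rewrite -rn_lt; exact: hN.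
apply/cvgrPdist_lt => e e0.
have re : e = (complex.Re e)%:C by rewrite RRe_real// gtr0_real.
have [|N hN] := h (complex.Re e); first by rewrite -ltcR -re.
by exists N => // n /= Nn; rewrite re rn_lt; exact: hN.
Qed.

Lemma seriesE (u : nat -> C) n :
  [series u k : C^o]_k n = \sum_(0 <= k < n) u k.
Proof. by []. Qed.

Lemma analytic_on_lin (A : set C) (a : C) f g :
  analytic_on A f -> analytic_on A g -> analytic_on A (a *: f + g).
Proof.
move=> Af Ag z0 Az0.
have [r [u [r0 hu]]] := Af z0 Az0; have [s [v [s0 hv]]] := Ag z0 Az0.
exists (Num.min r s), (fun k => a * u k + v k); split.
  by rewrite lt_min r0 s0.
move=> z; rewrite rn_lt lt_min -!rn_lt => /andP[/hu/cvg_rnP fz /hv/cvg_rnP gz].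
apply/cvg_rnP => e e0.
have ra : 0 < rn a + 1 by rewrite ltr_wpDl ?rnorm_ge0.
have [N hN] := fz _ (divr_gt0 (divr_gt0 e0 (ltr0n R 2)) ra).
have [P hP] := gz _ (divr_gt0 e0 (ltr0n R 2)).
exists (maxn N P) => n; rewrite geq_max => /andP[/hN {}hN /hP {}hP].
rewrite !seriesE in hN hP *.
have -> : \sum_(0 <= k < n) ((a * u k + v k) * (z - z0) ^+ k) =
  a * (\sum_(0 <= k < n) u k * (z - z0) ^+ k) +
  \sum_(0 <= k < n) (v k * (z - z0) ^+ k).
  rewrite mulr_sumr -big_split/=; apply: eq_bigr => k _.
  by rewrite mulrDl -mulrA.
set S := \sum_(_ <= _ < _) _ in hN *; set T := \sum_(_ <= _ < _) _ in hP *.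
change (rn (a * f z + g z - (a * S + T)) < e).
have -> : a * f z + g z - (a * S + T) = a * (f z - S) + (g z - T).
  by rewrite mulrBr opprD addrACA.
rewrite (le_lt_trans (@rnormD R C^o _ _))// rnM [e]splitr ltr_leD//; last first.
  exact: ltW.
rewrite (@le_lt_trans _ _ ((rn a + 1) * rn (f z - S)))//.
  by rewrite ler_wpM2r ?rnorm_ge0// lerDl.
by rewrite mulrC -ltr_pdivlMr.
Qed.

Lemma rn_bounded (u : nat -> C) (N : nat) :
  exists M : R, forall n, (n < N)%N -> rn (u n) <= M.
Proof.
elim: N => [|N [M hM]]; first by exists 0.
exists (Num.max M (rn (u N))) => n; rewrite ltnS leq_eqVlt le_max.
by case/orP => [/eqP->|/hM ->]//; rewrite lexx orbT.
Qed.

Lemma analytic_continuous (A : set C) f z0 : analytic_on A f -> A z0 ->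
  forall e : R, 0 < e -> exists2 d : R, 0 < d &
    forall z, rn (z - z0) < d -> rn (f z - f z0) < e.
Proof.
move=> Af Az0 e e0; have [r [a [r0 ha]]] := Af z0 Az0.
have S_recl (w : C) n : \sum_(0 <= k < n.+1) (a k * w ^+ k) =
    a 0%N + \sum_(0 <= k < n) (a k.+1 * w ^+ k.+1).
  by rewrite big_nat_recl// expr0 mulr1.
have f0 : f z0 = a 0%N.
  apply/subr0_eq/(@rnorm_eq0 R C^o)/le_anti; rewrite rnorm_ge0 andbT.
  apply/ler_addgt0Pl => d d0; rewrite addr0.
  have zz : `|z0 - z0| < r%:C by rewrite subrr normr0 ltcR.
  have /cvg_rnP /(_ d d0) [N /(_ N.+1 (leqnSn N))] := ha z0 zz.
  rewrite seriesE S_recl big1 ?addr0 => [/ltW//|k _].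
  by rewrite subrr expr0n/= mulr0.
pose rho := r / 2; have rho0 : 0 < rho by rewrite divr_gt0.
have [M M0 hM] : exists2 M : R, 0 < M & forall k, rn (a k) * rho ^+ k <= M.
  pose z := z0 + rho%:C.
  have zz : z - z0 = rho%:C by rewrite addrAC subrr add0r.
  have zr : `|z - z0| < r%:C.
    by rewrite zz rn_lt rnC ?(ltW rho0)// ltr_pdivrMr// ltr_pMr// ltr1n.
  have /cvg_rnP /(_ 1 ltr01) [N hN] := ha z zr.
  have [B hB] := rn_bounded (fun k => a k * rho%:C ^+ k) N.
  exists (Num.max 2 B); first by rewrite lt_max ltr0n.
  move=> k; have -> : rn (a k) * rho ^+ k = rn (a k * rho%:C ^+ k).
    by rewrite rnM rnX rnC ?ltW.
  rewrite le_max; have [kN|Nk] := ltnP k N; first by rewrite hB ?orbT.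
  apply/orP; left.
  have h1 := hN _ Nk; have h2 := hN _ (leqW Nk).
  rewrite !seriesE zz in h1 h2.
  have -> : a k * rho%:C ^+ k =
      (f z - \sum_(0 <= k < k) a k * rho%:C ^+ k) -
      (f z - \sum_(0 <= k < k.+1) a k * rho%:C ^+ k).
    by rewrite big_nat_recr//=; ring.
  rewrite (le_trans (@rnormD R C^o _ _))// -[2]/(1 + 1) lerD// ltW//.
  by rewrite /rnorm normrN.
have hle (w : C) n : rn w <= rho / 2 ->
    rn (\sum_(0 <= k < n) (a k.+1 * w ^+ k.+1)) <= 2 * M * (rn w / rho).
  move=> wr; set t := rn w / rho.
  have t0 : 0 <= t by rewrite divr_ge0 ?rnorm_ge0 ?ltW.
  have t2 : t <= 2^-1 by rewrite ler_pdivrMr// mulrC.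
  have Mt0 : 0 <= M * t := mulr_ge0 (ltW M0) t0.
  have tk k : rn (a k.+1 * w ^+ k.+1) <= M * t * 2^-1 ^+ k.
    rewrite rnM rnX; have -> : rn w = rho * t by rewrite mulrC divfK ?gt_eqF.
    rewrite exprMn mulrA -mulrA.
    apply: (@le_trans _ _ (M * t ^+ k.+1)).
      by rewrite mulrA ler_wpM2r// exprn_ge0.
    rewrite exprS mulrA; apply: (ler_wpM2l Mt0).
    by apply: lerXn2r => //; rewrite nnegrE invr_ge0.
  have : rn (\sum_(0 <= k < n) (a k.+1 * w ^+ k.+1)) <=
      M * t * (2 - 2 * 2^-1 ^+ n).
    elim: n => [|n ih].
      by rewrite big_nil expr0 mulr1 subrr mulr0 /rnorm normr0.
    rewrite big_nat_recr//= (le_trans (@rnormD R C^o _ _))//.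
    apply: (le_trans (lerD ih (tk n))); rewrite -mulrDr.
    apply: (ler_wpM2l Mt0).
    by rewrite exprS mulrA mulfV// mul1r; lra.
  move=> /le_trans; apply; rewrite mulrC mulrA ler_wpM2r//.
  rewrite ler_wpM2r ?(ltW M0)// gerBl mulr_ge0// exprn_ge0//.
pose d := Num.min (rho / 2) (e * rho / (4 * M)).
exists d; first by rewrite lt_min !divr_gt0 ?mulr_gt0.
move=> z; rewrite lt_min => /andP[zr ze].
have rr : `|z - z0| < r%:C.
  rewrite rn_lt (lt_trans zr)// (@lt_trans _ _ rho)//;
  by rewrite ltr_pdivrMr// ltr_pMr// ltr1n.
have /cvg_rnP/(_ _ (divr_gt0 e0 (ltr0n R 2)))[N /(_ _ (leqnSn N))] := ha z rr.
rewrite seriesE S_recl f0 => h; have h2 := hle _ N (ltW zr).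
set S := \sum_(_ <= _ < _) _ in h h2.
have -> : f z - a 0%N = (f z - (a 0%N + S)) + S.
  by rewrite opprD addrA subrK.
rewrite (le_lt_trans (@rnormD R C^o _ _))// [e]splitr ltr_leD//.
rewrite (le_trans h2)// mulrA ler_pdivrMr//.
move: ze; rewrite ltr_pdivlMr ?mulr_gt0// => ze.
by nra.
Qed.

End Analytic.

Section PlaneMeasurability.
Variable R : realType.
Local Notation mR := (measurableTypeR R).

(* The library does not relate the product sigma-algebra on R * R to open
   sets. *)
Lemma open_plane_measurable (U : set (R * R)) :
  (forall w, U w -> exists2 d : R, 0 < d &
    forall v, `|v.1 - w.1| < d -> `|v.2 - w.2| < d -> U v) ->
  measurable (U : set (mR * mR)).
Proof.
move=> hU.
pose e n : R := n.+1%:R^-1.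
pose box (q : rat * rat * nat) : set (R * R) :=
  ball (ratr q.1.1 : R) (e q.2) `*` ball (ratr q.1.2 : R) (e q.2).
pose F n : set (R * R) :=
  if unpickle n is Some q then (if `[< box q `<=` U >] then box q else set0)
  else set0.
have -> : U = \bigcup_n F n.
  apply/seteqP; split=> [w Uw|w [n _]]; last first.
    rewrite /F; case: unpickle => // q; case: asboolP => // qU; exact: qU.
  have [d d0 hd] := hU w Uw.
  have [n hn] : exists n, 2 * e n < d.
    have d2 : 0 < d / 2 by rewrite divr_gt0.
    have [n _ /(_ n (leqnn n)) h] := near_infty_natSinv_lt (PosNum d2).
    by exists n; rewrite mulrC -ltr_pdivlMr.
  have e0 : 0 < e n by rewrite invr_gt0.
  have near_rat (x : R) : exists q : rat, `|ratr q - x| < e n.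
    have /rat_in_itvoo[q] : x < x + e n by rewrite ltrDl.
    rewrite in_itv/= => /andP[q1 q2]; exists q.
    by rewrite gtr0_norm ?subr_gt0// ltrBlDl.
  have [a ha] := near_rat w.1; have [b hb] := near_rat w.2.
  have [k hk] : exists k, unpickle k = Some (a, b, n).
    by eexists; exact: pickleK.
  exists k; first exact: I.
  rewrite /F hk.
  have bU : box (a, b, n) `<=` U.
    move=> v [/=]; rewrite /ball/= => va vb; apply: hd.
      rewrite -(subrKA (ratr a)) (le_lt_trans (ler_normD _ _))//.
      rewrite (lt_trans _ hn)// mulr_natl mulr2n ltrD// distrC//.
    rewrite -(subrKA (ratr b)) (le_lt_trans (ler_normD _ _))//.
    by rewrite (lt_trans _ hn)// mulr_natl mulr2n ltrD// distrC.
  by case: asboolP => // _; split; rewrite /ball/=.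
apply: bigcupT_measurable => n; rewrite /F.
case: unpickle => [q|]; last exact: measurable0.
case: asboolP => _; last exact: measurable0.
by apply: measurableX; exact: measurable_ball.
Qed.

Lemma lsc_plane_measurable (g : R * R -> R) :
  (forall w c, c < g w -> exists2 d : R, 0 < d &
    forall v, `|v.1 - w.1| < d -> `|v.2 - w.2| < d -> c < g v) ->
  measurable_fun setT (g : mR * mR -> R).
Proof.
move=> hg; apply: (measurability (@RGenOInfty.G R)).
  exact: RGenOInfty.measurableE.
move=> _ [_ [r ->] <-]; rewrite setTI; apply: open_plane_measurable => w /=.
rewrite in_itv/= andbT => /hg[d d0 hd]; exists d => // v v1 v2.
by rewrite /= in_itv/= andbT hd.
Qed.

End PlaneMeasurability.

Section BergmanSpace.
Variables (R : realType) (p : R).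
Hypothesis p1 : 1 <= p.
Local Notation C := R[i].
Local Notation rn z := (rnorm (z : C^o)).
Implicit Types f g : C -> C^o.

Definition unit_disk : set C := [set z | `|z| < 1].

Local Notation mR := (measurableTypeR R).

(* Lebesgue measure dx dy; the point (x, y) stands for x + iy. *)
Definition area : {measure set (mR * mR) -> \bar R} :=
  (lebesgue_measure \x lebesgue_measure)%E.

Definition bergman_integral f : \bar R :=
  (\int[area]_(w in
     [set w : mR * mR | unit_disk (w.1 +i* w.2)])
     (rnorm (f (w.1 +i* w.2)) `^ p)%:E)%E.

(* Functions on the disk are represented by their extensions by 0, so that
   equality of functions on the disk is Leibniz equality. *)
Definition bergman_function : {pred C -> C^o} := fun f =>
  `[< [/\ analytic_on unit_disk f, forall z, ~ unit_disk z -> f z = 0 &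
          (bergman_integral f < +oo)%E] >].

Definition bergman_norm f : R := fine (bergman_integral f) `^ p^-1.

Let F f (w : R * R) : R := rnorm (f (w.1 +i* w.2)).

Let F0 f w : 0 <= F f w. Proof. exact: rnorm_ge0. Qed.

Lemma bergmanP f : f \in bergman_function ->
  [/\ analytic_on unit_disk f, forall z, ~ unit_disk z -> f z = 0 &
          (bergman_integral f < +oo)%E].
Proof. by move=> /asboolP. Qed.

Let berg_pint f : (forall z, ~ unit_disk z -> f z = 0) ->
  bergman_integral f = pint area p (F f).
Proof.
move=> f0; rewrite /bergman_integral pint.unlock [LHS]integral_mkcond.
apply: eq_integral => w _; rewrite patchE; case: ifPn => //.
rewrite notin_setE => /= /f0; rewrite /F => ->.
by rewrite /rnorm normr0/= powR0// gt_eqF// (lt_le_trans _ p1).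
Qed.

Let F_lsc f : analytic_on unit_disk f -> (forall z, ~ unit_disk z -> f z = 0) ->
  forall w c, 0 <= c -> c < F f w -> exists2 d : R, 0 < d &
    forall v, `|v.1 - w.1| < d -> `|v.2 - w.2| < d -> c < F f v.
Proof.
move=> Af f0 w c c0 cw; set z := w.1 +i* w.2.
have Dz : unit_disk z.
  apply: contrapT => /f0 z0; move: cw; rewrite /F z0 /rnorm normr0/=.
  by rewrite ltNge c0.
have [d d0 hd] : exists2 d : R, 0 < d &
    forall y, rn (y - z) < d -> rn (f y - f z) < F f w - c.
  by apply: (analytic_continuous Af Dz); rewrite subr_gt0.
exists (d / 2); first by rewrite divr_gt0.
move=> v v1 v2; set y := v.1 +i* v.2.
have : rn (y - z) < d.
  apply: (le_lt_trans (rn_pair (v.1 - w.1) (v.2 - w.2))).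
  by rewrite [d]splitr ltrD.
move=> /hd h; rewrite /F -/y -(ltrD2r (F f w - c)) addrC subrK.
have := @rnormD R C^o (f y) (- (f y - f z)).
rewrite opprB addrC subrK => h2.
rewrite (le_lt_trans h2)// ltrD2l//.
by move: h; rewrite -opprB /rnorm normrN.
Qed.

Let F_measurable f : analytic_on unit_disk f ->
  (forall z, ~ unit_disk z -> f z = 0) ->
  measurable_fun setT (F f : mR * mR -> R).
Proof.
move=> Af f0; apply: lsc_plane_measurable => w c cw.
have [c0|c0] := leP 0 c; first exact: F_lsc.
by exists 1 => // v _ _; rewrite (lt_le_trans c0).
Qed.

Lemma bergman_add f g : f \in bergman_function -> g \in bergman_function ->
  f + g \in bergman_function /\
  bergman_norm (f + g) <= bergman_norm f + bergman_norm g.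
Proof.
move=> /bergmanP[Af f0 foo] /bergmanP[Ag g0 goo].
have Afg : analytic_on unit_disk (f + g).
  by rewrite -[f]scale1r; exact: analytic_on_lin.
have fg0 z : ~ unit_disk z -> (f + g) z = 0.
  move=> Dz; change (f z + g z = 0); by rewrite f0// g0// addr0.
rewrite /bergman_norm !berg_pint//.
rewrite !berg_pint// in foo goo.
have [] := pint_triangle p1 (F_measurable Af f0) (F_measurable Ag g0)
  (F_measurable Afg fg0) (F0 f) (F0 g) (F0 _) _ foo goo.
  by move=> w; exact: rnormD.
by move=> h ?; split=> //; apply/asboolP; split=> //; rewrite berg_pint.
Qed.

Lemma bergman_scale a f : f \in bergman_function ->
  a *: f \in bergman_function /\
  bergman_norm (a *: f) = rn a * bergman_norm f.
Proof.
move=> /bergmanP[Af f0 foo].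
have Afg : analytic_on unit_disk (a *: f).
  have Z : analytic_on unit_disk (0 : C -> C^o).
    have -> : (0 : C -> C^o) = (-1) *: f + f by rewrite scaleN1r addNr.
    exact: analytic_on_lin.
  by rewrite -[_ *: _]addr0; exact: analytic_on_lin.
have fg0 z : ~ unit_disk z -> (a *: f) z = 0.
  by move=> Dz; change (a *: f z = 0); rewrite f0// scaler0.
rewrite /bergman_norm !berg_pint//.
rewrite !berg_pint// in foo.
have [] := pint_scale p1 (F_measurable Af f0) (F0 f) (rnorm_ge0 (a : C^o)) foo.
have -> : (fun w => rn a * F f w) = F (a *: f).
  by apply/funext => w; rewrite /F -rnormZ.
by move=> h ?; split=> //; apply/asboolP; split=> //; rewrite berg_pint.
Qed.

Lemma bergman_closed : submod_closed bergman_function.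
Proof.
split.
  apply/asboolP; split=> //.
  - move=> z0 _; exists 1, (fun=> 0); split=> // z _.
    apply/cvg_rnP => e e0; exists 0%N => n _; rewrite seriesE big1.
      by rewrite /rnorm subr0 normr0.
    by move=> k _; rewrite mul0r.
  - rewrite berg_pint// pint.unlock integral0_eq ?ltry// => w _.
    rewrite /F /rnorm normr0/= powR0// gt_eqF// (lt_le_trans _ p1)//.
move=> a f g bf bg; have [baf _] := bergman_scale a bf.
by have [] := bergman_add baf bg.
Qed.

Lemma bergman_normD : {in bergman_function &, forall f g,
  bergman_norm (f + g) <= bergman_norm f + bergman_norm g}.
Proof. by move=> f g bf bg; have [] := bergman_add bf bg. Qed.

Lemma bergman_normZ a : {in bergman_function, forall f,
  bergman_norm (a *: f) = rn a * bergman_norm f}.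
Proof. by move=> f bf; have [] := bergman_scale a bf. Qed.

Lemma bergman_norm_eq0 : {in bergman_function, forall f,
  bergman_norm f = 0 -> f = 0}.
Proof.
move=> f /bergmanP[Af f0 foo] /powR_eq0_eq0 /eqP.
rewrite !berg_pint// in foo *.
rewrite fine_eq0 ?ge0_fin_numE ?pint_ge0// => /eqP pf.
apply/funext => z; apply: (@rnorm_eq0 R C^o).
apply: contrapT => /eqP fz; have {fz} fz : 0 < rn (f z).
  by rewrite lt_def fz rnorm_ge0.
set c := rn (f z) / 2; have c0 : 0 < c by rewrite divr_gt0.
have [d d0 hd] : exists2 d : R, 0 < d & forall v, `|v.1 - complex.Re z| < d ->
    `|v.2 - complex.Im z| < d -> c < F f v.
  apply: (F_lsc Af f0 (w := (complex.Re z, complex.Im z)) (ltW c0)).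
  have -> : F f (complex.Re z, complex.Im z) = rn (f z).
    by rewrite /F; case: (z).
  by rewrite ltr_pdivrMr// ltr_pMr// ltr1n.
pose B : set (R * R) := ball (complex.Re z) d `*` ball (complex.Im z) d.
have mB : measurable (B : set (mR * mR)).
  by apply: measurableX; exact: measurable_ball.
have BE : area B = ((d *+ 2) * (d *+ 2))%:E.
  have mb (x : R) : measurable (ball x d : set mR) by exact: measurable_ball.
  apply: (etrans (product_measure1E lebesgue_measure lebesgue_measure
    (mb (complex.Re z)) (mb (complex.Im z)))).
  have lb (x : R) := lebesgue_measure_ball x (ltW d0).
  by rewrite EFinM; congr (_ * _)%E; exact: lb.
have mF := (measurable_EFinP _ _).2 (measurable_powRp p (F_measurable Af f0)).
have h1 : (\int[area]_(w in B) (cst (c `^ p)%:E w) <= 0)%E.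
  rewrite -pf pint.unlock.
  apply: (@le_trans _ _ (\int[area]_(w in B) (F f w `^ p)%:E)%E).
    apply: ge0_le_integral => //.
    - by move=> w _; rewrite lee_fin powR_ge0.
    - exact: measurable_funS mF.
    - move=> w [/= w1 w2]; rewrite lee_fin ge0_ler_powR ?nnegrE ?F0//.
      + by rewrite (le_trans _ p1).
      + exact: ltW.
      + by rewrite ltW// hd// distrC.
  apply: ge0_subset_integral => //.
  by move=> w _; rewrite lee_fin powR_ge0.
move: h1; rewrite integral_cst// [X in (_ * X)%E]BE -EFinM lee_fin leNgt.
by rewrite !mulr_gt0 ?powR_gt0// pmulrn_lgt0.
Qed.

Definition bergman : normed_submod (C -> C^o) :=
  NormedSubmod bergman_closed bergman_normD bergman_normZ bergman_norm_eq0.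

Definition bergman_space : normedModType R[i] := ns_type bergman.

End BergmanSpace.

(* Main.v *)
(* On a compact part of the disk, the functions of the unit ball of B_p are bounded
   and Lipschitz with uniform constants: the maximum principle bounds the Taylor
   coefficients of f at z0 on a disk independent of f, the average of f over the
   n-th roots of unity of a circle around z0 then differs from f(z0) by O(2^-n),
   and the invariance of the area under rotations turns it into an integral.

   Sampling f at one point of each cell of a partition of the disk into countably
   many cells where the unit ball oscillates by at most e, with weights
   area(cell)^(1/p), is therefore an almost isometry of B_p into l_p.

   The dilations D_s f(z) = f(s z), s < 1, are compact, close to f on compact parts
   of the disk, and negligible near the unit circle.  If s_1, ..., s_N tend rapidly
   to 1, the average K of the D_(s_j) differs from the multiplication by a radial
   step function with values in [0, 1] by errors supported by N disjoint annuli,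
   hence by O(N^(1/p - 1)); here p > 1 is used.  This yields compact operators K_n
   such that, for m > n, K_n S K_n + (I - K_m) T (I - K_m) has norm at most
   max(|S|, |T|) + O(1/n), the two terms having almost disjoint ranges and almost
   disjoint "domains".  Moreover K_n T -> T and T K_n -> T in norm for T compact, the
   latter because sums of N almost disjoint unit vectors have norm O(N^(1/p)) = o(N).
   The projection e -> lim e(K_n . K_n) along an ultrafilter is then an
   L-projection of the dual of L(B_p) with kernel the annihilator of K(B_p). *)
Require Import Defs.
From mathcomp Require Import all_boot all_order all_algebra.
From mathcomp Require Import all_classical all_reals all_analysis.
From mathcomp Require Import complex.
From mathcomp Require Import cyclic separable cyclotomic measurable_realfun.
From mathcomp Require Import ring lra.

Set Implicit Arguments.
Unset Strict Implicit.
Unset Printing Implicit Defensive.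

Import Order.TTheory GRing.Theory Num.Theory.
Import numFieldNormedType.Exports.

Local Open Scope classical_set_scope.
Local Open Scope complex_scope.
Local Open Scope ring_scope.

(** * Power series and the maximum principle *)

(** The definition of an M-ideal leaves no room for a constant factor, so the two-term estimate for
    the compact approximations must hold with asymptotic constant 1. This is why a single dilation
    is not enough: on the annulus between the region where it is close to the identity and the
    region where it is negligible, its error is comparable with [f] itself, and its norm is only
    known to be at most 4. Limits along an ultrafilter serve two purposes. A bounded scalar sequence
    gets a limit that depends linearly on the sequence, which makes the projection on the dual a
    linear map even though the sequences of values need not converge. The same limits replace the
    extraction of subsequences when a maximum is attained or a Cauchy sequence of analytic functions
    has an analytic limit. Only roots of unity of odd order are used to average over the area. They
    never equal -1, the one rotation that is not a product of three shears, and odd orders still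
    tend to infinity. *)

Section Modulus.
Variable R : realType.
Local Notation C := R[i].
Local Notation rn z := (rnorm (z : C^o)).

Lemma rn_ge0 (z : C) : 0 <= rn z. Proof. exact: rnorm_ge0. Qed.

Lemma rn0 : rn 0 = 0. Proof. by rewrite /rnorm normr0. Qed.

Lemma rnD (z w : C) : rn (z + w) <= rn z + rn w.
Proof. exact: (@rnormD R C^o). Qed.

Lemma rnN (z : C) : rn (- z) = rn z.
Proof. by rewrite /rnorm normrN. Qed.

Lemma rnB (z w : C) : rn (z - w) <= rn z + rn w.
Proof. by rewrite -[rn w]rnN; exact: rnD. Qed.

Lemma rn_distC (z w : C) : rn (z - w) = rn (w - z).
Proof. by rewrite -rnN opprB. Qed.

Lemma rn_eq0 (z : C) : rn z = 0 -> z = 0.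
Proof. exact: (@rnorm_eq0 R C^o). Qed.

Lemma rn_gt0 (z : C) : z != 0 -> 0 < rn z.
Proof.
by move=> z0; rewrite lt_def rn_ge0 andbT; apply: contra z0 => /eqP/rn_eq0 ->.
Qed.

Lemma rnV (z : C) : rn z^-1 = (rn z)^-1.
Proof.
have [->|z0] := eqVneq z 0; first by rewrite invr0 rn0 invr0.
have h : rn z * rn z^-1 = 1 by rewrite -rnM divff// rn1.
by rewrite -[RHS]mulr1 -h mulKf// gt_eqF// rn_gt0.
Qed.

Lemma rnR (x : R) : rn x%:C = `|x|.
Proof.
by have [x0|x0] := leP 0 x; [rewrite rnC// ger0_norm | rewrite -rnN
  -raddfN rnC ?ltr0_norm// oppr_ge0 ltW].
Qed.

Lemma rn_sum (I : Type) (r : seq I) (P : pred I) (F : I -> C) :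
  rn (\sum_(i <- r | P i) F i) <= \sum_(i <- r | P i) rn (F i).
Proof.
elim/big_ind2 : _ => [|x u y v ux vy|i _]; first by rewrite rn0.
  by rewrite (le_trans (rnD _ _))// lerD.
by [].
Qed.

Lemma rn_natmul n (z : C) : rn (z *+ n) = rn z *+ n.
Proof.
by rewrite -mulr_natl rnM -(rmorph_nat (real_complex R)) rnR normr_nat mulr_natl.
Qed.
End Modulus.

(** * Power series with explicit geometric remainders *)

Section LocalPowerSeries.
Variable R : realType.
Local Notation C := R[i].
Local Notation rn z := (rnorm (z : C^o)).
Implicit Types (f g : C -> C) (b : nat -> C) (w z h : C) (s M : R).

(* [f (w + h)] is the sum of [b k * h ^+ k] for [rn h < s], with a geometric
   bound on the remainders. *)
Definition has_ps f w s M b := forall n h, rn h <= s ->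
  rn (f (w + h) - \sum_(0 <= k < n) b k * h ^+ k) <= M * (rn h / s) ^+ n.

Lemma has_ps_value f w s M b : 0 < s -> has_ps f w s M b -> f w = b 0%N.
Proof.
move=> s0 /(_ 1%N 0); rewrite rn0 (ltW s0) addr0 big_nat1 expr0 mulr1 mul0r.
rewrite expr1 mulr0 => /(_ isT) h; apply/subr0_eq/rn_eq0/le_anti.
by rewrite h rn_ge0.
Qed.

Lemma has_ps_ge0 f w s M b : 0 < s -> has_ps f w s M b -> 0 <= M.
Proof.
move=> s0 /(_ 0%N 0); rewrite rn0 (ltW s0) big_geq// expr0 mulr1 => /(_ isT).
exact/le_trans/rn_ge0.
Qed.

Lemma has_ps_le f w s s' M b : 0 < s' -> s' <= s -> has_ps f w s M b ->
  has_ps f w s' M b.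
Proof.
move=> s'0 ss fb n h hs; apply: (le_trans (fb n h (le_trans hs ss))).
have s0 := lt_le_trans s'0 ss.
rewrite ler_wpM2l ?(has_ps_ge0 s0 fb)//.
apply: lerXn2r; rewrite ?nnegrE ?divr_ge0 ?rn_ge0 ?(ltW s0) ?(ltW s'0)//.
by rewrite ler_wpM2l ?rn_ge0// lef_pV2.
Qed.

(** At [h = s] the term of degree [n] is the difference of two consecutive remainders, each at most
    [M]. *)
Lemma has_ps_coef f w s M b n : 0 < s -> has_ps f w s M b ->
  rn (b n) <= 2 * M / s ^+ n.
Proof.
move=> s0 fb.
have rs : rn s%:C = s by rewrite rnC// ltW.
have h1 := fb n s%:C; have h2 := fb n.+1 s%:C.
rewrite rs lexx divff ?gt_eqF// !expr1n mulr1 in h1 h2.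
rewrite ler_pdivlMr ?exprn_gt0// -{1}rs -rnX -rnM.
have -> : b n * s%:C ^+ n =
   (f (w + s%:C) - \sum_(0 <= k < n) b k * s%:C ^+ k) -
   (f (w + s%:C) - \sum_(0 <= k < n.+1) b k * s%:C ^+ k).
  by rewrite big_nat_recr//=; ring.
rewrite (le_trans (rnB _ _))//; have := h1 isT; have := h2 isT; lra.
Qed.

(** Convergence at distance [r / 2] bounds the terms there by some [M]; for [rn h <= r / 4] the
    tails are dominated by a geometric series of ratio at most 1/2. Mere convergence thus becomes an
    estimate that survives limits. *)
Lemma series_has_ps f w r b : 0 < r ->
  (forall z, `|z - w| < r%:C ->
    [series b k * (z - w) ^+ k : C^o]_k @ \oo --> (f z : C^o)) ->
  exists s M, 0 < s /\ has_ps f w s M b.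
Proof.
move=> r0 hf; pose rho := r / 2; have rho0 : 0 < rho by rewrite divr_gt0.
have [M M0 hM] : exists2 M : R, 0 < M & forall k, rn (b k) * rho ^+ k <= M.
  pose z := w + rho%:C.
  have zz : z - w = rho%:C by rewrite addrAC subrr add0r.
  have zr : `|z - w| < r%:C.
    by rewrite zz rn_lt rnC ?(ltW rho0)// ltr_pdivrMr// ltr_pMr// ltr1n.
  have /cvg_rnP /(_ 1 ltr01) [N hN] := hf z zr.
  have [B hB] := rn_bounded (fun k => b k * rho%:C ^+ k) N.
  (* From [N] on the partial sums are within 1 of the limit, so consecutive ones differ by at most
     2; [B] covers the earlier terms. *)
  exists (Num.max 2 B); first by rewrite lt_max ltr0n.
  move=> k; have -> : rn (b k) * rho ^+ k = rn (b k * rho%:C ^+ k).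
    by rewrite rnM rnX rnC ?ltW.
  rewrite le_max; have [kN|Nk] := ltnP k N; first by rewrite hB ?orbT.
  apply/orP; left; have h1 := hN _ Nk; have h2 := hN _ (leqW Nk).
  rewrite !seriesE zz in h1 h2.
  have -> : b k * rho%:C ^+ k =
      (f z - \sum_(0 <= k < k) b k * rho%:C ^+ k) -
      (f z - \sum_(0 <= k < k.+1) b k * rho%:C ^+ k).
    by rewrite big_nat_recr//=; ring.
  by rewrite (le_trans (rnB _ _))//; move: h1 h2 => /ltW + /ltW; lra.
exists (rho / 2), (2 * M); split; first by rewrite divr_gt0.
move=> n h hs; set t := rn h / rho.
have t0 : 0 <= t by rewrite divr_ge0 ?rn_ge0// ltW.
have t2 : t <= 2^-1 by rewrite ler_pdivrMr// mulrC.
have ht : rn h = rho * t by rewrite mulrC divfK ?gt_eqF.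
have tk k : rn (b k * h ^+ k) <= M * t ^+ k.
  rewrite rnM rnX ht exprMn mulrA ler_wpM2r ?exprn_ge0//.
have tail m : rn (\sum_(n <= k < n + m) b k * h ^+ k) <=
    M * t ^+ n * (2 - 2 * 2^-1 ^+ m).
  elim: m => [|m ih].
    by rewrite addn0 big_geq// rn0 expr0 mulr1 subrr mulr0.
  rewrite addnS big_nat_recr ?leq_addr//= (le_trans (rnD _ _))//.
  apply: (le_trans (lerD ih (tk _))).
  rewrite exprD mulrA -mulrDr ler_wpM2l ?mulr_ge0 ?exprn_ge0 ?(ltW M0)//.
  have := @lerXn2r _ m t 2^-1; rewrite !nnegrE t0 invr_ge0 ler0n => /(_ isT isT t2).
  by rewrite exprS mulrA mulfV// mul1r; lra.
apply/ler_addgt0Pr => e e0.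
have hr : `|(w + h) - w| < r%:C.
  rewrite addrAC subrr add0r rn_lt (le_lt_trans hs)// (@lt_trans _ _ rho)//.
    by rewrite ltr_pdivrMr// ltr_pMr// ltr1n.
  by rewrite ltr_pdivrMr// ltr_pMr// ltr1n.
have /cvg_rnP/(_ _ e0)[N /(_ (n + N)%N (leq_addl _ _))] := hf _ hr.
rewrite seriesE addrAC subrr add0r (@big_cat_nat _ _ _ n)/= ?leq_addr// => hN.
have -> : f (w + h) - \sum_(0 <= k < n) b k * h ^+ k =
    (f (w + h) - (\sum_(0 <= k < n) b k * h ^+ k +
      \sum_(n <= k < n + N) b k * h ^+ k)) + \sum_(n <= k < n + N) b k * h ^+ k.
  by ring.
rewrite (le_trans (rnD _ _))// addrC lerD//; last exact: ltW.
apply: (le_trans (tail N)).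
have -> : rn h / (rho / 2) = 2 * t by rewrite invf_div mulrCA mulrC.
have p2 : 1 <= (2 : R) ^+ n by rewrite exprn_ege1// ler1n.
have q2 : 0 <= (2^-1 : R) ^+ N by rewrite exprn_ge0.
have A0 : 0 <= M * t ^+ n by rewrite mulr_ge0 ?exprn_ge0 ?(ltW M0).
have -> : 2 * M * (2 * t) ^+ n = M * t ^+ n * (2 * 2 ^+ n).
  by rewrite (exprMn _ 2 t); ring.
by rewrite ler_wpM2l//; lra.
Qed.

Lemma has_ps_series f w s M b z : 0 < s -> has_ps f w s M b ->
  `|z - w| < s%:C ->
  [series b k * (z - w) ^+ k : C^o]_k @ \oo --> (f z : C^o).
Proof.
move=> s0 fb; rewrite rn_lt => zs; apply/cvg_rnP => e e0.
set t := rn (z - w) / s.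
have t0 : 0 <= t by rewrite divr_ge0 ?rn_ge0// ltW.
have t1 : t < 1 by rewrite ltr_pdivrMr// mul1r.
have M0 := has_ps_ge0 s0 fb.
have := @cvg_expr R t; rewrite ger0_norm// => /(_ t1) /cvgrPdist_lt.
have M10 : 0 < M + 1 by rewrite ltr_wpDl.
move=> /(_ (e / (M + 1)))[|N _ hN]; first by rewrite divr_gt0.
exists N => n Nn; rewrite seriesE.
have := fb n (z - w) (ltW zs); rewrite [w + _]addrC subrK => h.
apply: (le_lt_trans h).
have := hN n Nn; rewrite /= sub0r normrN ger0_norm ?exprn_ge0//.
rewrite ltr_pdivlMr// => h2.
rewrite (le_lt_trans _ h2)// mulrC ler_wpM2l ?exprn_ge0// lerDl//.
Qed.

End LocalPowerSeries.

(** * Existence of limits along ultrafilters *)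

Section UltraLimits.
Variables (T : Type) (U : set_system T) (R : realType).
Hypothesis hU : UltraFilter U.
Local Notation C := R[i].
Local Notation rn z := (rnorm (z : C^o)).

(** The limit is the supremum of the [y] such that [y <= x t] on a member of [U]; beyond it, the
    ultrafilter contains the complementary set. *)
Lemma ultra_real_lim (x : T -> R) (B : R) : (forall t, `|x t| <= B) ->
  exists l, forall e, 0 < e -> U [set t | `|x t - l| < e].
Proof.
move=> xB; have FU : ProperFilter U := ultra_proper.
pose A := [set y | U [set t | y <= x t]].
have A0 : A (- B).
  by apply: filterS (@filterT _ U _) => t _ /=; case/ler_normlP: (xB t); lra.
have hA : has_sup A.
  split; first by exists (- B).
  exists B => y /filter_ex [t /= yt]; apply: (le_trans yt).
  by case/ler_normlP: (xB t).
exists (sup A) => e e0.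
have [y Ay ye] := sup_adherent e0 hA.
have nA : ~ A (sup A + e / 2).
  move=> /(ub_le_sup hA.2); lra.
have [//|h2] := in_ultra_setVsetC [set t | sup A + e / 2 <= x t] hU.
apply: filterS (filterI Ay h2) => t /= [yt /negP]; rewrite -ltNge => te.
by rewrite ltr_norml; lra.
Qed.

Lemma ultra_lim (x : T -> C) (B : R) : (forall t, rn (x t) <= B) ->
  exists l : C, forall e, 0 < e -> U [set t | rn (x t - l) < e].
Proof.
move=> xB; have FU : ProperFilter U := ultra_proper.
have hre (z : C) : `|complex.Re z| <= rn z /\ `|complex.Im z| <= rn z.
  have z0 := rn_ge0 z.
  have zz : rn z ^+ 2 = complex.Re z ^+ 2 + complex.Im z ^+ 2.
    by rewrite /rnorm normc_def/= sqr_sqrtr// addr_ge0 ?sqr_ge0.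
  split; rewrite -(@ler_pXn2r _ 2)// ?nnegrE// real_normK ?num_real// zz.
    by rewrite lerDl sqr_ge0.
  by rewrite lerDr sqr_ge0.
have [a ha] := @ultra_real_lim (fun t => complex.Re (x t)) B
  (fun t => le_trans (hre (x t)).1 (xB t)).
have [b hb] := @ultra_real_lim (fun t => complex.Im (x t)) B
  (fun t => le_trans (hre (x t)).2 (xB t)).
exists (a +i* b) => e e0.
have e2 : 0 < e / 2 by rewrite divr_gt0.
apply: filterS (filterI (ha _ e2) (hb _ e2)) => t /= [h1 h2].
have -> : x t - (a +i* b) = (complex.Re (x t) - a) +i* (complex.Im (x t) - b).
  by case: (x t).
by rewrite (le_lt_trans (rn_pair _ _))//; lra.
Qed.

Lemma ultra_le (y : T -> R) (c : R) : U [set t | y t <= c] ->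
  forall l, (forall e, 0 < e -> U [set t | `|y t - l| < e]) -> l <= c.
Proof.
move=> h l hl; have FU : ProperFilter U := ultra_proper.
apply/ler_addgt0Pr => e e0.
have [t /= [h1]] := filter_ex (filterI h (hl _ e0)).
by rewrite ltr_norml; lra.
Qed.

End UltraLimits.

Lemma ultra_nat : exists U : set_system nat, UltraFilter U /\
  forall N, U [set n | (N <= n)%N].
Proof.
have [U [hU oU]] := @ultraFilterLemma nat \oo _.
by exists U; split=> // N; apply: oU; exists N.
Qed.

(** * Averages over roots of unity *)

Section RootsOfUnity.
Variable R : realType.
Local Notation C := R[i].
Local Notation rn z := (rnorm (z : C^o)).

(** In characteristic 0, ['X^n - 1] is separable, so it has [n] distinct roots in the algebraically
    closed field; such a set contains a primitive one. *)
Lemma complex_prim_root n : (0 < n)%N -> exists w : C, n.-primitive_root w.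
Proof.
move=> n0; have [r Dr] := closed_field_poly_normal ('X^n - 1 : {poly C}).
rewrite (monicP _) ?monicXnsubC// scale1r in Dr.
have [|||w _ hw] := hasP (@has_prim_root _ n r n0 _ _ _).
- by apply/allP => z; rewrite -root_prod_XsubC -Dr.
- by rewrite -separable_prod_XsubC -Dr separable_Xn_sub_1// pnatr_eq0 -lt0n.
- by rewrite -ltnS -(size_prod_XsubC r id) -Dr size_XnsubC.
by exists w.
Qed.

Lemma prim_root_rn n (w : C) : n.-primitive_root w -> rn w = 1.
Proof.
move=> hw; have n0 := prim_order_gt0 hw.
apply/eqP; rewrite -(@pexpr_eq1 _ _ n)// ?rn_ge0//.
by rewrite -rnX (prim_expr_order hw) rn1.
Qed.

Lemma sum_prim_root n (w : C) k : n.-primitive_root w -> (0 < k < n)%N ->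
  \sum_(j < n) (w ^+ j) ^+ k = 0.
Proof.
move=> hw /andP[k0 kn].
have : w ^+ k != 1.
  by rewrite -(prim_order_dvd hw) gtnNdvd.
rewrite -subr_eq0 => wk; apply: (mulfI wk); rewrite mulr0.
under eq_bigr do rewrite exprAC.
by rewrite -subrX1 exprAC (prim_expr_order hw) expr1n subrr.
Qed.

(** A mean value property by finite sums: averaging over the roots kills the powers of degree
    strictly between 0 and [n], so only the remainder of order [n] is left as an error. *)
Lemma has_ps_mean (f : C -> C) w s M b n (om : C) h : has_ps f w s M b ->
  n.-primitive_root om -> rn h <= s ->
  rn (f w *+ n - \sum_(j < n) f (w + om ^+ j * h)) <=
  (M * (rn h / s) ^+ n) *+ n.
Proof.
move=> fb hom hs; have n0 := prim_order_gt0 hom.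
have rj (j : nat) : rn (om ^+ j * h) = rn h.
  by rewrite rnM rnX (prim_root_rn hom) expr1n mul1r.
have s0 : 0 <= s := le_trans (rn_ge0 h) hs.
have -> : f w *+ n = \sum_(j < n) \sum_(0 <= k < n) b k * (om ^+ j * h) ^+ k.
  rewrite exchange_big/= big_ltn//=.
  under eq_bigr do rewrite expr0 mulr1.
  rewrite sumr_const card_ord big1_seq ?addr0; last first.
    move=> k; rewrite mem_index_iota => /andP[_ kn].
    under eq_bigr do rewrite exprMn mulrCA mulrC.
    by rewrite -mulr_sumr sum_prim_root ?mulr0.
  move: (fb 1%N 0); rewrite rn0 s0 addr0 big_nat1 expr0 mulr1 mul0r.
  rewrite expr1 mulr0 => /(_ isT) h0.
  by congr (_ *+ _); apply/subr0_eq/rn_eq0/le_anti; rewrite h0 rn_ge0.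
rewrite -sumrB (le_trans (rn_sum _ _ _))//.
have -> : (M * (rn h / s) ^+ n) *+ n = \sum_(j < n) M * (rn h / s) ^+ n.
  by rewrite sumr_const card_ord.
apply: ler_sum => j _; rewrite rn_distC -(rj j); apply: fb.
by rewrite rj.
Qed.

End RootsOfUnity.

(** * Difference quotients, maximum principle and coefficient bounds *)

Section LocallyPowerSeries.
Variable R : realType.
Local Notation C := R[i].
Local Notation rn z := (rnorm (z : C^o)).
Implicit Types (f g : C -> C) (b : nat -> C) (w z h : C) (s M : R).

Definition locally_ps (A : set C) f := forall w, A w ->
  exists s M b, 0 < s /\ has_ps f w s M b.

Lemma analytic_onP (A : set C) f : analytic_on A f <-> locally_ps A f.
Proof.
split=> hf w Aw.
  have [r [b [r0 hb]]] := hf w Aw.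
  by have [s [M [s0 fb]]] := series_has_ps r0 hb; exists s, M, b.
have [s [M [b [s0 fb]]]] := hf w Aw.
by exists s, b; split=> // z; exact: has_ps_series fb.
Qed.

(** When [b] is the Taylor sequence of [f] at [z0], the value [b 1%N] is the derivative; it removes
    the singularity, so the quotient is again locally a power series. *)
Definition div_quot f z0 b z : C :=
  if z == z0 then b 1%N else (f z - b 0%N) / (z - z0).

Lemma div_quotE f z0 b z : f z0 = b 0%N ->
  f z = b 0%N + (z - z0) * div_quot f z0 b z.
Proof.
move=> f0; rewrite /div_quot; have [->|zz] := eqVneq z z0.
  by rewrite subrr mul0r addr0.
by rewrite mulrC divfK ?subr_eq0// addrC subrK.
Qed.

Lemma has_ps_div_center f z0 s M b : 0 < s -> has_ps f z0 s M b ->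
  has_ps (div_quot f z0 b) z0 s (2 * M / s) (fun k => b k.+1).
Proof.
move=> s0 fb n h hs; have f0 := has_ps_value s0 fb.
have M0 := has_ps_ge0 s0 fb.
(* At [h = 0] the quotient is [b 1%N]; its bound [2 * M / s] dictates the constant, [M / s] being
   enough elsewhere. *)
have [->|h0] := eqVneq h 0.
  rewrite rn0 mul0r addr0 /div_quot eqxx.
  case: n => [|n].
    rewrite big_geq// subr0 expr0 mulr1.
    by have := has_ps_coef 1 s0 fb; rewrite expr1.
  rewrite big_nat_recl// expr0 mulr1 big1 ?addr0 ?subrr ?rn0.
    by rewrite expr0n/= mulr0.
  by move=> k _; rewrite expr0n/= mulr0.
have rh := rn_gt0 h0.
have := fb n.+1 h hs; rewrite (div_quotE _ f0) [z0 + h]addrC addrK.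
rewrite big_nat_recl// expr0 mulr1 opprD addrACA subrr add0r.
have -> : \sum_(0 <= i < n) b i.+1 * h ^+ i.+1 =
   h * \sum_(0 <= i < n) b i.+1 * h ^+ i.
  by rewrite mulr_sumr; apply: eq_bigr => i _; rewrite exprS mulrCA.
rewrite -mulrBr rnM -ler_pdivlMl// => /le_trans; apply.
set t := rn h / s; have t0 : 0 <= t by rewrite divr_ge0 ?rn_ge0// ltW.
have -> : (rn h)^-1 * (M * t ^+ n.+1) = M / s * t ^+ n.
  by rewrite /t exprS; field; rewrite !gt_eqF.
rewrite ler_wpM2r ?exprn_ge0// ler_wpM2r ?invr_ge0 ?(ltW s0)//; lra.
Qed.

(** Division of the series of [f - c] by [u + h], which does not vanish for [rn h <= rn u / 2]. *)
Lemma has_ps_div_off f w s M b z0 b' : 0 < s -> has_ps f w s M b -> w != z0 ->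
  exists s' M' e, 0 < s' /\ has_ps (div_quot f z0 b') w s' M' e.
Proof.
move=> s0 fb wz; pose u := w - z0; pose c := b' 0%N.
have u0 : u != 0 by rewrite subr_eq0.
have ru := rn_gt0 u0.
pose s' := Num.min s (rn u / 2).
have s'0 : 0 < s' by rewrite lt_min s0 divr_gt0.
have {fb} fb : has_ps f w s' M b by apply: has_ps_le fb; rewrite // ge_min lexx.
have s'u : s' <= rn u / 2 by rewrite ge_min lexx orbT.
(* These coefficients solve [(u + h) * e = b - c] degree by degree. Since [s' <= rn u / 2], the
   recursion halves the previous bound and adds a constant, so [B] bounds all
   [rn (e k) * s' ^+ k]. *)
pose e := fix e k := if k is k'.+1 then (b k - e k') / u else (b 0%N - c) / u.
pose B := 2 * (2 * M + rn c) / rn u.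
have M0 := has_ps_ge0 s'0 fb.
have B0 : 0 <= B.
  by rewrite divr_ge0 ?mulr_ge0 ?addr_ge0 ?mulr_ge0 ?rn_ge0.
have bk k : rn (b k) * s' ^+ k <= 2 * M.
  by rewrite -ler_pdivlMr ?exprn_gt0//; exact: has_ps_coef fb.
have ek k : rn (e k) * s' ^+ k <= B.
  elim: k => [|k ih] /=; rewrite rnM rnV mulrAC ler_pdivrMr// /B divfK ?gt_eqF//.
    rewrite expr0 mulr1 (le_trans (rnB _ _))//.
    have := bk 0%N; rewrite expr0 mulr1; have := rn_ge0 c; nra.
  apply: (@le_trans _ _ ((rn (b k.+1) + rn (e k)) * s' ^+ k.+1)).
    by rewrite ler_wpM2r ?rnB// exprn_ge0// ltW.
  rewrite mulrDl; have := bk k.+1.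
  have : rn (e k) * s' ^+ k.+1 <= 2 * M + rn c.
    rewrite exprS mulrCA; apply: (@le_trans _ _ (rn u / 2 * B)).
      by apply: ler_pM; rewrite ?mulr_ge0 ?rn_ge0 ?exprn_ge0 ?(ltW s'0).
    by rewrite le_eqVlt; apply/orP; left; apply/eqP; rewrite /B; field; rewrite gt_eqF.
  have := rn_ge0 c; lra.
pose K := rn c + B * s'.
exists s', (2 / rn u * (M + K)), e; split=> // n h hs.
set t := rn h / s'; have t0 : 0 <= t by rewrite divr_ge0 ?rn_ge0// ltW.
have ht : rn h = t * s' by rewrite divfK ?gt_eqF.
have uh : rn u / 2 <= rn (u + h).
  have := rnB (u + h) h; rewrite addrK; have := le_trans hs s'u; lra.
have uh0 : 0 < rn (u + h) by apply: lt_le_trans uh; rewrite divr_gt0.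
have whz : w + h - z0 = u + h by rewrite addrAC.
have whn : w + h != z0.
  rewrite -subr_eq0 whz; apply/eqP => uh1; by rewrite uh1 rn0 ltxx in uh0.
rewrite /div_quot (negbTE whn) whz -/c.
(* Truncating at degree [n] leaves a defect [d]: the top term [e n.-1 * h ^+ n] of the product, or
   [c] when [n = 0]. The two summands of [K] cover these cases. *)
have key : exists2 d, rn d <= K * t ^+ n &
   (u + h) * ((f (w + h) - c) / (u + h) - \sum_(0 <= k < n) e k * h ^+ k) =
   (f (w + h) - \sum_(0 <= k < n) b k * h ^+ k) - d.
  have uhn : u + h != 0 by rewrite -whz subr_eq0.
  rewrite mulrBr [X in X - _]mulrC divfK//.
  case: n => [|n].
    exists c; first by rewrite expr0 mulr1 lerDl mulr_ge0// ltW.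
    by rewrite !big_geq// mulr0 !subr0.
  exists (e n * h ^+ n.+1).
    rewrite rnM rnX {1}exprS mulrCA ht exprMn.
    apply: (@le_trans _ _ (B * s' * t ^+ n.+1)).
      have -> : t * s' * (rn (e n) * (t ^+ n * s' ^+ n)) =
         (rn (e n) * s' ^+ n) * (s' * t ^+ n.+1) by rewrite exprS; ring.
      by rewrite -[leRHS]mulrA ler_wpM2r// mulr_ge0 ?exprn_ge0// ltW.
    by rewrite ler_wpM2r ?exprn_ge0// lerDr rn_ge0.
  have -> : (u + h) * \sum_(0 <= k < n.+1) e k * h ^+ k =
     \sum_(0 <= k < n.+1) b k * h ^+ k - c + e n * h ^+ n.+1.
    elim: n => [|n ih].
      by rewrite !big_nat1 !expr0 !mulr1 expr1 /=; field.
    rewrite big_nat_recr//= mulrDr ih [in RHS]big_nat_recr//= !exprS.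
    by set S := \sum_(_ <= _ < _) _; field.
  by ring.
have [d hd hE] := key.
rewrite -(ler_pM2l uh0) -rnM hE (le_trans (rnB _ _))//.
apply: (@le_trans _ _ ((M + K) * t ^+ n)).
  by rewrite mulrDl lerD// fb.
rewrite !mulrA; apply: ler_wpM2r; first exact: exprn_ge0.
apply: ler_peMl.
  have K0 : 0 <= K.
    by apply: addr_ge0; [exact: rn_ge0|apply: mulr_ge0 => //; exact: ltW].
  exact: addr_ge0.
by rewrite ler_pdivlMr// mul1r; lra.
Qed.

Lemma locally_ps_div (A : set C) f z0 s M b : 0 < s -> has_ps f z0 s M b ->
  locally_ps A f -> locally_ps A (div_quot f z0 b).
Proof.
move=> s0 fb Af w /Af [s1 [M1 [b1 [s10 fb1]]]].
have [->|wz] := eqVneq w z0; last exact: has_ps_div_off fb1 wz.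
by do 3 eexists; split; last exact: has_ps_div_center fb.
Qed.

Lemma rn_sqE z : rn z ^+ 2 = complex.Re z ^+ 2 + complex.Im z ^+ 2.
Proof. by rewrite /rnorm normc_def/= sqr_sqrtr// addr_ge0 ?sqr_ge0. Qed.

Lemma locally_ps_continuous (A : set C) f w : locally_ps A f -> A w ->
  forall e : R, 0 < e -> exists2 d : R, 0 < d &
    forall z, rn (z - w) < d -> rn (f z - f w) < e.
Proof. by move=> /analytic_onP Af Aw; exact: analytic_continuous Af Aw. Qed.

(** Compactness through ultralimits: a sequence in the closed disk has a limit there. A sequence
    with [n <= u (x n)] would contradict continuity, so [u] is bounded; a maximizing sequence then
    yields the maximum. *)
Lemma closed_disk_max (u : C -> R) z0 (r : R) : 0 <= r ->
  (forall w, rn (w - z0) <= r -> forall e, 0 < e -> exists2 d : R, 0 < d &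
    forall z, rn (z - w) < d -> `|u z - u w| < e) ->
  exists2 w, rn (w - z0) <= r & forall z, rn (z - z0) <= r -> u z <= u w.
Proof.
move=> r0 uc; have [U [hU UN]] := ultra_nat.
have FU : ProperFilter U := ultra_proper.
have lim (x : nat -> C) : (forall n, rn (x n - z0) <= r) ->
    exists2 w, rn (w - z0) <= r &
      forall e, 0 < e -> U [set n | `|u (x n) - u w| < e].
  move=> xr; have [v hv] := ultra_lim hU xr.
  have vr : rn (v + z0 - z0) <= r.
    rewrite addrK; apply: (ultra_le hU (y := fun n => rn (x n - z0))).
      by apply: filterS (@filterT _ U _) => n _; exact: xr.
    move=> e /hv; apply: filterS => n /=; apply: le_lt_trans.
    have := rnD (x n - z0 - v) v; have := rnD (v - (x n - z0)) (x n - z0).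
    rewrite !subrK rn_distC ler_norml; lra.
  exists (v + z0) => // e e0; have [d d0 hd] := uc _ vr _ e0.
  apply: filterS (hv d d0) => n /= h; apply: hd.
  by rewrite opprD addrCA addrC -addrA in h *.
pose A := [set u z | z in [set z | rn (z - z0) <= r]].
have hA : has_sup A.
  split; first by exists (u z0), z0; rewrite //= subrr rn0.
  apply: contrapT => nb.
  have /choice[x hx] : forall n : nat, exists z, rn (z - z0) <= r /\ n%:R <= u z.
    move=> n; apply: contrapT => h; apply: nb; exists n%:R => _ [z zr <-].
    by rewrite leNgt; apply/negP => /ltW nz; apply: h; exists z.
  have [w wr hw] := lim x (fun n => (hx n).1).
  have [N hN] : exists N : nat, u w + 1 < N%:R.
    exists (Num.bound `|u w + 1|).
    exact: le_lt_trans (ler_norm _) (archi_boundP (normr_ge0 _)).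
  have [n /= [Nn h]] := filter_ex (filterI (UN N) (hw 1 ltr01)).
  move: h; rewrite ltr_norml => /andP[_ h]; have := (hx n).2.
  have : (N%:R : R) <= n%:R by rewrite ler_nat.
  lra.
have /choice[x hx] : forall n : nat, exists z, rn (z - z0) <= r /\
    sup A - n.+1%:R^-1 < u z.
  move=> n; have n0 : 0 < n.+1%:R^-1 :> R by rewrite invr_gt0.
  by have [_ [z zr <-] h] := sup_adherent n0 hA; exists z.
have [w wr hw] := lim x (fun n => (hx n).1).
exists w => // z zr; apply: (@le_trans _ _ (sup A)).
  by apply: (ub_le_sup hA.2); exists z.
apply/ler_addgt0Pr => e e0; have e2 : 0 < e / 2 by rewrite divr_gt0.
have [N _ /(_ N (leqnn N)) hN] := near_infty_natSinv_lt (PosNum e2).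
have [n /= [Nn h]] := filter_ex (filterI (UN N) (hw _ e2)).
have := (hx n).2.
have : (n.+1%:R^-1 : R) <= N.+1%:R^-1 by rewrite lef_pV2 ?posrE// ler_nat.
move: hN h; rewrite ltr_norml /=. move: (n.+1%:R^-1) (N.+1%:R^-1) => a c; lra.
Qed.

(* At an interior maximum of [rn (f z) + d * rn (z - z0) ^+ 2], the averages of
   [f] over the n-th roots of unity of a small circle of radius [t] give
   [d * t ^+ 2 <= M / 2 ^+ n] for all [n]. *)
Lemma max_principle f z0 (r m : R) : 0 <= r ->
  locally_ps [set z | rn (z - z0) <= r] f ->
  (forall z, rn (z - z0) = r -> rn (f z) <= m) ->
  forall z, rn (z - z0) <= r -> rn (f z) <= m.
Proof.
move=> r0 Af fm z1 zr; rewrite leNgt; apply/negP => fz1.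
(* With this [d], [u] is at most [m + d * r ^+ 2 = rn (f z1) - d] on the circle, less than [u z1];
   so the maximum of [u] is interior. *)
pose d := (rn (f z1) - m) / (r ^+ 2 + 1).
have r20 : 0 < r ^+ 2 + 1 by rewrite ltr_wpDl ?sqr_ge0.
have d0 : 0 < d by rewrite divr_gt0// subr_gt0.
pose u z := rn (f z) + d * rn (z - z0) ^+ 2.
have [w wr hw] : exists2 w, rn (w - z0) <= r &
    forall z, rn (z - z0) <= r -> u z <= u w.
  apply: closed_disk_max => // w wr e e0.
  have e2 : 0 < e / 2 by rewrite divr_gt0.
  have [d1 d10 h1] := locally_ps_continuous Af wr e2.
  pose k := d * (2 * r + 1) + 1.
  have k0 : 0 < k by apply: ltr_wpDl => //; apply: mulr_ge0; [exact: ltW|lra].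
  exists (Num.min (Num.min d1 1) (e / 2 / k)).
    by rewrite !lt_min d10 ltr01 divr_gt0.
  move=> z; rewrite !lt_min => /andP[/andP[zd1 z1'] zk].
  have := h1 z zd1.
  set a := rn (f z - f w) => ha.
  have A1 : `|rn (f z) - rn (f w)| <= a.
    have := rnD (f z - f w) (f w); have := rnD (f w - f z) (f z).
    rewrite !subrK rn_distC -/a ler_norml; lra.
  have A2 : `|rn (z - z0) - rn (w - z0)| <= rn (z - w).
    have := rnD (z - w) (w - z0); have := rnD (w - z) (z - z0).
    rewrite !addrA !subrK rn_distC ler_norml; lra.
  have -> : u z - u w = (rn (f z) - rn (f w)) +
     d * ((rn (z - z0) - rn (w - z0)) * (rn (z - z0) + rn (w - z0))).
    by rewrite /u; ring.
  rewrite (le_lt_trans (ler_normD _ _))// [e]splitr ltrD//.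
    exact: le_lt_trans A1 ha.
  rewrite ltr_pdivlMr// in zk; apply: le_lt_trans zk.
  rewrite normrM (gtr0_norm d0) normrM [X in _ * (_ * X)]ger0_norm; last first.
    by rewrite addr_ge0 ?rn_ge0.
  have zw0 := rn_ge0 (z - w).
  apply: (@le_trans _ _ (d * (rn (z - w) * (2 * r + 1)))).
    rewrite ler_wpM2l ?(ltW d0)//; apply: ler_pM; rewrite ?addr_ge0 ?rn_ge0//.
    move: A2; rewrite ler_norml; lra.
  by rewrite mulrCA ler_wpM2l// /k lerDl.
have uw : rn (f z1) <= u w.
  by apply: le_trans (hw _ zr); rewrite lerDl mulr_ge0 ?sqr_ge0// ltW.
have wlt : rn (w - z0) < r.
  rewrite lt_neqAle wr andbT; apply/eqP => wE.
  have := fm w wE; move: uw; rewrite /u wE.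
  have : d * (r ^+ 2 + 1) = rn (f z1) - m by rewrite divfK// gt_eqF.
  lra.
have [s [M [b [s0 fb]]]] := Af w wr.
(* The first bound makes the error of the average at most [M / 2 ^ n], the second keeps the circle
   inside the disk where [w] is maximal. *)
pose t := Num.min (s / 2) (r - rn (w - z0)).
have t0 : 0 < t by rewrite lt_min divr_gt0// subr_gt0.
have ts : t <= s / 2 by rewrite ge_min lexx.
have tr : t <= r - rn (w - z0) by rewrite ge_min lexx orbT.
have rt : rn t%:C = t by rewrite rnC// ltW.
have M0 := has_ps_ge0 s0 fb.
have bound n : (1 < n)%N -> d * t ^+ 2 <= M * 2^-1 ^+ n.
  move=> n1; have n0 := ltnW n1.
  have [om hom] := complex_prim_root R n0.
  have rj (j : nat) : rn (om ^+ j * t%:C) = t.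
    by rewrite rnM rnX (prim_root_rn hom) expr1n mul1r.
  have hts : rn t%:C <= s by rewrite rt; have := s0; lra.
  have := has_ps_mean fb hom hts; rewrite rt.
  set S := \sum_(j < n) _ => h1.
  have h2 : rn (f w) *+ n <= (M * (t / s) ^+ n) *+ n +
      \sum_(j < n) rn (f (w + om ^+ j * t%:C)).
    rewrite -rn_natmul -(subrK S (f w *+ n)) (le_trans (rnD _ _))// lerD//.
    exact: rn_sum.
  have h3 : \sum_(j < n) u (w + om ^+ j * t%:C) <= u w *+ n.
    have -> : u w *+ n = \sum_(j < n) u w by rewrite sumr_const card_ord.
    apply: ler_sum => j _; apply: hw.
    rewrite addrAC (le_trans (rnD _ _))// rj; lra.
  (* The cross terms are linear in the roots of unity, which sum to 0 because [1 < n]. *)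
  have h4 : \sum_(j < n) rn (w + om ^+ j * t%:C - z0) ^+ 2 =
      (rn (w - z0) ^+ 2 + t ^+ 2) *+ n.
    have hz : \sum_(j < n) om ^+ j * t%:C = 0.
      rewrite -mulr_suml; have := sum_prim_root hom (k := 1).
      by rewrite n1 => /(_ isT); under eq_bigr do rewrite expr1; move=> ->; rewrite mul0r.
    under eq_bigr => j _.
      rewrite addrAC rn_sqE.
      have -> : complex.Re (w - z0 + om ^+ j * t%:C) ^+ 2 +
         complex.Im (w - z0 + om ^+ j * t%:C) ^+ 2 =
        (rn (w - z0) ^+ 2 + rn (om ^+ j * t%:C) ^+ 2) +
        (2 * complex.Re (w - z0) * complex.Re (om ^+ j * t%:C) +
        2 * complex.Im (w - z0) * complex.Im (om ^+ j * t%:C)).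
        by rewrite !rn_sqE !raddfD/=; ring.
      rewrite rj; over.
    rewrite big_split/= sumr_const card_ord big_split/= -!mulr_sumr.
    by rewrite -!raddf_sum hz !raddf0 !mulr0 !addr0.
  move: h3; rewrite /u big_split/= -mulr_sumr h4 mulrnDl => h3.
  have h5 : (d * t ^+ 2) *+ n <= (M * (t / s) ^+ n) *+ n.
    move: h3 h2; rewrite mulrnDl mulrDr -!mulrnAr; lra.
  rewrite lerMn2r gtn_eqF//= in h5; apply: (le_trans h5).
  rewrite ler_wpM2l//; apply: lerXn2r; rewrite ?nnegrE ?invr_ge0//.
    by apply: divr_ge0; exact: ltW.
  by rewrite ler_pdivrMr// mulrC.
have dt : 0 < d * t ^+ 2 by rewrite mulr_gt0 ?exprn_gt0.
have := @cvg_expr R 2^-1; rewrite ger0_norm ?invr_ge0//.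
rewrite invf_lt1// ltr1n => /(_ isT) /cvgrPdist_lt.
have M10 : 0 < M + 1 by rewrite ltr_wpDl.
move=> /(_ (d * t ^+ 2 / (M + 1)))[|N _ hN]; first by rewrite divr_gt0.
have := hN (maxn N 2) (leq_maxl _ _); rewrite /= sub0r normrN ger0_norm; last first.
  by rewrite exprn_ge0 ?invr_ge0.
rewrite ltr_pdivlMr// => h; have := bound (maxn N 2) (leq_maxr _ _).
have q0 : 0 <= (2^-1 : R) ^+ maxn N 2 by rewrite exprn_ge0 ?invr_ge0.
nra.
Qed.

(* The maximum principle for the iterated difference quotients at [z0] bounds the
   coefficients without contour integrals; it costs a factor 2 in the radius. *)
Lemma cauchy_bound f z0 (r m : R) : 0 < r ->
  locally_ps [set z | rn (z - z0) <= r] f ->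
  (forall z, rn (z - z0) <= r -> rn (f z) <= m) ->
  exists b, has_ps f z0 (r / 2) m b.
Proof.
move=> r0 Af fm.
have [|s [M [b [s0 fb]]]] := Af z0; first by rewrite /= subrr rn0 ltW.
(* The induction passes to the difference quotient, so all these data vary. Its bound [2 * m / r]
   times [rn h] equals [m * (rn h / (r / 2))]: the halved radius absorbs the factor 2. *)
exists b => n; move: f b m M Af fm fb; elim: n => [|n ih] f b m M Af fm fb h hr.
  rewrite big_geq// subr0 expr0 mulr1 fm// addrC addKr (le_trans hr)//.
  by rewrite ler_pdivrMr// ler_peMr ?ler1n ?(ltW r0).
have f0 := has_ps_value s0 fb.
have Ag := locally_ps_div s0 fb Af.
have gb := has_ps_div_center s0 fb.
set g := div_quot f z0 b in Ag gb.
have gm z : rn (z - z0) <= r -> rn (g z) <= 2 * m / r.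
  apply: (max_principle (ltW r0) Ag) => {}z zr.
  have zz : z != z0 by apply: contraTneq r0 => zE; rewrite -zr zE subrr rn0 ltxx.
  rewrite /g /div_quot (negbTE zz) rnM rnV zr ler_wpM2r ?invr_ge0 ?(ltW r0)//.
  rewrite (le_trans (rnB _ _))// -f0 mulr_natl mulr2n lerD// fm ?zr//.
  by rewrite subrr rn0 ltW.
have := ih g (fun k => b k.+1) _ _ Ag gm gb h hr.
rewrite (div_quotE _ f0) [z0 + h]addrC addrK -/g.
rewrite big_nat_recl// expr0 mulr1 opprD addrACA subrr add0r.
have -> : \sum_(0 <= i < n) b i.+1 * h ^+ i.+1 =
   h * \sum_(0 <= i < n) b i.+1 * h ^+ i.
  by rewrite mulr_sumr; apply: eq_bigr => i _; rewrite exprS mulrCA.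
rewrite -mulrBr rnM => hh.
apply: (le_trans (ler_wpM2l (rn_ge0 h) hh)).
rewrite le_eqVlt; apply/orP; left; apply/eqP.
by rewrite [in RHS]exprS; field; rewrite gt_eqF.
Qed.

End LocallyPowerSeries.

(** * Area of the plane under affine maps *)

Section AffineInvariance.
Variable R : realType.
Local Notation mR := (measurableTypeR R).
Local Notation mu := (@lebesgue_measure R).
Local Open Scope ereal_scope.

(** Lebesgue measure and [a] times its image under [x |-> a * x + b] agree on half-open intervals,
    hence on all measurable sets. *)
Lemma integral_affine (a b : R) (g : mR -> \bar R) : (0 < a)%R ->
  measurable_fun setT g -> (forall x, 0 <= g x) ->
  \int[mu]_x g (a * x + b)%R = a^-1%:E * \int[mu]_x g x.
Proof.
move=> a0 mg g0; pose phi (x : mR) : mR := (a * x + b)%R.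
have mphi : measurable_fun setT phi.
  by apply: measurable_funD => //; apply: measurable_funM.
pose a' : {nonneg R} := NngNum (ltW a0).
have [nu [nuE nuI]] : exists nu : {measure set mR -> \bar R},
    (forall A, nu A = a%:E * mu (phi @^-1` A)) /\
    \int[nu]_x g x = a%:E * \int[mu]_x g (phi x).
  unshelve eexists (mscale a' (pushforward mu phi)); first exact: mphi.
  split=> //.
  by rewrite ge0_integral_mscale// ge0_integral_pushforward//= preimage_setT.
have muE A : measurable A -> mu A = nu A.
  apply: lebesgue_measure_unique => _ [[x y] _ <-]; rewrite nuE.
  have -> : phi @^-1` `]x, y]%classic =
      `]((x - b) / a)%R, ((y - b) / a)%R]%classic.
    apply/seteqP; split=> z /=; rewrite !in_itv/= ltr_pdivrMr// ler_pdivlMr//;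
    by rewrite ltrBlDr lerBrDr mulrC.
  rewrite !lebesgue_measure_itv/= !lte_fin ltr_pM2r ?invr_gt0// ltrD2r.
  case: ifPn => _; last by rewrite mule0.
  by rewrite -!EFinD -EFinM; congr EFin; field; rewrite gt_eqF.
have -> : \int[mu]_x g x = \int[nu]_x g x.
  by apply: eq_measure_integral => A mA _; exact: muE.
by rewrite nuI muleA -EFinM mulVf ?gt_eqF// mul1e.
Qed.

Local Notation area := (area R).

Lemma measurable_affine1 (a : R) (b : R -> R) :
  measurable_fun setT (b : mR -> mR) ->
  measurable_fun setT (fun w : mR * mR => ((a * w.1 + b w.2)%R, w.2) : mR * mR).
Proof.
move=> mb; apply/measurable_fun_pairP; split => /=; last exact: measurable_snd.
apply: measurable_funD; first exact: measurable_funM.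
  exact: measurableT_comp.
Qed.

Lemma measurable_affine2 (a : R) (b : R -> R) :
  measurable_fun setT (b : mR -> mR) ->
  measurable_fun setT (fun w : mR * mR => (w.1, (a * w.2 + b w.1)%R) : mR * mR).
Proof.
move=> mb; apply/measurable_fun_pairP; split => /=; first exact: measurable_fst.
apply: measurable_funD; first exact: measurable_funM.
  exact: measurableT_comp.
Qed.

Lemma area_fubini1 (g : mR * mR -> \bar R) :
  measurable_fun setT g -> (forall w, 0 <= g w) ->
  \int[area]_w g w = \int[mu]_x \int[mu]_y g (x, y).
Proof. by move=> mg g0; exact: (fubini_tonelli1 (m1 := mu) (m2 := mu)). Qed.

Lemma area_fubini2 (g : mR * mR -> \bar R) :
  measurable_fun setT g -> (forall w, 0 <= g w) ->
  \int[area]_w g w = \int[mu]_y \int[mu]_x g (x, y).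
Proof. by move=> mg g0; exact: (fubini_tonelli2 (m1 := mu) (m2 := mu)). Qed.

(** Fubini reduces this to one variable. Letting the translation depend on the other coordinate
    covers translations, dilations and shears at once. *)
Lemma area_affine2 (a : R) (b : R -> R) (g : mR * mR -> \bar R) : (0 < a)%R ->
  measurable_fun setT (b : mR -> mR) ->
  measurable_fun setT g -> (forall w, 0 <= g w) ->
  \int[area]_w g (w.1, (a * w.2 + b w.1)%R) = a^-1%:E * \int[area]_w g w.
Proof.
move=> a0 mb mg g0; rewrite area_fubini1//; last first.
  apply: (measurableT_comp mg); exact: measurable_affine2.
rewrite area_fubini1// -ge0_integralZl//; last 3 first.
- exact: (measurable_fun_fubini_tonelli_F (m2 := mu) g).
- by move=> x _; apply: integral_ge0.
- by rewrite lee_fin invr_ge0 ltW.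
apply: eq_integral => x _; rewrite /fubini_F/=.
apply: (integral_affine (b x) (g := fun y => g (x, y))) => //.
exact: measurableT_comp.
Qed.

Lemma area_affine1 (a : R) (b : R -> R) (g : mR * mR -> \bar R) : (0 < a)%R ->
  measurable_fun setT (b : mR -> mR) ->
  measurable_fun setT g -> (forall w, 0 <= g w) ->
  \int[area]_w g ((a * w.1 + b w.2)%R, w.2) = a^-1%:E * \int[area]_w g w.
Proof.
move=> a0 mb mg g0; rewrite area_fubini2//; last first.
  apply: (measurableT_comp mg); exact: measurable_affine1.
rewrite area_fubini2// -ge0_integralZl//; last 3 first.
- exact: (measurable_fun_fubini_tonelli_G (m1 := mu) g).
- by move=> x _; apply: integral_ge0.
- by rewrite lee_fin invr_ge0 ltW.
apply: eq_integral => y _; rewrite /fubini_G/=.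
apply: (integral_affine (b y) (g := fun x => g (x, y))) => //.
exact: measurableT_comp.
Qed.

Lemma area_translation (u v : R) (g : mR * mR -> \bar R) :
  measurable_fun setT g -> (forall w, 0 <= g w) ->
  \int[area]_w g ((w.1 + u)%R, (w.2 + v)%R) = \int[area]_w g w.
Proof.
move=> mg g0.
have mb (t : R) : measurable_fun setT ((fun=> t) : mR -> mR) by [].
have := @area_affine1 1 (fun=> u)
  (fun w => g (w.1, (1 * w.2 + v)%R)) ltr01 (mb u).
have := @area_affine2 1 (fun=> v) g ltr01 (mb v) mg g0.
rewrite invr1 !mul1e => -> /=.
rewrite (_ : (fun w : mR * mR => g ((1 * w.1 + u)%R, (1 * w.2 + v)%R)) =
   (fun w => g ((w.1 + u)%R, (w.2 + v)%R))); last first.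
  by apply/funext => w; rewrite !mul1r.
apply=> // .
by apply: (measurableT_comp mg); apply: (@measurable_affine2 1 (fun=> v)).
Qed.

Lemma area_dilation (s : R) (g : mR * mR -> \bar R) : (0 < s)%R ->
  measurable_fun setT g -> (forall w, 0 <= g w) ->
  \int[area]_w g ((s * w.1)%R, (s * w.2)%R) = (s ^- 2)%:E * \int[area]_w g w.
Proof.
move=> s0 mg g0.
have mb (t : R) : measurable_fun setT ((fun=> t) : mR -> mR) by [].
have := @area_affine1 s (fun=> 0%R)
  (fun w => g (w.1, (s * w.2 + 0)%R)) s0 (mb 0%R).
rewrite (@area_affine2 s (fun=> 0%R) g s0 (mb 0%R) mg g0) /=.
rewrite (_ : (fun w : mR * mR => g ((s * w.1 + 0)%R, (s * w.2 + 0)%R)) =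
   (fun w => g ((s * w.1)%R, (s * w.2)%R))); last first.
  by apply/funext => w; rewrite !addr0.
rewrite muleA -EFinM -expr2 exprVn; apply=> //.
by apply: (measurableT_comp mg); apply: (@measurable_affine2 s (fun=> 0%R)).
Qed.

(* A rotation other than -1 is a product of three shears. *)
Lemma area_rotation (c s : R) (g : mR * mR -> \bar R) :
  (c ^+ 2 + s ^+ 2 = 1)%R -> c != (-1)%R ->
  measurable_fun setT g -> (forall w, 0 <= g w) ->
  \int[area]_w g ((c * w.1 - s * w.2)%R, (s * w.1 + c * w.2)%R) =
  \int[area]_w g w.
Proof.
move=> cs c1 mg g0.
have [s0|s0] := eqVneq s 0%R.
  have : ((c - 1) * (c + 1) = 0)%R by rewrite s0 in cs; lra.
  move/eqP; rewrite mulf_eq0 subr_eq0 addr_eq0 (negbTE c1) orbF => /eqP ->.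
  by apply: eq_integral => w _; rewrite s0 !mul1r !mul0r subr0 add0r -surjective_pairing.
(* This is minus the tangent of half the angle. As [1 + a * s = c], the product of [sx], [sy] and
   [sx] is the rotation. *)
pose a := ((c - 1) / s)%R.
have mb (t : R) : measurable_fun setT ((fun y => t * y)%R : mR -> mR).
  exact: measurable_funM.
pose sx (w : mR * mR) : mR * mR := ((1 * w.1 + a * w.2)%R, w.2).
pose sy (w : mR * mR) : mR * mR := (w.1, (1 * w.2 + s * w.1)%R).
have msx : measurable_fun setT sx by exact: (@measurable_affine1 1 (fun y => a * y)%R).
have msy : measurable_fun setT sy by exact: (@measurable_affine2 1 (fun y => s * y)%R).
have mg1 : measurable_fun setT (g \o sx) by exact: measurableT_comp.
have mg2 : measurable_fun setT (g \o sx \o sy) by exact: measurableT_comp.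
transitivity (\int[area]_w (g \o sx \o sy) (sx w)).
  apply: eq_integral => w _ /=; congr g; rewrite /sx /sy /= /a.
  have s2 : (s ^+ 2 = 1 - c ^+ 2)%R by rewrite -cs addrC addKr.
  congr pair; last by field.
  rewrite -[(c * _ - s * w.2)%R](mulfK s0) -[RHS](mulfK s0); congr (_ / _)%R.
  have -> : ((c * w.1 - s * w.2) * s = c * w.1 * s - s ^+ 2 * w.2)%R by ring.
  by rewrite s2; field.
rewrite (@area_affine1 1 (fun y => a * y)%R (g \o sx \o sy) ltr01 (mb a) mg2 (fun w => g0 _)).
rewrite (@area_affine2 1 (fun y => s * y)%R (g \o sx) ltr01 (mb s) mg1 (fun w => g0 _)).
rewrite (@area_affine1 1 (fun y => a * y)%R g ltr01 (mb a) mg g0).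
by rewrite invr1 !mul1e.
Qed.

End AffineInvariance.

(** * Point evaluations and completeness of the Bergman space *)

Section LpFunctions.
Context d (T : measurableType d) (R : realType).
Variables (mu : {measure set T -> \bar R}) (p : R).
Hypothesis p1 : 1 <= p.
Implicit Types g h k : T -> R.

Let p0 : 0 < p. Proof. exact: lt_le_trans p1. Qed.
Let pn0 : p != 0. Proof. by rewrite gt_eqF. Qed.

Definition lpfun g := [/\ measurable_fun setT g, (forall x, 0 <= g x) &
  (pint mu p g < +oo)%E].

Definition pnorm g : R := fine (pint mu p g) `^ p^-1.

Lemma pnorm_ge0 g : 0 <= pnorm g. Proof. exact: powR_ge0. Qed.

Lemma pnormXp g : pnorm g `^ p = fine (pint mu p g).
Proof. by rewrite /pnorm -powRrM mulVf// powRr1// fine_ge0// pint_ge0. Qed.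

Lemma pnorm_le_root g (c : R) : 0 <= c -> (pint mu p g <= c%:E)%E ->
  pnorm g <= c `^ p^-1.
Proof.
move=> c0 gc; rewrite /pnorm ge0_ler_powR ?nnegrE ?invr_ge0 ?(ltW p0)//.
  by rewrite fine_ge0// pint_ge0.
have fg : pint mu p g \is a fin_num.
  by rewrite ge0_fin_numE ?pint_ge0// (le_lt_trans gc)// ltry.
by rewrite -lee_fin fineK.
Qed.

Lemma pint_le g h : measurable_fun setT g -> measurable_fun setT h ->
  (forall x, 0 <= g x <= h x) -> (pint mu p g <= pint mu p h)%E.
Proof.
move=> mg mh gh; rewrite !pint.unlock.
apply: ge0_le_integral => //.
- by move=> x _; rewrite lee_fin powR_ge0.
- exact/measurable_EFinP/measurable_powRp.
- exact/measurable_EFinP/measurable_powRp.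
- move=> x _; have /andP[g0 h0] := gh x.
  by rewrite lee_fin ge0_ler_powR ?nnegrE ?(ltW p0)// (le_trans g0).
Qed.

Lemma lpfun_le g h : measurable_fun setT g -> lpfun h ->
  (forall x, 0 <= g x <= h x) -> lpfun g /\ pnorm g <= pnorm h.
Proof.
move=> mg [mh h0 hoo] gh; have le := pint_le mg mh gh.
have goo := le_lt_trans le hoo.
split; first by split=> // x; case/andP: (gh x).
rewrite /pnorm ge0_ler_powR ?nnegrE ?invr_ge0 ?(ltW p0) ?fine_ge0 ?pint_ge0//.
by rewrite fine_le// ge0_fin_numE ?pint_ge0.
Qed.

Lemma lpfunD g h : lpfun g -> lpfun h ->
  lpfun (fun x => g x + h x) /\ pnorm (fun x => g x + h x) <= pnorm g + pnorm h.
Proof.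
move=> [mg g0 goo] [mh h0 hoo].
have mk : measurable_fun setT (fun x => g x + h x) by exact: measurable_funD.
have k0 x : 0 <= g x + h x by rewrite addr_ge0.
by have [] := pint_triangle p1 mg mh mk g0 h0 k0 (fun x => lexx _) goo hoo.
Qed.

Lemma lpfun_triangle g h k : lpfun g -> lpfun h -> measurable_fun setT k ->
  (forall x, 0 <= k x <= g x + h x) -> lpfun k /\ pnorm k <= pnorm g + pnorm h.
Proof.
move=> lg lh mk kgh; have [lgh le] := lpfunD lg lh.
by have [lk le'] := lpfun_le mk lgh kgh; split=> //; exact: le_trans le.
Qed.

Lemma lpfunZ (c : R) g : 0 <= c -> lpfun g ->
  lpfun (fun x => c * g x) /\ pnorm (fun x => c * g x) = c * pnorm g.
Proof.
move=> c0 [mg g0 goo]; have [koo E] := pint_scale p1 mg g0 c0 goo.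
by split=> //; split=> //; [exact: measurable_funM|move=> x; rewrite mulr_ge0].
Qed.

Lemma pint0 : pint mu p (fun=> 0) = 0%E.
Proof. by rewrite pint.unlock integral0_eq// => x _; rewrite powR0. Qed.

Lemma lpfun0 : lpfun (fun=> 0).
Proof. by split=> //; rewrite pint0 ltry. Qed.

Lemma pnorm0 : pnorm (fun=> 0) = 0.
Proof. by rewrite /pnorm pint0 powR0// invr_eq0. Qed.

Lemma pint_disjoint g h : measurable_fun setT g -> measurable_fun setT h ->
  (forall x, g x = 0 \/ h x = 0) ->
  pint mu p (fun x => g x + h x) = (pint mu p g + pint mu p h)%E.
Proof.
move=> mg mh gh; rewrite !pint.unlock -ge0_integralD//.
- apply: eq_integral => x _; rewrite -EFinD; congr EFin.
  by case: (gh x) => ->; rewrite powR0// ?addr0 ?add0r.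
- by move=> x _; rewrite lee_fin powR_ge0.
- exact/measurable_EFinP/measurable_powRp.
- by move=> x _; rewrite lee_fin powR_ge0.
- exact/measurable_EFinP/measurable_powRp.
Qed.

Definition cutoff (A : set T) g x : R := \1_A x * g x.

Lemma cutoffT A g x : A x -> cutoff A g x = g x.
Proof. by move=> Ax; rewrite /cutoff indicE mem_set// mul1r. Qed.

Lemma cutoffF A g x : ~ A x -> cutoff A g x = 0.
Proof. by move=> Ax; rewrite /cutoff indicE memNset// mul0r. Qed.

Lemma measurable_cutoff A g : measurable A -> measurable_fun setT g ->
  measurable_fun setT (cutoff A g).
Proof. by move=> mA mg; apply: measurable_funM => //; exact: measurable_indic. Qed.

Lemma cutoff_le A g x : 0 <= g x -> 0 <= cutoff A g x <= g x.
Proof.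
by move=> g0; have [Ax|Ax] := pselect (A x);
  rewrite ?(cutoffT _ Ax) ?(cutoffF _ Ax) ?lexx g0.
Qed.

Lemma lpfun_cutoff A g : measurable A -> lpfun g ->
  lpfun (cutoff A g) /\ pnorm (cutoff A g) <= pnorm g.
Proof.
move=> mA lg; have [mg g0 _] := lg.
by apply: lpfun_le => //; [exact: measurable_cutoff|move=> x; exact: cutoff_le].
Qed.

Lemma pint_cutoffC A g : measurable A -> measurable_fun setT g ->
  pint mu p g = (pint mu p (cutoff A g) + pint mu p (cutoff (~` A) g))%E.
Proof.
move=> mA mg; rewrite -pint_disjoint//.
- congr pint; apply/funext => x; have [Ax|nAx] := pselect (A x).
    by rewrite cutoffT// (@cutoffF (~` A))// addr0.
  by rewrite cutoffF// (@cutoffT (~` A))// add0r.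
- exact: measurable_cutoff.
- by apply: measurable_cutoff => //; exact: measurableC.
- by move=> x; have [Ax|Ax] := pselect (A x); [right; rewrite cutoffF|left; rewrite cutoffF].
Qed.

(** This exact additivity, sharper than the triangle inequality, is what later permits the
    asymptotic constant 1. *)
Lemma pnorm_cutoffC A g : measurable A -> lpfun g ->
  pnorm g `^ p = pnorm (cutoff A g) `^ p + pnorm (cutoff (~` A) g) `^ p.
Proof.
move=> mA lg; rewrite !pnormXp (pint_cutoffC mA); last by case: lg.
have [[_ _ h1] _] := lpfun_cutoff mA lg.
have [[_ _ h2] _] := lpfun_cutoff (measurableC mA) lg.
by rewrite fineD// ge0_fin_numE ?pint_ge0.
Qed.

Lemma pint_indic A (c : R) : measurable A -> 0 <= c ->
  pint mu p (fun x => c * \1_A x) = ((c `^ p)%:E * mu A)%E.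
Proof.
move=> mA c0; rewrite -[A in RHS]setIT -(integral_indic mu measurableT)//.
rewrite pint.unlock -ge0_integralZl//.
- apply: eq_integral => x _; rewrite indicE; case: (x \in A) => /=.
    by rewrite mulr1 mule1.
  by rewrite mulr0 powR0// mule0.
- by apply/measurable_EFinP; exact: measurable_indic.
- by rewrite lee_fin powR_ge0.
Qed.

End LpFunctions.

(** * Moduli of Bergman functions and areas of disks *)

Section BergmanFunctions.
Variables (R : realType) (p : R).
Hypothesis p1 : 1 <= p.
Local Notation C := R[i].
Local Notation rn z := (rnorm (z : C^o)).
Local Notation mR := (measurableTypeR R).
Local Notation area := (area R).
Local Notation pt w := (w.1 +i* w.2).
Implicit Types f : C -> C.

Let p0 : 0 < p. Proof. exact: lt_le_trans p1. Qed.

Definition modulus f (w : mR * mR) : R := rn (f (pt w)).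

Lemma unit_diskE (z : C) : unit_disk z <-> rn z < 1.
Proof. by rewrite /unit_disk/= -(rmorph1 (real_complex R)) rn_lt. Qed.

Lemma rn_ptB (v w : R * R) : rn (pt v - pt w) <= `|v.1 - w.1| + `|v.2 - w.2|.
Proof. exact: rn_pair. Qed.

(** The extension by 0 may jump on the unit circle, but the modulus is continuous in the open disk
    and 0 elsewhere, hence lower semicontinuous. *)
Lemma measurable_modulus f : analytic_on (@unit_disk R) f ->
  (forall z, ~ unit_disk z -> f z = 0) -> measurable_fun setT (modulus f).
Proof.
move=> Af f0; apply: lsc_plane_measurable => w c cw.
have [Dw|Dw] := pselect (unit_disk (pt w)); last first.
  exists 1 => // v _ _; apply: (@lt_le_trans _ _ 0); last exact: rn_ge0.
  by rewrite (lt_le_trans cw)// /modulus f0// rn0.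
have [|d d0 hd] := analytic_continuous Af Dw (e := modulus f w - c).
  by rewrite subr_gt0.
exists (d / 2); first by rewrite divr_gt0.
move=> v v1 v2; have /hd h : rn (pt v - pt w) < d.
  by rewrite (le_lt_trans (rn_ptB _ _))//; lra.
have := rnD (f (pt w) - f (pt v)) (f (pt v)); rewrite subrK rn_distC.
move: h; rewrite /modulus; lra.
Qed.

Lemma bergman_integralE f : (forall z, ~ unit_disk z -> f z = 0) ->
  bergman_integral p f = pint area p (modulus f).
Proof.
move=> f0; rewrite /bergman_integral integral_mkcond pint.unlock.
apply: eq_integral => w _; rewrite patchE; case: ifPn => // /negP.
rewrite inE /= => /f0; rewrite /modulus => ->.
by rewrite rn0 powR0// gt_eqF.
Qed.

Lemma bergman_lpfun f : f \in bergman_function p ->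
  lpfun area p (modulus f) /\ bergman_norm p f = pnorm area p (modulus f).
Proof.
move=> /bergmanP[Af f0]; rewrite /bergman_norm bergman_integralE// => foo.
by split=> //; split=> //; [exact: measurable_modulus|move=> w; exact: rn_ge0].
Qed.

Lemma bergman_lpfunW f : analytic_on (@unit_disk R) f ->
  (forall z, ~ unit_disk z -> f z = 0) -> (pint area p (modulus f) < +oo)%E ->
  f \in bergman_function p.
Proof. by move=> Af f0 foo; apply/asboolP; split; rewrite ?bergman_integralE. Qed.

Definition disk (r : R) : set (mR * mR) := [set w | rn (pt w) < r].

Lemma measurable_disk r : measurable (disk r).
Proof.
apply: open_plane_measurable => w; rewrite /disk/= => wr.
exists ((r - rn (pt w)) / 2); first by rewrite divr_gt0// subr_gt0.
move=> v v1 v2; have := rnD (pt v - pt w) (pt w); rewrite subrK.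
have := rn_ptB v w; lra.
Qed.

Lemma area_box (t : R) : 0 <= t ->
  area (ball 0 t `*` ball 0 t) = (4 * t ^+ 2)%:E.
Proof.
move=> t0; have mb : measurable (ball 0 t : set mR) by exact: measurable_ball.
apply: (etrans (product_measure1E lebesgue_measure lebesgue_measure mb mb)).
have lb := lebesgue_measure_ball (0 : R) t0.
transitivity ((t *+ 2)%:E * (t *+ 2)%:E)%E; first by congr (_ * _)%E; exact: lb.
by rewrite -EFinM; congr EFin; ring.
Qed.

Lemma measurable_box (t : R) :
  measurable (ball 0 t `*` ball 0 t : set (mR * mR)).
Proof. by apply: measurableX; exact: measurable_ball. Qed.

(** Comparison with the circumscribed square; the next lemma uses the square of half-side
    [r / 2]. *)
Lemma area_disk_le (r : R) : 0 <= r -> (area (disk r) <= (4 * r ^+ 2)%:E)%E.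
Proof.
move=> r0; rewrite -area_box//; apply: le_measure; rewrite ?inE.
- exact: measurable_disk.
- exact: measurable_box.
move=> [x y]; rewrite /disk /ball/= /ball_/= !sub0r !normrN => wr.
have h := rn_sqE (x +i* y); rewrite /= in h.
split; rewrite (le_lt_trans _ wr)// -(@ler_pXn2r _ 2)// ?nnegrE ?rn_ge0//;
  rewrite h real_normK ?num_real//; have := sqr_ge0 x; have := sqr_ge0 y; lra.
Qed.

Lemma area_disk_ge (r : R) : 0 <= r -> ((r ^+ 2)%:E <= area (disk r))%E.
Proof.
move=> r0; have -> : r ^+ 2 = 4 * (r / 2) ^+ 2 by field.
rewrite -area_box ?divr_ge0//; apply: le_measure; rewrite ?inE.
- exact: measurable_box.
- exact: measurable_disk.
move=> [x y]; rewrite /disk /ball/= /ball_/= !sub0r !normrN => -[h1 h2].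
by rewrite (le_lt_trans (rn_pair _ _))//; lra.
Qed.

End BergmanFunctions.

(** * Bounding point values by area integrals *)

Section PointEvaluation.
Variables (R : realType) (p : R).
Hypothesis p1 : 1 <= p.
Local Notation C := R[i].
Local Notation rn z := (rnorm (z : C^o)).
Local Notation mR := (measurableTypeR R).
Local Notation area := (area R).
Local Notation pt w := (w.1 +i* w.2).
Implicit Types f : C -> C.

Let p0 : 0 < p. Proof. exact: lt_le_trans p1. Qed.

(** It plays the part of Hölder's inequality: on a disk, the integral of [|f|] is at most the area
    plus the integral of [|f|^p]. *)
Lemma le_1powR (x : R) : 0 <= x -> x <= 1 + x `^ p.
Proof.
move=> x0; have [x1|x1] := leP x 1.
  by rewrite (le_trans x1)// lerDl powR_ge0.
have h : x `^ 1 <= x `^ p by rewrite ler_powR// ltW.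
by rewrite powRr1// in h; rewrite (le_trans h)// lerDr.
Qed.

Lemma geometric_le (x y m : R) : (forall n, odd n -> x <= y + m * 2^-1 ^+ n) ->
  x <= y.
Proof.
move=> h; apply/ler_addgt0Pr => e e0.
have := @cvg_expr R 2^-1; rewrite ger0_norm ?invr_ge0//.
rewrite invf_lt1// ltr1n => /(_ isT) /cvgrPdist_lt.
have M10 : 0 < `|m| + 1 by rewrite ltr_wpDl.
move=> /(_ (e / (`|m| + 1)))[|N _ hN]; first by rewrite divr_gt0.
have /hN : (N <= N.*2.+1)%N by rewrite -addnn -addSn leq_addl.
rewrite /= sub0r normrN ger0_norm ?exprn_ge0 ?invr_ge0//.
rewrite ltr_pdivlMr// => h2; have := h N.*2.+1; rewrite /= odd_double => /(_ isT).
move=> /le_trans; apply; rewrite lerD2l; apply: le_trans (ltW h2).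
rewrite mulrC; apply: ler_wpM2l; first by rewrite exprn_ge0 ?invr_ge0.
by rewrite (le_trans (ler_norm _))// lerDl.
Qed.

Definition plane_rot (u : C) (w : mR * mR) : mR * mR :=
  (complex.Re u * w.1 - complex.Im u * w.2,
   complex.Im u * w.1 + complex.Re u * w.2).

Lemma pt_plane_rot u (w : mR * mR) : pt (plane_rot u w) = u * pt w.
Proof.
by case: u => c s; apply/eqP; rewrite eq_complex/=; apply/andP; split; apply/eqP; ring.
Qed.

Lemma measurable_plane_rot u : measurable_fun setT (plane_rot u).
Proof.
apply/measurable_fun_pairP; split; rewrite /plane_rot /=.
  by apply: measurable_funB; apply: measurable_funM.
by apply: measurable_funD; apply: measurable_funM.
Qed.

(** The parity of [n] excludes [u = -1], the case that [area_rotation] leaves out. *)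
Lemma area_root_of_unity n (u : C) (g : mR * mR -> \bar R) :
  odd n -> u ^+ n = 1 -> measurable_fun setT g -> (forall w, (0 <= g w)%E) ->
  (\int[area]_w g (plane_rot u w) = \int[area]_w g w)%E.
Proof.
move=> n_odd un mg g0.
have ru : rn u = 1.
  apply/eqP; rewrite -(@pexpr_eq1 _ _ n)// ?rn_ge0//; last by case: n n_odd {un}.
  by rewrite -rnX un rn1.
have cs : complex.Re u ^+ 2 + complex.Im u ^+ 2 = 1.
  by rewrite -rn_sqE ru expr1n.
apply: area_rotation => //; apply/eqP => c1.
have s0 : complex.Im u = 0.
  by apply/eqP; rewrite -sqrf_eq0; apply/eqP; move: cs; rewrite c1; lra.
have uE : u = -1 by apply/eqP; rewrite eq_complex/= c1 s0 oppr0 !eqxx.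
move: un; rewrite uE -signr_odd n_odd expr1 => /eqP.
rewrite -subr_eq0 -opprD oppr_eq0 -[1 + 1]/(2%:R) pnatr_eq0.
by [].
Qed.

(** Integrating [has_ps_mean] over the disk of radius [t] around [z0] gives [n] integrals that
    coincide by rotation invariance, so [n] cancels. As [t <= s / 2], the error is [m / 2 ^ n] times
    the area and vanishes for large odd [n]; hence [m] is absent from the bound. *)
Lemma has_ps_area_mean f z0 s m b t : analytic_on (@unit_disk R) f ->
  (forall z, ~ unit_disk z -> f z = 0) -> (pint area p (modulus f) < +oo)%E ->
  0 < s -> 0 < t -> t <= s / 2 -> has_ps f z0 s m b ->
  rn (f z0) <= 1 + fine (pint area p (modulus f)) / fine (area (disk t)).
Proof.
move=> Af f0 foo s0 t0 ts fb.
set A := fine (pint area p (modulus f)); set beta := fine (area (disk t)).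
have AE : pint area p (modulus f) = A%:E.
  by rewrite fineK// ge0_fin_numE// pint_ge0.
have bE : area (disk t) = beta%:E.
  rewrite fineK// ge0_fin_numE//.
  by rewrite (le_lt_trans (area_disk_le (ltW t0)))// ltry.
have beta0 : 0 < beta.
  rewrite -lte_fin -bE (lt_le_trans _ (area_disk_ge (ltW t0)))// lte_fin.
  by rewrite exprn_gt0.
have mB := measurable_disk t.
pose sh (w : mR * mR) : mR * mR := (w.1 + complex.Re z0, w.2 + complex.Im z0).
have msh : measurable_fun setT sh.
  by apply/measurable_fun_pairP; split; rewrite /sh/=; apply: measurable_funD.
have mf := measurable_modulus Af f0.
pose G := cutoff (disk t) (modulus f \o sh).
have mG : measurable_fun setT G by apply: measurable_cutoff => //; exact: measurableT_comp.
have G0 w : 0 <= G w by rewrite mulr_ge0// rn_ge0.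
have IG : (\int[area]_w (G w)%:E <= (beta + A)%:E)%E.
  apply: (@le_trans _ _ (\int[area]_w ((\1_(disk t) w)%:E + (modulus f (sh w) `^ p)%:E))%E).
    apply: ge0_le_integral => //.
    - by move=> w _; rewrite lee_fin.
    - exact/measurable_EFinP.
    - apply: emeasurable_funD; apply/measurable_EFinP; first exact: measurable_indic.
      by apply: measurable_powRp; exact: measurableT_comp.
    - move=> w _; rewrite -EFinD lee_fin /G.
      have [Bw|Bw] := pselect (disk t w).
        by rewrite cutoffT//= indicE mem_set//; apply: le_1powR; exact: rn_ge0.
      by rewrite cutoffF// addr_ge0 ?powR_ge0.
  rewrite ge0_integralD//; last 3 first.
  - by apply/measurable_EFinP; exact: measurable_indic.
  - by move=> w _; rewrite lee_fin powR_ge0.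
  - by apply/measurable_EFinP/measurable_powRp; exact: measurableT_comp.
  rewrite integral_indic// setIT EFinD bE -AE leeD2l//.
  rewrite pint.unlock -(@area_translation R (complex.Re z0) (complex.Im z0)
    (fun w => (modulus f w `^ p)%:E))//.
  - exact/measurable_EFinP/measurable_powRp.
  - by move=> w; rewrite lee_fin powR_ge0.
suff H n : odd n -> rn (f z0) * beta <= (beta + A) + (m * beta) * 2^-1 ^+ n.
  have := geometric_le H; rewrite -ler_pdivlMr// mulrDl divff ?gt_eqF//.
move=> n_odd; have n0 : (0 < n)%N by case: n n_odd.
have [om hom] := complex_prim_root R n0.
have m0 := has_ps_ge0 s0 fb.
have pw w : (rn (f z0) *+ n) * \1_(disk t) w <=
    \sum_(j < n) G (plane_rot (om ^+ j) w) + ((m * 2^-1 ^+ n) *+ n) * \1_(disk t) w.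
  have [Bw|Bw] := pselect (disk t w); last first.
    rewrite indicE memNset// !mulr0 addr0; apply: sumr_ge0 => j _; exact: G0.
  rewrite indicE mem_set// !mulr1.
  have hs : rn (pt w) <= s by have := ltW Bw; have := s0; rewrite /disk/=; lra.
  have hmean := has_ps_mean fb hom hs.
  apply: (@le_trans _ _ (\sum_(j < n) G (plane_rot (om ^+ j) w) +
    (m * (rn (pt w) / s) ^+ n) *+ n)); last first.
    rewrite lerD2l lerMn2r; apply/orP; right; apply: ler_wpM2l => //.
    apply: lerXn2r; rewrite ?nnegrE ?divr_ge0 ?rn_ge0 ?(ltW s0) ?invr_ge0//.
    rewrite ler_pdivrMr// mulrC; exact: le_trans (ltW Bw) ts.
  rewrite -rn_natmul -(subrK (\sum_(j < n) f (z0 + om ^+ j * pt w)) (f z0 *+ n)).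
  rewrite (le_trans (rnD _ _))// addrC lerD// (le_trans (rn_sum _ _ _))//.
  apply: ler_sum => j _; rewrite /G cutoffT/=; last first.
    by rewrite /disk/= pt_plane_rot rnM rnX (prim_root_rn hom) expr1n mul1r.
  rewrite /modulus le_eqVlt; apply/orP; left; apply/eqP; congr (rn (f _)).
  rewrite -pt_plane_rot /sh; case: (z0) => a c; apply/eqP; rewrite eq_complex/=.
  by apply/andP; split; apply/eqP; rewrite addrC.
have mGr (j : nat) : measurable_fun setT (fun w => G (plane_rot (om ^+ j) w)).
  by apply: (measurableT_comp mG); exact: measurable_plane_rot.
have : (\int[area]_w ((rn (f z0) *+ n) * \1_(disk t) w)%:E <=
   \int[area]_w ((\sum_(j < n) (G (plane_rot (om ^+ j) w))%:E) +
     (((m * 2^-1 ^+ n) *+ n) * \1_(disk t) w)%:E))%E.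
  apply: ge0_le_integral => //.
  - by move=> w _; rewrite lee_fin mulr_ge0// mulrn_wge0// rn_ge0.
  - by apply/measurable_EFinP/measurable_funM => //; exact: measurable_indic.
  - apply: emeasurable_funD.
      by apply: emeasurable_sum => j; exact/measurable_EFinP.
    by apply/measurable_EFinP/measurable_funM => //; exact: measurable_indic.
  - by move=> w _; rewrite sumEFin -EFinD lee_fin.
rewrite ge0_integralD//; last 4 first.
- by move=> w _; apply: sume_ge0 => j _; rewrite lee_fin.
- by apply: emeasurable_sum => j; exact/measurable_EFinP.
- by move=> w _; rewrite lee_fin mulr_ge0// mulrn_wge0// mulr_ge0.
- by apply/measurable_EFinP/measurable_funM => //; exact: measurable_indic.
rewrite ge0_integral_sum//; last 2 first.
- by move=> j; exact/measurable_EFinP.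
- by move=> j w _; rewrite lee_fin.
have rotE (j : nat) :
    (\int[area]_w (G (plane_rot (om ^+ j) w))%:E = \int[area]_w (G w)%:E)%E.
  apply: (area_root_of_unity (g := fun w => (G w)%:E) n_odd) => //.
    by rewrite exprAC (prim_expr_order hom) expr1n.
  exact/measurable_EFinP.
have IGf : (\int[area]_w (G w)%:E)%E \is a fin_num.
  rewrite ge0_fin_numE ?(le_lt_trans IG) ?ltry// integral_ge0// => w _.
  by rewrite lee_fin.
under eq_bigr do rewrite rotE -(fineK IGf).
have cst (c : R) : 0 <= c ->
    (\int[area]_w (c * \1_(disk t) w)%:E = (c * beta)%:E)%E.
  move=> c0; under eq_integral do rewrite EFinM.
  rewrite ge0_integralZl//; last first.
    by apply/measurable_EFinP; exact: measurable_indic.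
  by rewrite integral_indic// setIT bE EFinM.
rewrite !cst ?mulrn_wge0 ?mulr_ge0 ?rn_ge0 ?exprn_ge0 ?invr_ge0//.
rewrite sumEFin sumr_const card_ord.
move: IG; rewrite -(fineK IGf); set I := fine _.
rewrite -EFinD !lee_fin => IG hle.
rewrite -[rn (f z0) *+ n]mulr_natl -[I *+ n]mulr_natl
  -[m * 2^-1 ^+ n *+ n]mulr_natl in hle.
have nR : 0 < n%:R :> R by rewrite ltr0n.
have nI : n%:R * I <= n%:R * (beta + A) by rewrite ler_pM2l.
by rewrite -(ler_pM2l nR); lra.
Qed.

End PointEvaluation.

(** * Calculus of limits along an ultrafilter *)

Section UltraLimitTheory.
Variables (T : Type) (U : set_system T) (R : realType).
Hypothesis hU : UltraFilter U.
Local Notation C := R[i].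
Local Notation rn z := (rnorm (z : C^o)).
Implicit Types (x y : T -> C) (l m : C).

Definition ulim x l := forall e : R, 0 < e -> U [set t | rn (x t - l) < e].

Let FU : ProperFilter U := ultra_proper.

Lemma ulim_cst l : ulim (fun=> l) l.
Proof. by move=> e e0; apply: filterS filterT => t _ /=; rewrite subrr rn0. Qed.

Lemma ulimD x y l m : ulim x l -> ulim y m -> ulim (fun t => x t + y t) (l + m).
Proof.
move=> xl ym e e0; have e2 : 0 < e / 2 by rewrite divr_gt0.
apply: filterS (filterI (xl _ e2) (ym _ e2)) => t /= [h1 h2].
by rewrite opprD addrACA (le_lt_trans (rnD _ _))//; lra.
Qed.

Lemma ulimZ (a : C) x l : ulim x l -> ulim (fun t => a * x t) (a * l).
Proof.
move=> xl e e0; have a1 : 0 < rn a + 1 by rewrite ltr_wpDl ?rn_ge0.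
apply: filterS (xl _ (divr_gt0 e0 a1)) => t /=.
rewrite ltr_pdivlMr// -mulrBr rnM => h; apply: le_lt_trans h.
by rewrite mulrC ler_wpM2l ?rn_ge0// lerDl.
Qed.

Lemma ulimB x y l m : ulim x l -> ulim y m -> ulim (fun t => x t - y t) (l - m).
Proof.
move=> xl ym; have := ulimD xl (ulimZ (-1) ym); rewrite mulN1r.
by congr ulim; apply/funext => t; rewrite mulN1r.
Qed.

Lemma ulim_sum n (x : nat -> T -> C) (l : nat -> C) :
  (forall k, ulim (x k) (l k)) ->
  ulim (fun t => \sum_(0 <= k < n) x k t) (\sum_(0 <= k < n) l k).
Proof.
move=> xl; elim: n => [|n ih].
  rewrite big_geq//; under eq_fun do rewrite big_geq//; exact: ulim_cst.
rewrite big_nat_recr//=; under eq_fun do rewrite big_nat_recr//=.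
exact: ulimD.
Qed.

Lemma ulim_le x l (c : R) : U [set t | rn (x t) <= c] -> ulim x l -> rn l <= c.
Proof.
move=> xc xl; apply/ler_addgt0Pr => e e0.
have [t /= [h1 h2]] := filter_ex (filterI xc (xl e e0)).
have := rnD (l - x t) (x t); rewrite subrK rn_distC; lra.
Qed.

Lemma ulim_unique x l m : ulim x l -> ulim x m -> l = m.
Proof.
move=> xl xm; apply/subr0_eq/rn_eq0/le_anti; rewrite rn_ge0 andbT.
apply: (ulim_le _ (ulimB xl xm)).
by apply: filterS filterT => t _ /=; rewrite subrr rn0.
Qed.

Lemma ulim_exists x (B : R) : (forall t, rn (x t) <= B) -> exists l, ulim x l.
Proof. by move=> xB; exact: ultra_lim xB. Qed.

End UltraLimitTheory.

Section Powers.
Variables (R : realType) (p : R).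
Hypothesis p0 : 0 < p.

Lemma powR_rootK (x : R) : 0 <= x -> (x `^ p^-1) `^ p = x.
Proof. by move=> x0; rewrite -powRrM mulVf ?gt_eqF// powRr1. Qed.

Lemma powRK_root (x : R) : 0 <= x -> (x `^ p) `^ p^-1 = x.
Proof. by move=> x0; rewrite -powRrM mulfV ?gt_eqF// powRr1. Qed.

Lemma lt_powR (x y : R) : 0 <= x -> x < y -> x `^ p < y `^ p.
Proof.
move=> x0 xy; apply: gt0_ltr_powR; rewrite // nnegrE//.
exact: le_trans (ltW xy).
Qed.

Lemma le_powR (x y : R) : 0 <= x -> x <= y -> x `^ p <= y `^ p.
Proof.
move=> x0 xy; apply: ge0_ler_powR; rewrite ?nnegrE ?(ltW p0)//.
exact: le_trans xy.
Qed.

Lemma powR_continuous_ge0 (x e : R) : 0 <= x -> 0 < e ->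
  exists2 d : R, 0 < d &
    forall y, 0 <= y -> `|y - x| < d -> `|y `^ p - x `^ p| < e.
Proof.
move=> x0 e0; have xp0 := powR_ge0 x p.
pose y1 := (x `^ p + e) `^ p^-1.
have y1p : y1 `^ p = x `^ p + e by rewrite powR_rootK// addr_ge0// ltW.
have xy1 : x < y1.
  rewrite ltNge; apply/negP => /le_powR; rewrite y1p powR_ge0 => /(_ isT).
  by rewrite gerDl leNgt e0.
(* When [x ^ p < e] there is no root of [x ^ p - e] to take, and the lower estimate holds since
   powers are nonnegative. *)
have [xe|ex] := ltP (x `^ p) e.
  exists (y1 - x); first by rewrite subr_gt0.
  move=> y y0; rewrite ltr_norml ltrD2r => /andP[_ /(lt_powR y0)]; rewrite y1p => h.
  rewrite ltr_norml ltrBlDl h andbT ltrBrDr addrC.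
  by apply: lt_le_trans (powR_ge0 _ _); rewrite subr_lt0.
pose y2 := (x `^ p - e) `^ p^-1.
have y2p : y2 `^ p = x `^ p - e by rewrite powR_rootK// subr_ge0.
have xy2 : y2 < x.
  rewrite ltNge; apply/negP => /(le_powR x0); rewrite y2p.
  by rewrite lerBrDr gerDl leNgt e0.
exists (Num.min (y1 - x) (x - y2)); first by rewrite lt_min !subr_gt0 xy1.
move=> y y0; rewrite lt_min => /andP[].
rewrite ltr_norml ltrD2r => /andP[_ /(lt_powR y0)]; rewrite y1p => h1.
rewrite ltr_norml opprB ltrD2r => /andP[/(lt_powR (powR_ge0 _ _)) + _].
by rewrite y2p => h2; rewrite ltr_norml ltrBlDl h1 andbT ltrBrDr addrC.
Qed.

End Powers.

Section PintFatou.
Context d (T : measurableType d) (R : realType).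
Variables (mu : {measure set T -> \bar R}) (p : R).
Hypothesis p1 : 1 <= p.

(** Used twice: for norm limits of Cauchy sequences in the Bergman space, and for exhausting the
    disk by smaller disks. *)
Lemma pint_fatou (g : nat -> T -> R) (h : T -> R) (c : R) N :
  (forall n, measurable_fun setT (g n)) -> (forall n x, 0 <= g n x) ->
  (forall x, 0 <= h x) ->
  (forall x (e : R), 0 < e ->
    exists M, forall n, (M <= n)%N -> `|g n x - h x| < e) ->
  (forall n, (N <= n)%N -> (pint mu p (g n) <= c%:E)%E) ->
  (pint mu p h <= c%:E)%E.
Proof.
move=> mg g0 h0 gh gc; have p0 : 0 < p by exact: lt_le_trans p1.
have cv x : (g n x `^ p)%:E @[n --> \oo] --> (h x `^ p)%:E.
  apply: cvg_EFin; first by near=> n.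
  apply/cvgrPdist_lt => e e0.
  have [d0 d00 hd] := powR_continuous_ge0 p0 (h0 x) e0.
  have [M hM] := gh x d0 d00; exists M => // n /= Mn.
  by rewrite distrC hd// hM.
rewrite pint.unlock.
have -> : (\int[mu]_x (h x `^ p)%:E = \int[mu]_x limn_einf (fun n => (g n x `^ p)%:E))%E.
  apply: eq_integral => x _; apply/esym.
  rewrite is_cvg_limn_einfE; last by apply/cvg_ex; eexists; exact: cv.
  exact/cvg_lim.
have mgp n : measurable_fun setT (fun x => (g n x `^ p)%:E).
  exact/measurable_EFinP/measurable_powRp.
apply: le_trans (fatou mu measurableT mgp _) _.
  by move=> n x _; rewrite lee_fin powR_ge0.
rewrite limn_einf_lim; apply: lime_le; first exact: is_cvg_einfs.
exists N => // n /= Nn; apply: le_trans (gc n Nn).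
rewrite pint.unlock; apply: ereal_inf_lbound; exists n => //=.
Unshelve. all: by end_near. Qed.

End PintFatou.

(** * Uniform estimates on the Bergman unit ball, and completeness *)

Section BergmanEstimates.
Variables (R : realType) (p : R).
Hypothesis p1 : 1 <= p.
Local Notation C := R[i].
Local Notation rn z := (rnorm (z : C^o)).
Local Notation area := (area R).
Local Notation norm f := (bergman_norm p f).
Implicit Types f : C -> C^o.

Let p0 : 0 < p. Proof. exact: lt_le_trans p1. Qed.

Lemma bergman_norm_ge0 f : 0 <= norm f. Proof. exact: powR_ge0. Qed.

Lemma locally_ps_closed_disk f z0 (r : R) : analytic_on (@unit_disk R) f ->
  rn z0 + r < 1 -> locally_ps [set z | rn (z - z0) <= r] f.
Proof.
move=> /analytic_onP Af zr w /= wr; apply: Af; apply/unit_diskE.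
have := rnD (w - z0) z0; rewrite subrK; lra.
Qed.

(** For functions of norm 1 the area mean over radius [t = r / 4] gives a constant; homogeneity then
    turns this inhomogeneous bound, with its summand 1, into a multiple of the norm. *)
Lemma bergman_eval : forall r : R, 0 < r -> exists2 K : R, 0 < K &
  forall f z, f \in bergman_function p -> rn z + r < 1 -> rn (f z) <= K * norm f.
Proof.
move=> r r0; pose t := r / 4; have t0 : 0 < t by rewrite divr_gt0.
have t20 : 0 < t ^+ 2 by rewrite exprn_gt0.
exists (1 + (t ^+ 2)^-1); first by rewrite addr_gt0 ?invr_gt0.
have unit_case f z : f \in bergman_function p -> norm f = 1 -> rn z + r < 1 ->
    rn (f z) <= 1 + (t ^+ 2)^-1.
  move=> bf f1 zr; have [[_ _ foo] nf] := bergman_lpfun p1 bf.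
  have [Af f0 _] := bergmanP bf.
  have Lf := locally_ps_closed_disk Af zr.
  have [w wr hw] : exists2 w, rn (w - z) <= r &
      forall y, rn (y - z) <= r -> rn (f y) <= rn (f w).
    apply: (closed_disk_max (ltW r0)) => w wr e e0.
    have [d d0 hd] := locally_ps_continuous Lf wr e0.
    exists d => // y /hd; apply: le_lt_trans.
    have := rnD (f y - f w) (f w); have := rnD (f w - f y) (f y).
    rewrite !subrK rn_distC ler_norml; lra.
  (* The maximum [rn (f w)] depends on [f], but only the radius [r / 2] of the expansion enters the
     bound below. *)
  have [b fb] := cauchy_bound r0 Lf hw.
  have := has_ps_area_mean p1 Af f0 foo (divr_gt0 r0 (ltr0n R 2)) t0 _ fb.
  have -> : t <= r / 2 / 2 by rewrite /t; lra.
  move=> /(_ isT)/le_trans; apply; rewrite lerD2l.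
  rewrite -(pnormXp area p1) -nf f1 powR1 div1r lef_pV2 ?posrE//.
    rewrite -lee_fin fineK ?area_disk_ge// ?(ltW t0)//.
    by rewrite ge0_fin_numE// (le_lt_trans (area_disk_le (ltW t0)))// ltry.
  rewrite -lte_fin fineK.
    by rewrite (lt_le_trans _ (area_disk_ge (ltW t0)))// lte_fin.
  by rewrite ge0_fin_numE// (le_lt_trans (area_disk_le (ltW t0)))// ltry.
move=> f z bf zr; have [f0|f0] := eqVneq (norm f) 0.
  have := bergman_norm_eq0 p1 bf f0 => ->; change (rn (0 : C) <= (1 + t ^- 2) * norm (0 : C -> C^o)).
  rewrite rn0 mulr_ge0 ?bergman_norm_ge0// addr_ge0// invr_ge0 ltW//.
have fp : 0 < norm f by rewrite lt_def f0 bergman_norm_ge0.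
pose c : C := (norm f)^-1%:C.
have rc : rn c = (norm f)^-1 by rewrite rnC// invr_ge0 ltW.
have [bg ng] := bergman_scale p1 c bf.
have := unit_case _ z bg _ zr; rewrite ng rc mulVf// => /(_ erefl).
change (rn (c * f z) <= 1 + t ^- 2 -> rn (f z) <= (1 + t ^- 2) * norm f).
by rewrite rnM rc mulrC ler_pdivrMr.
Qed.

(** One margin [r] holds the disk around [z] on which Cauchy's bound is applied, the other serves to
    evaluate [f] at the points of that disk. *)
Lemma bergman_has_ps : forall r : R, 0 < r -> exists2 K : R, 0 < K &
  forall f z, f \in bergman_function p -> rn z + 2 * r < 1 ->
    exists b, has_ps f z (r / 2) (K * norm f) b.
Proof.
move=> r r0; have [K K0 hK] := bergman_eval r0; exists K => // f z bf zr.
have [Af _ _] := bergmanP bf.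
apply: cauchy_bound => //.
  by apply: locally_ps_closed_disk => //; lra.
move=> w wr; apply: hK => //; have := rnD (w - z) z; rewrite subrK; lra.
Qed.

Lemma bergman_lipschitz : forall r : R, 0 < r -> exists2 K : R, 0 < K &
  forall f z w, f \in bergman_function p -> rn z + 2 * r < 1 ->
    rn (w - z) <= r / 2 -> rn (f w - f z) <= K * rn (w - z) * norm f.
Proof.
move=> r r0; have [K K0 hK] := bergman_has_ps r0.
exists (K / (r / 2)); first by rewrite divr_gt0// divr_gt0.
move=> f z w bf zr wz; have [b fb] := hK f z bf zr.
have := fb 1%N (w - z) wz.
rewrite big_nat1 expr0 mulr1 expr1 -(has_ps_value _ fb) ?divr_gt0//.
rewrite [z + _]addrC subrK => /le_trans; apply.
by rewrite le_eqVlt; apply/orP; left; apply/eqP; field; rewrite gt_eqF.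
Qed.

(** The pointwise ultralimit is analytic because the Taylor coefficients, bounded uniformly, have
    ultralimits too and the remainder estimates pass to the limit. Norm convergence and membership
    come from Fatou. *)
Lemma bergman_complete (f : nat -> C -> C^o) :
  (forall n, f n \in bergman_function p) ->
  (forall e, 0 < e -> exists N, forall n m, (N <= n)%N -> (N <= m)%N ->
     norm (f n - f m) < e) ->
  exists2 g, g \in bergman_function p &
    forall e, 0 < e -> exists N, forall n, (N <= n)%N -> norm (f n - g) <= e.
Proof.
move=> bf cf.
have bB n m : f n - f m \in bergman_function p.
  have [_ h] := bergman_closed p1.
  by have := h (-1) (f m) (f n) (bf m) (bf n); rewrite scaleN1r addrC.
have nB n m : norm (f n) <= norm (f m) + norm (f n - f m).
  rewrite -{1}(subrK (f m) (f n)) addrC; exact: bergman_normD p1 _ _ _ _.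
have [B hB] : exists B, forall n, norm (f n) <= B.
  have [N hN] := cf 1 ltr01.
  have [M hM] := rn_bounded (fun n => (norm (f n))%:C) N.
  exists (Num.max M (norm (f N) + 1)) => n; rewrite le_max.
  have [nN|Nn] := ltnP n N.
    by have := hM n nN; rewrite rnC ?bergman_norm_ge0// => ->.
  by apply/orP; right; rewrite (le_trans (nB n N))// lerD2l ltW// hN.
have B0 : 0 <= B := le_trans (bergman_norm_ge0 _) (hB 0%N).
have [U [hU UN]] := ultra_nat.
have FU : ProperFilter U := @ultra_proper _ _ hU.
have f0 n z : ~ unit_disk z -> f n z = 0 by have [_ h _] := bergmanP (bf n); exact: h.
have gapE (z : C) : unit_disk z -> exists2 r : R, 0 < r & rn z + 2 * r < 1.
  move=> /unit_diskE zr; exists ((1 - rn z) / 4); last lra.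
  by rewrite divr_gt0// subr_gt0.
have /choice[g hg] : forall z, exists l, ulim U (fun n => f n z) l.
  move=> z; have [Dz|nDz] := pselect (unit_disk z); last first.
    by exists 0 => e e0; apply: filterS filterT => n _ /=; rewrite f0// subrr rn0.
  have [r r0 zr] := gapE z Dz; have [K K0 hK] := bergman_eval r0.
  apply: (@ulim_exists _ _ _ hU _ (K * B)) => n.
  rewrite (le_trans (hK _ _ (bf n) _)) ?ler_wpM2l ?(ltW K0)//; lra.
have g0 z : ~ unit_disk z -> g z = 0.
  move=> nDz; apply: (ulim_unique hU (hg z)) => e e0.
  by apply: filterS filterT => n _ /=; rewrite f0// subrr rn0.
(* The Cauchy property upgrades the ultralimit to an ordinary limit, as Fatou's lemma requires. *)
have cvz z (e : R) : 0 < e -> exists N, forall n, (N <= n)%N -> rn (f n z - g z) < e.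
  move=> e0; have [Dz|nDz] := pselect (unit_disk z); last first.
    by exists 0%N => n _; rewrite f0// g0// subrr rn0.
  have [r r0 zr] := gapE z Dz; have [K K0 hK] := bergman_eval r0.
  have e2 : 0 < e / 2 by rewrite divr_gt0.
  have [N hN] := cf _ (divr_gt0 e2 K0); exists N => n Nn.
  have [m /= [Nm hm]] := filter_ex (filterI (UN N) (hg z _ e2)).
  have zr1 : rn z + r < 1 by lra.
  have := hK _ z (bB n m) zr1; have := hN n m Nn Nm.
  rewrite ltr_pdivlMr// => h1 h2.
  have h3 := rnD (f n z - f m z) (f m z - g z).
  rewrite addrA subrK in h3; apply: (le_lt_trans h3).
  have h4 : rn (f n z - f m z) < e / 2.
    by apply: le_lt_trans h2 _; rewrite mulrC.
  lra.
have Ag : analytic_on (@unit_disk R) g.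
  apply/analytic_onP => z Dz; have [r r0 zr] := gapE z Dz.
  have [K K0 hK] := bergman_has_ps r0.
  have /choice[b hb] : forall n, exists b, has_ps (f n) z (r / 2) (K * B) b.
    move=> n; have [b fb] := hK (f n) z (bf n) zr; exists b => k h hr.
    apply: (le_trans (fb k h hr)); apply: ler_wpM2r.
      by rewrite exprn_ge0// divr_ge0 ?rn_ge0// divr_ge0// ltW.
    by rewrite ler_wpM2l ?(ltW K0).
  have r20 : 0 < r / 2 by rewrite divr_gt0.
  have /choice[c hc] : forall k, exists l, ulim U (fun n => b n k) l.
    move=> k; apply: (@ulim_exists _ _ _ hU _ (2 * (K * B) / (r / 2) ^+ k)) => n.
    exact: has_ps_coef (hb n).
  exists (r / 2), (K * B), c; split=> // k h hr.
  apply: (@ulim_le _ U _ hU (fun n => f n (z + h) - \sum_(0 <= j < k) b n j * h ^+ j)).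
    by apply: filterS filterT => n _ /=; exact: hb.
  apply: ulimB => //.
  apply: (@ulim_sum _ U _ hU k (fun j n => b n j * h ^+ j)) => j.
  by have := ulimZ hU (h ^+ j) (hc j); rewrite mulrC; under eq_fun do rewrite mulrC.
have modB n : (forall z, ~ unit_disk z -> (f n - g) z = 0).
  by move=> z nDz; change (f n z - g z = 0); rewrite f0// g0// subrr.
have anB n : analytic_on (@unit_disk R) (f n - g).
  have [An _ _] := bergmanP (bf n).
  have -> : f n - g = (-1) *: (g : C -> C^o) + f n by rewrite scaleN1r addrC.
  exact: (analytic_on_lin (-1) Ag An).
have fatou_bound (e : R) N n : 0 < e -> (N <= n)%N ->
    (forall k m, (N <= k)%N -> (N <= m)%N -> norm (f k - f m) < e) ->
    (pint area p (modulus (f n - g)%R) <= (e `^ p)%:E)%E.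
  move=> e0 Nn hN.
  apply: (@pint_fatou _ _ _ area p p1 (fun m => modulus (f n - f m)) _ _ N).
  - by move=> m; have [[]] := bergman_lpfun p1 (bB n m).
  - by move=> m w; exact: rn_ge0.
  - by move=> w; exact: rn_ge0.
  - move=> w e1 e10; have [M hM] := cvz (w.1 +i* w.2) e1 e10; exists M => m Mm.
    apply: le_lt_trans (hM m Mm); rewrite /modulus; set z := (_ +i* _).
    change (`|rn (f n z - f m z) - rn (f n z - g z)| <= rn (f m z - g z)).
    have := rnD (f n z - f m z) (f m z - g z).
    have := rnD (f n z - g z) (g z - f m z).
    rewrite !addrA !subrK [rn (g z - _)]rn_distC ler_norml; lra.
  - move=> m Nm; have [[_ _ hoo] nE] := bergman_lpfun p1 (bB n m).
    rewrite -(@fineK _ (pint _ _ _)) ?ge0_fin_numE ?pint_ge0// lee_fin.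
    rewrite -(pnormXp area p1) -nE le_powR ?bergman_norm_ge0//.
    by rewrite ltW// hN.
have bg : g \in bergman_function p.
  have [N hN] := cf 1 ltr01.
  have bNg : f N - g \in bergman_function p.
    have foo := le_lt_trans (fatou_bound 1 N N ltr01 (leqnn N) hN) (ltry _).
    exact: (bergman_lpfunW p1 (anB N) (modB N) foo).
  have [_ h] := bergman_closed p1.
  have := h (-1) _ (f N) bNg (bf N).
  by rewrite scaleN1r opprB addrNK.
exists g => // e e0; have [N hN] := cf e e0; exists N => n Nn.
have bng : f n - g \in bergman_function p.
  have [_ h] := bergman_closed p1.
  by have := h (-1) g (f n) bg (bf n); rewrite scaleN1r addrC.
have [_ ->] := bergman_lpfun p1 bng.
rewrite (le_trans (pnorm_le_root p1 _ (fatou_bound e N n e0 Nn hN))) ?powR_ge0//.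
by rewrite powRK_root// ltW.
Qed.

End BergmanEstimates.

(** * Bounded and compact operators *)

Section BoundedOperators.
Variable R : realType.
Implicit Types X Y Z : normedModType R[i].

Lemma rnorm0 X : rnorm (0 : X) = 0. Proof. by rewrite /rnorm normr0. Qed.

Lemma rnormN X (x : X) : rnorm (- x) = rnorm x.
Proof. by rewrite /rnorm normrN. Qed.

Lemma rnorm_distC X (x y : X) : rnorm (x - y) = rnorm (y - x).
Proof. by rewrite -rnormN opprB. Qed.

Lemma rnorm_gt0 X (x : X) : x != 0 -> 0 < rnorm x.
Proof.
by move=> x0; rewrite lt_def rnorm_ge0 andbT; apply: contra x0 => /eqP/rnorm_eq0 ->.
Qed.

Section Theory.
Variables X Y : normedModType R[i].
Implicit Types (S T : bounded_op X Y) (a : R[i]) (x y : X).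

Lemma op_lin T a x y : T (a *: x + y) = a *: T x + T y.
Proof. exact: op_linear. Qed.

Lemma op_add T x y : T (x + y) = T x + T y.
Proof. by have := op_lin T 1 x y; rewrite !scale1r. Qed.

Lemma op_0 T : T 0 = 0.
Proof. by have := op_lin T (-1) 0 0; rewrite scaler0 addr0 scaleN1r addNr. Qed.

Lemma op_scale T a x : T (a *: x) = a *: T x.
Proof. by have := op_lin T a x 0; rewrite op_0 !addr0. Qed.

Lemma op_opp T x : T (- x) = - T x.
Proof. by rewrite -scaleN1r op_scale scaleN1r. Qed.

Lemma op_sub T x y : T (x - y) = T x - T y.
Proof. by rewrite op_add op_opp. Qed.

Lemma opDE S T x : op_fun (S + T) x = S x + T x. Proof. by []. Qed.

Lemma opBE S T x : op_fun (S - T) x = S x - T x. Proof. by []. Qed.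

Lemma opZE a T x : op_fun (a *: T) x = a *: T x. Proof. by []. Qed.

Lemma op_eqP S T : (forall x, S x = T x) -> S = T.
Proof. by move=> ST; apply/val_inj/funext. Qed.

Lemma op_norm_le T (M : R) :
  (forall x, rnorm x <= 1 -> rnorm (T x) <= M) -> rnorm T <= M.
Proof. by move=> h; apply: opnorm_le => x /unit_ballE; exact: h. Qed.

Lemma op_normM T x : rnorm (T x) <= rnorm T * rnorm x.
Proof.
have [->|x0] := eqVneq x 0; first by rewrite op_0 !rnorm0 mulr0.
have x_gt0 := rnorm_gt0 x0.
pose c : R[i] := (rnorm x)^-1%:C.
have rc : rnorm (c : R[i]^o) = (rnorm x)^-1 by rewrite rnC// invr_ge0 ltW.
have : rnorm (T (c *: x)) <= rnorm T.
  apply: opnorm_ub; first exact: ns_valP.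
  by apply/unit_ballE; rewrite rnormZ rc mulVf// gt_eqF.
by rewrite op_scale rnormZ rc mulrC ler_pdivrMr.
Qed.

Lemma op_norm_attained T (d : R) : 0 < d ->
  exists2 x, rnorm x <= 1 & rnorm T - d < rnorm (T x).
Proof.
move=> d0.
have [_ [x /unit_ballE x1 <-] h] := sup_adherent d0 (opnorm_has_sup (ns_valP T)).
by exists x.
Qed.

Lemma mk_op_subproof (f : X -> Y) (M : R) : linear f ->
  (forall x, rnorm (f x) <= M * rnorm x) -> f \in bounded_linear (X:=X) (Y:=Y).
Proof. by move=> lf hM; apply/asboolP; split=> //; exists M. Qed.

Definition mk_op (f : X -> Y) (M : R) (lf : linear f)
    (hM : forall x, rnorm (f x) <= M * rnorm x) : bounded_op X Y :=
  NsElt (N := operators X Y) (mk_op_subproof lf hM).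

End Theory.

Lemma op_id_linear X : linear (@id X). Proof. by []. Qed.

Lemma op_id_bound X (x : X) : rnorm (id x) <= 1 * rnorm x.
Proof. by rewrite mul1r. Qed.

Definition op_id X : bounded_op X X := mk_op (@op_id_linear X) (@op_id_bound X).

Section Composition.
Variables X Y Z : normedModType R[i].
Variables (S : bounded_op Y Z) (T : bounded_op X Y).

Lemma op_comp_linear : linear (fun x => S (T x)).
Proof. by move=> a x y; rewrite !op_lin. Qed.

Lemma op_comp_bound x : rnorm (S (T x)) <= (rnorm S * rnorm T) * rnorm x.
Proof.
rewrite (le_trans (op_normM _ _))// -mulrA ler_wpM2l ?rnorm_ge0//.
exact: op_normM.
Qed.

Definition op_comp : bounded_op X Z := mk_op op_comp_linear op_comp_bound.

Lemma op_compE x : op_comp x = S (T x). Proof. by []. Qed.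

End Composition.
End BoundedOperators.

(** * Total boundedness and precompactness *)

Section TotallyBounded.
Variables (R : realType) (X : normedModType R[i]).
Implicit Types (A : set X).

Definition totally_bounded A := forall e : R, 0 < e ->
  exists s : seq X, forall x, A x -> exists2 y, y \in s & rnorm (x - y) < e.

Definition complete_norm := forall u : nat -> X,
  (forall e : R, 0 < e -> exists N, forall n m, (N <= n)%N -> (N <= m)%N ->
     rnorm (u n - u m) < e) ->
  exists l, forall e : R, 0 < e -> exists N, forall n, (N <= n)%N ->
     rnorm (u n - l) <= e.

(** Balls have radii in [R[i]]; a positive element there is real, so real radii give the same
    topology. *)
Lemma nbhs_rnormP (x : X) (B : set X) : nbhs x B <->
  exists2 e : R, 0 < e & forall y, rnorm (y - x) < e -> B y.
Proof.
split=> [/nbhs_ballP[e /= e0 h]|[e e0 h]].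
  have eE : e = (complex.Re e)%:C by rewrite RRe_real// gtr0_real.
  exists (complex.Re e); first by rewrite -ltcR -eE.
  move=> y yx; apply: h; rewrite -ball_normE /= eE rnormE ltcR.
  by rewrite rnorm_distC.
apply/nbhs_ballP; exists e%:C; first by rewrite /= ltcR.
move=> y; rewrite -ball_normE /= rnormE ltcR rnorm_distC; exact: h.
Qed.

Lemma closureP A x : closure A x <->
  forall e : R, 0 < e -> exists2 y, A y & rnorm (x - y) < e.
Proof.
split=> [cA e e0|h B /nbhs_rnormP[e e0 hB]].
  have [|y [Ay xy]] := cA [set y | rnorm (x - y) < e].
    by apply/nbhs_rnormP; exists e => // y; rewrite rnorm_distC.
  by exists y.
have [y Ay xy] := h e e0; exists y; split=> //; apply: hB.
by rewrite rnorm_distC.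
Qed.

Lemma precompact_totally_bounded A : precompact A -> totally_bounded A.
Proof.
rewrite precompactE compact_cover => cA e e0.
have [|x Ax|D' _ hD'] := cA X setT (fun y => [set x | rnorm (x - y) < e]).
- move=> y _; rewrite openE => x /= xy; apply/nbhs_rnormP.
  exists (e - rnorm (x - y)); first by rewrite subr_gt0.
  move=> z zx; rewrite /= -(subrKA x) (le_lt_trans (rnormD _ _))//.
  by rewrite -ltrBrDr.
- by exists x => //=; rewrite subrr rnorm0.
exists (finmap.enum_fset D') => x Ax.
by have [y /= yD xy] := hD' x (@subset_closure _ A x Ax); exists y.
Qed.

(** An ultrafilter on the closure contains a ball of each radius [1 / (n + 1)]. Any two of these
    balls meet, so their centres form a Cauchy sequence, whose limit is that of the ultrafilter. *)
Lemma totally_bounded_precompact A : complete_norm -> totally_bounded A ->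
  precompact A.
Proof.
move=> cX tA; rewrite precompactE compact_ultra => G hG GA.
have FG : ProperFilter G := @ultra_proper _ _ hG.
have small (e : R) : 0 < e -> exists y, G [set x | rnorm (x - y) < e].
  move=> e0; have e2 : 0 < e / 2 by rewrite divr_gt0.
  have [s hs] := tA _ e2; apply: contrapT => nG.
  (* If no ball around a net point were in [G], the intersection of the finitely many complements
     would be, which the net excludes. *)
  have GC : G [set x | forall y, y \in s -> ~ rnorm (x - y) < e].
    elim: (s) => [|y s' ih]; first by apply: filterS filterT.
    have [h|h] := in_ultra_setVsetC [set x | rnorm (x - y) < e] hG.
      by exfalso; apply: nG; exists y.
    apply: filterS (filterI h ih) => x /= [h1 h2] z.
    by rewrite inE => /orP[/eqP->|/h2].
  have [x /= [/closureP/(_ _ e2)[z /hs[y ys zy] xz] /(_ y ys)]] := filter_ex (filterI GA GC).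
  apply; rewrite -(subrKA z) (le_lt_trans (rnormD _ _))// [e]splitr ltrD//.
have /choice[u hu] : forall n : nat, exists y, G [set x | rnorm (x - y) < n.+1%:R^-1].
  by move=> n; apply: small; rewrite invr_gt0.
have [|l hl] := cX u.
  move=> e e0; have e2 : 0 < e / 2 by rewrite divr_gt0.
  have [N _ /(_ N (leqnn N)) /= hN] := near_infty_natSinv_lt (PosNum e2).
  have lt n : (N <= n)%N -> (n.+1%:R^-1 : R) < e / 2.
    by move=> Nn; apply: le_lt_trans hN; rewrite lef_pV2 ?posrE// ler_nat.
  exists N => n m Nn Nm.
  have [x /= [xn xm]] := filter_ex (filterI (hu n) (hu m)).
  rewrite -(subrKA x) (le_lt_trans (rnormD _ _))// [e]splitr ltrD//.
    by rewrite rnorm_distC (lt_trans xn)// lt.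
  by rewrite (lt_trans xm)// lt.
have Gl (e : R) : 0 < e -> G [set x | rnorm (x - l) < e].
  move=> e0; have e2 : 0 < e / 2 by rewrite divr_gt0.
  have [N hN] := hl _ e2.
  have [M _ /(_ M (leqnn M)) /= hM] := near_infty_natSinv_lt (PosNum e2).
  apply: filterS (hu (maxn N M)) => x /= xu.
  rewrite -(subrKA (u (maxn N M))) (le_lt_trans (rnormD _ _))// [e]splitr.
  rewrite ltr_leD ?hN ?leq_maxl// (lt_trans xu)//; apply: le_lt_trans hM.
  by rewrite lef_pV2 ?posrE// ler_nat ltnS leq_maxr.
exists l; split.
  apply/closureP => e e0; have e2 : 0 < e / 2 by rewrite divr_gt0.
  have [x /= [/closureP/(_ _ e2)[y Ay xy] xl]] := filter_ex (filterI GA (Gl _ e2)).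
  exists y => //; rewrite -(subrKA x) (le_lt_trans (rnormD _ _))// [e]splitr.
  by rewrite ltrD// rnorm_distC.
by move=> B /nbhs_rnormP[e e0 hB]; apply: filterS (Gl e e0).
Qed.

End TotallyBounded.

Section CompactOperators.
Variables (R : realType) (X : normedModType R[i]).
Implicit Types (S T : bounded_op X X).

(** Compactness of [T] as an estimate; unlike precompactness it passes directly to sums,
    compositions and norm limits. *)
Definition finite_nets T := forall e : R, 0 < e ->
  exists s : seq X, forall x, rnorm x <= 1 ->
    exists2 y, y \in s & rnorm (T x - y) < e.

Lemma compact_operatorsP T : complete_norm X ->
  compact_operators T <-> finite_nets T.
Proof.
move=> cX; split=> [/precompact_totally_bounded tT e /tT[s hs]|nT].
  by exists s => x x1; apply: hs; exists x => //; apply/unit_ballE.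
apply: totally_bounded_precompact => // e /nT[s hs].
by exists s => _ [x /unit_ballE x1 <-]; exact: hs.
Qed.

Lemma finite_nets_ball T (r e : R) : finite_nets T -> 0 < r -> 0 < e ->
  exists s : seq X, forall x, rnorm x <= r ->
    exists2 y, y \in s & rnorm (T x - y) < e.
Proof.
move=> nT r0 e0; have [s hs] := nT _ (divr_gt0 e0 r0).
have rc : rnorm (r%:C : R[i]^o) = r by rewrite rnC// ltW.
have rn0 : r%:C != 0 :> R[i] by rewrite eq_complex/= eqxx andbT gt_eqF.
exists [seq r%:C *: y | y <- s] => x xr.
have [|y ys h] := hs (r%:C^-1 *: x).
  rewrite rnormZ rnV rc mulrC ler_pdivrMr// mul1r//.
exists (r%:C *: y); first exact: map_f.
rewrite -(scale1r (T x)) -(divff rn0) -scalerA -scalerBr rnormZ rc.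
by rewrite -op_scale mulrC -ltr_pdivlMr.
Qed.

Lemma finite_netsD S T : finite_nets S -> finite_nets T -> finite_nets (S + T).
Proof.
move=> nS nT e e0; have e2 : 0 < e / 2 by rewrite divr_gt0.
have [s hs] := nS _ e2; have [t ht] := nT _ e2.
exists [seq y + z | y <- s, z <- t] => x x1.
have [y ys hy] := hs x x1; have [z zt hz] := ht x x1.
exists (y + z); first exact: allpairs_f.
by rewrite opDE opprD addrACA (le_lt_trans (rnormD _ _))// [e]splitr ltrD.
Qed.

Lemma finite_netsZ (a : R[i]) T : finite_nets T -> finite_nets (a *: T).
Proof.
move=> nT e e0; have a1 : 0 < rnorm (a : R[i]^o) + 1 by rewrite ltr_wpDl ?rnorm_ge0.
have [s hs] := nT _ (divr_gt0 e0 a1); exists [seq a *: y | y <- s] => x /hs[y ys].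
rewrite ltr_pdivlMr// => h; exists (a *: y); first exact: map_f.
rewrite opZE -scalerBr rnormZ; apply: le_lt_trans h.
by rewrite mulrC ler_wpM2l ?rnorm_ge0// lerDl.
Qed.

Lemma finite_nets_compl S T : finite_nets T -> finite_nets (op_comp S T).
Proof.
move=> nT e e0; have a1 : 0 < rnorm S + 1 by rewrite ltr_wpDl ?rnorm_ge0.
have [s hs] := nT _ (divr_gt0 e0 a1); exists [seq S y | y <- s] => x /hs[y ys].
rewrite ltr_pdivlMr// => h; exists (S y); first exact: map_f.
rewrite op_compE -op_sub (le_lt_trans (op_normM _ _))//; apply: le_lt_trans h.
by rewrite mulrC ler_wpM2l ?rnorm_ge0// lerDl.
Qed.

Lemma finite_nets_compr S T : finite_nets T -> finite_nets (op_comp T S).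
Proof.
move=> nT e e0; have a1 : 0 < rnorm S + 1 by rewrite ltr_wpDl ?rnorm_ge0.
have [s hs] := finite_nets_ball nT a1 e0; exists s => x x1; apply: hs.
rewrite (le_trans (op_normM _ _))// (@le_trans _ _ (rnorm S))//.
  by rewrite ler_piMr ?rnorm_ge0.
by rewrite lerDl.
Qed.

Lemma finite_nets0 : finite_nets (0 : bounded_op X X).
Proof.
move=> e e0; exists [:: 0] => x _; exists 0; first by rewrite inE.
by rewrite subr0; change (rnorm (0 : X) < e); rewrite rnorm0.
Qed.

Lemma finite_nets_closed T :
  (forall e : R, 0 < e -> exists2 S, finite_nets S & rnorm (T - S) < e) ->
  finite_nets T.
Proof.
move=> h e e0; have e2 : 0 < e / 2 by rewrite divr_gt0.
have [S nS TS] := h _ e2; have [s hs] := nS _ e2; exists s => x x1.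
have [y ys Sy] := hs x x1; exists y => //.
rewrite -(subrKA (S x)) (le_lt_trans (rnormD _ _))// [e]splitr ltrD//.
rewrite -opBE (le_lt_trans (op_normM _ _))//; apply: le_lt_trans TS.
by rewrite ler_piMr ?rnorm_ge0.
Qed.

Lemma compact_operators_submod : complete_norm X ->
  submod_closed (mem (@compact_operators R X)).
Proof.
move=> cX; split=> [|a S T].
  by rewrite inE; apply/(compact_operatorsP _ cX); exact: finite_nets0.
rewrite !inE => /(compact_operatorsP _ cX) nS /(compact_operatorsP _ cX) nT.
by apply/(compact_operatorsP _ cX); apply: finite_netsD => //; exact: finite_netsZ.
Qed.

Lemma compact_operators_closed : complete_norm X ->
  closed (@compact_operators R X).
Proof.
move=> cX T /closureP cT; apply/(compact_operatorsP _ cX).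
apply: finite_nets_closed => e /cT[S /(compact_operatorsP _ cX) nS TS].
by exists S.
Qed.

End CompactOperators.

(** * Compact operators as an M-ideal *)

Section MIdealCriterion.
Variables (R : realType) (X : normedModType R[i]).
Hypothesis X_complete : complete_norm X.
Local Notation C := R[i].
Local Notation L := (bounded_op X X).
Local Notation dual := (bounded_op L C^o).
Local Notation rn z := (rnorm (z : C^o)).
Implicit Types (S T : L) (e v : dual).

Variables (A B : nat -> L -> L) (c : R).
Hypothesis A_lin : forall n a S T, A n (a *: S + T) = a *: A n S + A n T.
Hypothesis A_bound : forall n S, rnorm (A n S) <= c * rnorm S.
Hypothesis A_finite_nets : forall n S, finite_nets (A n S).
Hypothesis A_cvg : forall T (d : R), finite_nets T -> 0 < d ->
  exists N, forall n, (N <= n)%N -> rnorm (T - A n T) <= d.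
Hypothesis B_scale : forall n a T, B n (a *: T) = a *: B n T.
Hypothesis B_finite_nets : forall n T, finite_nets (T - B n T).
Hypothesis AB_norm : forall d : R, 0 < d -> exists N, forall n m S T,
  (N <= n)%N -> (n < m)%N -> rnorm S <= 1 -> rnorm T <= 1 ->
  rnorm (A n S + B m T) <= 1 + d.

Let kills_compact e := forall T, finite_nets T -> e T = 0.

Let annihilatorP e : annihilator (@compact_operators R X) e <-> kills_compact e.
Proof.
by split=> h T nT; apply: h; apply/(compact_operatorsP _ X_complete).
Qed.

Let ops_le e T : rn (e T) <= rnorm e * rnorm T. Proof. exact: op_normM. Qed.

Let excess_le (q s V t x W E : R) : s + q <= E + x -> E <= W ->
  W <= V + V * t -> V - t < s -> x < t -> q <= t * V + 2 * t.
Proof. lra. Qed.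

(** An almost norming [T] is multiplied by a number of modulus 1 that makes [e T] real and
    nonnegative. *)
Lemma dual_norm_attained e (d : R) : 0 < d ->
  exists T, rnorm T <= 1 /\ exists2 t : R, rnorm e - d < t & e T = t%:C.
Proof.
move=> /(op_norm_attained e)[T T1 eT].
have [e0|e0] := eqVneq (e T) 0.
  by exists T; split=> //; exists 0 => //; rewrite e0 rnorm0 in eT.
pose a : C := (rn (e T))%:C / e T.
have a1 : rn a = 1.
  by rewrite rnM rnV rnC ?rn_ge0// divff// gt_eqF// rn_gt0.
exists (a *: T); rewrite rnormZ a1 mul1r; split=> //.
exists (rn (e T)) => //; rewrite op_scale.
by change ((rn (e T))%:C / e T * e T = (rn (e T))%:C); rewrite divfK.
Qed.

(** [V] consists of the functionals recovered along [U] from their values on the compact operators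
    [A n S]. By [A_cvg] the limit [v] agrees with [e] on compact operators. For the norms, [e] is
    tested on [A n S + B m T], where [S] and [T] almost norm [v] and [j]. *)
Lemma M_ideal_compact_operators : M_ideal (@compact_operators R X).
Proof.
have [U [hU UN]] := ultra_nat.
have FU : ProperFilter U := @ultra_proper _ _ hU.
have c0 S : 0 <= c * rnorm S := le_trans (rnorm_ge0 _) (A_bound 0%N S).
pose V : set dual := [set v | forall S, ulim U (fun n => v (A n S)) (v S)].
have sV : submod_closed (mem V).
  split=> [|a v w]; rewrite !inE.
    by move=> S; exact: (@ulim_cst _ U _ hU 0).
  move=> hv hw S; rewrite opDE opZE.
  exact: (ulimD hU (ulimZ hU a (hv S)) (hw S)).
have proj e : exists2 v, V v & kills_compact (e - v).
  have eA n S : rn (e (A n S)) <= rnorm e * c * rnorm S.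
    by rewrite (le_trans (ops_le _ _))// -mulrA ler_wpM2l ?rnorm_ge0.
  have /choice[f hf] : forall S, exists l, ulim U (fun n => e (A n S)) l.
    by move=> S; apply: (ulim_exists hU) => n; exact: eA.
  have lf : linear (f : L -> C^o).
    move=> a S T; apply: (ulim_unique hU (hf _)).
    have := ulimD hU (ulimZ hU a (hf S)) (hf T).
    congr ulim; apply/funext => n; rewrite A_lin op_lin//.
  have bf S : rnorm (f S : C^o) <= (rnorm e * c) * rnorm S.
    apply: (ulim_le hU _ (hf S)); apply: filterS filterT => n _; exact: eA.
  pose v : dual := mk_op lf bf.
  have vK T : finite_nets T -> v T = e T.
    move=> nT; apply: (ulim_unique hU (hf T)) => d d0.
    have e1 : 0 < rnorm e + 1 by rewrite ltr_wpDl ?rnorm_ge0.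
    have [N hN] := A_cvg nT (divr_gt0 d0 e1).
    apply: filterS (UN N) => n /= Nn.
    have -> : e (A n T) - e T = e (A n T - T) by rewrite op_sub.
    apply: (le_lt_trans (ops_le _ _)); have := hN n Nn.
    rewrite rnorm_distC ler_pdivlMr// mulrC mulrDl mul1r => h.
    have [->|T0] := eqVneq (rnorm (A n T - T)) 0; first by rewrite mulr0.
    apply: lt_le_trans h; rewrite ltrDl lt_def T0 rnorm_ge0//.
  exists v; last by move=> T nT; rewrite opBE vK// subrr.
  move=> S; have := hf S; congr ulim; apply/funext => n.
  by rewrite vK.
have VK v : V v -> kills_compact v -> v = 0.
  move=> Vv vk; apply: op_eqP => S; apply: (ulim_unique hU (Vv S)).
  have -> : (fun n => v (A n S)) = (fun=> 0) by apply/funext => n; rewrite vk.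
  exact: (@ulim_cst _ U _ hU 0).
split; [exact: compact_operators_submod|exact: compact_operators_closed|].
exists V => // e; have [v Vv ev] := proj e.
exists (e - v, v).
  split=> /=; first by split=> //; [exact/annihilatorP|rewrite subrK].
  move=> [j' v'] /= [/annihilatorP kj' Vv' eE].
  have d0 : v - v' = 0.
    apply: VK.
      have [_ h] := sV; have := h (-1) v' v; rewrite !inE scaleN1r addrC.
      exact.
    move=> T nT; have -> : v - v' = j' - (e - v).
      by rewrite eE opprB addrCA opprD addNKr.
    by rewrite opBE kj'// ev// subrr.
  by rewrite -[v](subrK v') d0 add0r eE addrK.
rewrite /=.
have [j jE] : exists j : dual, j = e - v by exists (e - v).
rewrite -jE in ev *.
have eE T : e T = j T + v T by rewrite jE opBE subrK.
apply/le_anti; rewrite !rnormE -rmorphD/= !lecR; apply/andP; split.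
  by rewrite -{1}(subrK v e) -jE rnormD.
apply/ler_addgt0Pr => d d0.
pose k := rnorm e + rnorm v + 8.
have k0 : 0 < k by rewrite /k; have := rnorm_ge0 e; have := rnorm_ge0 v; lra.
pose t := d / k; have t0 : 0 < t by rewrite divr_gt0.
have [S [S1 [s1 hs1 vS]]] := dual_norm_attained v t0.
have [T [T1 [s2 hs2 jT]]] := dual_norm_attained j t0.
have [N hN] := AB_norm t0.
have [n /= [Nn hn]] := filter_ex (filterI (UN N) (Vv S t t0)).
(* The estimate [AB_norm] is uniform in [m > n], so the next index serves and no second limit is
   taken. *)
pose Tm := B n.+1 T.
have jTm : j Tm = j T.
  by have := ev _ (B_finite_nets n.+1 T); rewrite op_sub => /subr0_eq ->.
(* Testing [v] alone on [A n S + B n.+1 (a *: T)], with the phase [a] aligned, shows this: [S]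
   already uses up almost all of the norm of [v]. *)
have vTm : rn (v Tm) <= t * rnorm v + 2 * t.
  have [v0|v0] := eqVneq (v Tm) 0.
    rewrite v0 rn0 addr_ge0//; first by rewrite mulr_ge0 ?rnorm_ge0// ltW.
    by rewrite mulr_ge0// ltW.
  pose a : C := (rn (v Tm))%:C / v Tm.
  have a1 : rn a = 1 by rewrite rnM rnV rnC ?rn_ge0// divff// gt_eqF// rn_gt0.
  have aT1 : rnorm (a *: T) <= 1 by rewrite rnormZ a1 mul1r.
  have h1 := hN n n.+1 S (a *: T) Nn (ltnSn n) S1 aT1.
  have h2 := ops_le v (A n S + B n.+1 (a *: T)).
  have vE : v (A n S + B n.+1 (a *: T)) = (v (A n S) - v S) + (s1 + rn (v Tm))%:C.
    rewrite op_add B_scale op_scale -/Tm vS rmorphD/=.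
    have -> : a *: (v Tm) = (rn (v Tm))%:C.
      by change ((rn (v Tm))%:C / v Tm * v Tm = (rn (v Tm))%:C); rewrite divfK.
    by rewrite addrA subrK.
  have h3 := rnB ((v (A n S) - v S) + (s1 + rn (v Tm))%:C) (v (A n S) - v S).
  rewrite addrAC subrr add0r -vE rnR in h3.
  have h4 := le_trans (ler_norm _) h3.
  have h5 : rnorm v * rnorm (A n S + B n.+1 (a *: T)) <= rnorm v * (1 + t).
    by rewrite ler_wpM2l ?rnorm_ge0.
  rewrite mulrDr mulr1 in h5; exact: (excess_le h4 h2 h5 hs1 hn).
have h1 := hN n n.+1 S T Nn (ltnSn n) S1 T1.
have h2 := ops_le e (A n S + B n.+1 T).
(* [j] kills the compact [A n S] and does not distinguish [Tm] from [T], so the value is [s1 + s2]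
   up to small terms. *)
have eS : e (A n S + B n.+1 T) = (v (A n S) - v S + v Tm) + (s1 + s2)%:C.
  rewrite op_add !eE -/Tm jTm jT vS ev// add0r rmorphD/=.
  by rewrite [LHS]addrC -!addrA; ring.
have h3 := rnB (e (A n S + B n.+1 T)) (v (A n S) - v S + v Tm).
rewrite {1}eS [X in rn (X - _)]addrC addrK rnR in h3.
have h4 := le_trans (ler_norm _) h3.
have h5 := rnD (v (A n S) - v S) (v Tm).
have h6 : rnorm e * rnorm (A n S + B n.+1 T) <= rnorm e * (1 + t).
  by rewrite ler_wpM2l ?rnorm_ge0.
have tk : t * k = d by rewrite divfK// gt_eqF.
rewrite /k in tk; lra.
Qed.

End MIdealCriterion.

(** * Inequalities for p-th powers *)

Section PowerInequalities.
Variables (R : realType) (p : R).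
Hypothesis p1 : 1 < p.

Let p0 : 0 < p. Proof. exact: lt_trans p1. Qed.

Lemma convex_powR_le (l x y : R) : 0 <= l <= 1 -> 0 <= x -> 0 <= y ->
  (l * x + (1 - l) * y) `^ p <= l * x `^ p + (1 - l) * y `^ p.
Proof.
move=> /andP[l0 l1] x0 y0.
have := @convex_powR R p (ltW p1) (Itv01 l0 l1) x y.
rewrite !inE /= !in_itv /= !andbT => /(_ x0 y0).
by rewrite !convRE.
Qed.

(* Minkowski's inequality for the vectors [(a, b)] and [(e, e)] of the plane. *)
Lemma powR_plane (a b e : R) : 0 <= a -> 0 <= b -> 0 <= e ->
  (a + e) `^ p + (b + e) `^ p <= ((a `^ p + b `^ p) `^ p^-1 + 2 * e) `^ p.
Proof.
move=> a0 b0 e0; set c := (a `^ p + b `^ p) `^ p^-1.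
have ab0 : 0 <= a `^ p + b `^ p by rewrite addr_ge0 ?powR_ge0.
have cp : c `^ p = a `^ p + b `^ p by rewrite /c powR_rootK.
have c0 : 0 <= c by exact: powR_ge0.
have ac : a <= c.
  rewrite leNgt; apply/negP => /(lt_powR p0 c0); rewrite cp ltNge lerDl.
  by rewrite powR_ge0.
have bc : b <= c.
  rewrite leNgt; apply/negP => /(lt_powR p0 c0); rewrite cp ltNge lerDr.
  by rewrite powR_ge0.
have [->|en0] := eqVneq e 0; first by rewrite mulr0 !addr0 cp.
have ep : 0 < e by rewrite lt_def en0.
have [c00|cn0] := eqVneq c 0.
  have a00 : a = 0 by apply/le_anti; rewrite a0 -c00 ac.
  have b00 : b = 0 by apply/le_anti; rewrite b0 -c00 bc.
  have -> : (a + e) `^ p + (b + e) `^ p = 2 * e `^ p.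
    by rewrite a00 b00 !add0r mulrDl mul1r.
  rewrite c00 add0r powRM// ler_wpM2r ?powR_ge0//.
  by apply: le1r_powR; rewrite ?ler1n// ltW.
have cgt : 0 < c by rewrite lt_def cn0.
set s := c + 2 * e; have s0 : 0 < s by rewrite addr_gt0 ?mulr_gt0.
pose l := c / s.
have l01 : 0 <= l <= 1.
  by rewrite divr_ge0 ?(ltW s0)//= ler_pdivrMr// mul1r lerDl mulr_ge0.
(* [(x + e) / s] is the convex combination of [x / c] and 1/2 with weights [l] and [1 - l]. By
   convexity and [2^-1 ^ p <= 2^-1], the bounds for [a] and [b] sum to 1. *)
have key x : 0 <= x -> ((x + e) / s) `^ p <= l * (x / c) `^ p + (1 - l) / 2.
  move=> x0; have -> : (x + e) / s = l * (x / c) + (1 - l) * 2^-1.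
    by rewrite /l /s; field; rewrite !gt_eqF// addr_gt0// mulr_gt0.
  apply: le_trans (convex_powR_le l01 _ _) _; rewrite ?divr_ge0 ?invr_ge0//.
  rewrite lerD2l ler_wpM2l// ?subr_ge0; first by case/andP: l01.
  by apply: ge1r_powR; rewrite ?(ltW p1)// invr_gt0 ltr0n invf_le1// ler1n.
have h := lerD (key a a0) (key b b0).
rewrite !powRM ?addr_ge0 ?invr_ge0 ?(ltW s0) ?(ltW cgt)// in h.
rewrite -mulrDl in h.
have cV : c^-1 `^ p * (a `^ p + b `^ p) = 1.
  by rewrite -cp -powRM ?invr_ge0 ?(ltW cgt)// mulVf// powR1.
have sV : s^-1 `^ p * s `^ p = 1.
  by rewrite -powRM ?invr_ge0 ?(ltW s0)// mulVf ?gt_eqF// powR1.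
have sp : 0 < s `^ p by rewrite powR_gt0.
have E : l * (a `^ p * c^-1 `^ p) + (1 - l) / 2 +
    (l * (b `^ p * c^-1 `^ p) + (1 - l) / 2) = 1.
  transitivity (l * (c^-1 `^ p * (a `^ p + b `^ p)) + (1 - l)); first by field.
  by rewrite cV mulr1 addrC subrK.
rewrite E in h; have := ler_wpM2r (ltW sp) h.
by rewrite -mulrA sV mulr1 mul1r.
Qed.

(** Here [p > 1] is decisive: [k ^ (p - 1)] is unbounded. This yields both the cutoff operators and
    the smallness of [T (I - K_n)]. *)
Lemma linear_lt_power (D : R) : exists k : nat, D * k.+1%:R < k.+1%:R `^ p.
Proof.
pose y := (`|D| + 1) `^ (p - 1)^-1.
have q0 : 0 < p - 1 by rewrite subr_gt0.
have [k hk] : exists k : nat, y < k.+1%:R.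
  exists (Num.bound `|y|); apply: (le_lt_trans (ler_norm _)).
  by rewrite (lt_trans (archi_boundP (normr_ge0 _)))// ltr_nat.
exists k; rewrite -[ltRHS]mulr_powRB1// mulrC ltr_pM2l// -/(_ `^ _).
apply: (@lt_trans _ _ (`|D| + 1)).
  by rewrite (le_lt_trans (ler_norm _))// ltrDl.
have := lt_powR q0 (powR_ge0 _ _) hk.
by rewrite powR_rootK// addr_ge0.
Qed.

End PowerInequalities.

Lemma eps_small (R : realType) (e : R) : 0 < e -> exists N : nat,
  forall n, (N <= n)%N -> (n.+1%:R^-1 : R) < e.
Proof.
move=> e0; have [N _ /(_ N (leqnn N)) /= hN] := near_infty_natSinv_lt (PosNum e0).
exists N => n Nn; apply: le_lt_trans hN.
by rewrite lef_pV2 ?posrE// ler_nat.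
Qed.

Lemma seq_uniform_bound (T : eqType) (s : seq T) (P : T -> nat -> Prop) :
  (forall y, exists N, forall n, (N <= n)%N -> P y n) ->
  exists N, forall y n, y \in s -> (N <= n)%N -> P y n.
Proof.
move=> h; elim: s => [|y s [N hN]]; first by exists 0%N.
have [M hM] := h y; exists (maxn M N) => z n.
by rewrite inE geq_max => /orP[/eqP->|zs] /andP[Mn Nn]; [exact: hM|exact: hN].
Qed.

(* [inner n] and [outer n] stand for the norms of the restrictions of a function
   to an increasing sequence of regions and to their complements; [K n] acts
   almost as the multiplication by a function with values in [0, 1] which is 1
   on the n-th region and 0 off the (n+1)-st. *)
Section CutoffOperators.
Variables (R : realType) (p : R).
Hypothesis p1 : 1 < p.
Variable X : normedModType R[i].
Hypothesis X_complete : complete_norm X.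
Variables (inner outer : nat -> X -> R) (K : nat -> bounded_op X X).

Hypothesis inner_ge0 : forall n x, 0 <= inner n x.
Hypothesis outer_ge0 : forall n x, 0 <= outer n x.
Hypothesis inner_outer : forall n x,
  rnorm x `^ p = inner n x `^ p + outer n x `^ p.
Hypothesis innerD : forall n x y, inner n (x + y) <= inner n x + inner n y.
Hypothesis outerD : forall n x y, outer n (x + y) <= outer n x + outer n y.
Hypothesis inner_mono : forall n m x, (n <= m)%N -> inner n x <= inner m x.
Hypothesis outer_mono : forall n m x, (n <= m)%N -> outer m x <= outer n x.
Hypothesis outer_cvg0 : forall x (e : R), 0 < e -> exists n, outer n x < e.

Local Notation eps n := (n.+1%:R^-1 : R).

Hypothesis K_finite_nets : forall n, finite_nets (K n).
Hypothesis K_le : forall n x, rnorm (K n x) <= inner n.+1 x + eps n * rnorm x.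
Hypothesis KC_le : forall n x, rnorm (x - K n x) <= outer n x + eps n * rnorm x.
Hypothesis K_outer : forall n x, outer n.+1 (K n x) <= eps n * rnorm x.
Hypothesis KC_inner : forall n x, inner n (x - K n x) <= eps n * rnorm x.

Let p0 : 0 < p. Proof. exact: lt_trans p1. Qed.

Implicit Types (x y : X) (S T : bounded_op X X).

Let eps_gt0 n : 0 < eps n. Proof. by rewrite invr_gt0. Qed.

Let eps_le1 n : eps n <= 1. Proof. by rewrite invf_le1// ler1n. Qed.

Let eps_mono n m : (n <= m)%N -> eps m <= eps n.
Proof. by move=> nm; rewrite lef_pV2 ?posrE// ler_nat. Qed.

Let le_root (u v : R) : 0 <= v -> u `^ p <= v `^ p -> u <= v.
Proof. by move=> v0 uv; rewrite leNgt; apply/negP => /(lt_powR p0 v0); rewrite ltNge uv. Qed.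

Let inner_le n x : inner n x <= rnorm x.
Proof. by apply: le_root (rnorm_ge0 _) _; rewrite (inner_outer n) lerDl powR_ge0. Qed.

Let outer_le n x : outer n x <= rnorm x.
Proof. by apply: le_root (rnorm_ge0 _) _; rewrite (inner_outer n) lerDr powR_ge0. Qed.

Let K_le2 n x : rnorm (K n x) <= 2 * rnorm x.
Proof.
rewrite (le_trans (K_le _ _))// mulr_natl mulr2n lerD//.
by rewrite ler_piMl ?rnorm_ge0.
Qed.

Let inner_eps_le (o s t : R) : t <= s -> o + s + 2 * s + 2 * t <= o + 5 * s.
Proof. lra. Qed.

Let outer_eps_le (o s t : R) : t <= s -> o + t + 2 * t + 2 * s <= o + 5 * s.
Proof. lra. Qed.

Definition complK n : bounded_op X X := op_id X - K n.

Let complKE n x : complK n x = x - K n x. Proof. by []. Qed.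

Let complK_le2 n x : rnorm (complK n x) <= 2 * rnorm x.
Proof.
rewrite complKE (le_trans (KC_le _ _))// mulr_natl mulr2n lerD//.
by rewrite ler_piMl ?rnorm_ge0.
Qed.

Lemma complK_cvg0 x (e : R) : 0 < e ->
  exists N, forall n, (N <= n)%N -> rnorm (complK n x) < e.
Proof.
move=> e0; have e2 : 0 < e / 2 by rewrite divr_gt0.
have x1 : 0 < rnorm x + 1 by rewrite ltr_wpDl ?rnorm_ge0.
have [N hN] := outer_cvg0 x e2; have [M hM] := eps_small (divr_gt0 e2 x1).
exists (maxn N M) => n; rewrite geq_max => /andP[Nn Mn].
rewrite complKE (le_lt_trans (KC_le _ _))// [e]splitr ltrD//.
  by rewrite (le_lt_trans (outer_mono _ Nn)).
have := hM n Mn; rewrite ltr_pdivlMr// => h; apply: le_lt_trans h.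
by rewrite ler_wpM2l// ?lerDl// ltW.
Qed.

(** Pointwise convergence to 0 of uniformly bounded operators is uniform on the totally bounded
    image of the unit ball. *)
Lemma complK_left T (e : R) : finite_nets T -> 0 < e ->
  exists N, forall n, (N <= n)%N -> rnorm (op_comp (complK n) T) <= e.
Proof.
move=> nT e0; have e4 : 0 < e / 4 by rewrite divr_gt0.
have e2 : 0 < e / 2 by rewrite divr_gt0.
have [s hs] := nT _ e4.
have [N hN] := seq_uniform_bound s (P := fun y n => rnorm (complK n y) < e / 2)
  (fun y => complK_cvg0 y e2).
exists N => n Nn; apply: op_norm_le => x /hs[y ys Ty].
rewrite op_compE -(subrK y (T x)) op_add (le_trans (rnormD _ _))//.
have := complK_le2 n (T x - y); have := hN y n ys Nn; lra.
Qed.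

(* Almost disjointly supported sums of [N] vectors of the unit ball have norm
   of order [N ^ (1 / p)], which is negligible with respect to [N]. *)
Lemma complK_right T (e : R) : finite_nets T -> 0 < e ->
  exists N, forall n, (N <= n)%N -> rnorm (op_comp T (complK n)) <= e.
Proof.
move=> nT e0; apply: contrapT => nN.
have e4 : 0 < e / 4 by rewrite divr_gt0.
have [s hs] := finite_nets_ball nT (ltr0n R 2) e4.
pose bad y n x := [/\ rnorm x <= 1, e < rnorm (T (complK n x)) &
  rnorm (T (complK n x) - y) < e / 4].
(* Pigeonhole on the finite net: one point [y] is close to [T (complK n x)] for arbitrarily large
   [n]. Adding such vectors makes their images add up almost to multiples of [y]. *)
have [y hy] : exists y, forall N, exists2 n, (N <= n)%N & exists x, bad y n x.
  apply: contrapT => ny.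
  have hb y : exists N, forall n, (N <= n)%N -> ~ exists x, bad y n x.
    apply: contrapT => h; apply: ny; exists y => N.
    apply: contrapT => h2; apply: h; exists N => n Nn bx; apply: h2.
    by exists n.
  have [N hN] := seq_uniform_bound s hb.
  apply: nN; exists N => n Nn; apply: op_norm_le => x x1; rewrite op_compE.
  rewrite leNgt; apply/negP => ex.
  have [|y ys hy] := hs (complK n x).
    by rewrite (le_trans (complK_le2 _ _))// ler_piMr.
  by apply: (hN y n ys Nn); exists x.
have ye : 3 * (e / 4) < rnorm y.
  have [n _ [x [_ h1 h2]]] := hy 0%N.
  have := rnormD (T (complK n x) - y) y; rewrite subrK; lra.
(* Each new vector raises the p-th power of the norm by at most [c]: for [n] large the inner part
   grows by 1, and the outer part is at most 2, namely 1/2 from [h] and 3/2 from the new vector. *)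
pose c := 2 `^ p + 1.
have sums k : exists h : X, rnorm h `^ p <= c * k%:R /\
    rnorm (T h - k%:R%:C *: y) <= k%:R * (e / 4).
  elim: k => [|k [h [h1 h2]]].
    exists 0; rewrite op_0 scale0r subr0 !rnorm0 powR0 ?gt_eqF// !mulr0 mul0r.
    by split.
  have [d d0 hd] := powR_continuous_ge0 p0 (rnorm_ge0 h) ltr01.
  have [N1 hN1] := eps_small d0.
  have h20 : 0 < 2^-1 :> R by rewrite invr_gt0.
  have [N2 hN2] := eps_small h20; have [N3 hN3] := outer_cvg0 h h20.
  have [n Nn [x [x1 _ Ty]]] := hy (maxn (maxn N1 N2) N3).
  move: Nn; rewrite !geq_max => /andP[/andP[Nn1 Nn2] Nn3].
  exists (h + complK n x); split; last first.
    rewrite op_add -natr1 rmorphD/= scalerDl rmorph1 scale1r opprD addrACA.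
    by rewrite (le_trans (rnormD _ _))// mulrDl mul1r lerD// ltW.
  rewrite (inner_outer n).
  have -> : c * k.+1%:R = (c * k%:R + 1) + 2 `^ p.
    by rewrite -natr1 /c; move: (2 `^ p) k%:R => u v; ring.
  have en1 : eps n * rnorm x <= eps n by rewrite ler_piMr// ltW.
  apply: lerD; last first.
    apply: le_powR => //; rewrite (le_trans (outerD _ _ _))//.
    have := outer_mono h Nn3; have := hN2 n Nn2.
    have := le_trans (outer_le n (complK n x)) (KC_le n x).
    have := outer_le n x; move: (eps n) en1 hN3 => t; lra.
  apply: (@le_trans _ _ ((rnorm h + eps n) `^ p)).
    apply: le_powR => //; rewrite (le_trans (innerD _ _ _))// lerD//.
    by rewrite (le_trans (KC_inner _ _)).
  have := hd (rnorm h + eps n); rewrite addr_ge0 ?rnorm_ge0 ?(ltW (eps_gt0 n))//.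
  rewrite [rnorm h + _ - _]addrAC subrr add0r gtr0_norm// hN1// => /(_ isT isT).
  rewrite ltr_norml => /andP[_]; rewrite ltrBlDl => /ltW/le_trans; apply.
  by rewrite lerD2r.
have T0 := rnorm_ge0 T; have c0 : 0 <= c by rewrite addr_ge0 ?powR_ge0.
have ep0 : 0 < (e / 2) `^ p by rewrite powR_gt0// divr_gt0.
have [k hk] := linear_lt_power p1 (rnorm T `^ p * c / (e / 2) `^ p).
have [h [h1 h2]] := sums k.+1.
have k0 : 0 <= k.+1%:R :> R by rewrite ler0n.
(* Linear growth of [T h] against growth of [h] like the p-th root of [k]: the choice of [k] makes
   them contradictory. *)
have low : k.+1%:R * (e / 2) <= rnorm T * rnorm h.
  apply: le_trans (op_normM T h).
  have := rnormD (k.+1%:R%:C *: y - T h) (T h); rewrite subrK rnormZ rnC//.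
  have h3 : k.+1%:R * (3 * (e / 4)) <= k.+1%:R * rnorm y.
    by rewrite ler_wpM2l// ltW.
  move: h2; rewrite rnorm_distC => h2; move: (k.+1%:R : R) h2 h3 => t; lra.
have e20 : 0 <= e / 2 by rewrite divr_ge0// ltW.
have := le_powR p0 (mulr_ge0 k0 e20) low; rewrite (powRM _ k0 e20).
rewrite (powRM _ (rnorm_ge0 _) (rnorm_ge0 _)).
apply/negP; rewrite -ltNge -ltr_pdivrMr//; apply: le_lt_trans hk.
rewrite [leRHS]mulrAC ler_wpM2r ?invr_ge0 ?(ltW ep0)//.
by rewrite -mulrA ler_wpM2l ?powR_ge0.
Qed.

Definition innerOp n T := op_comp (K n) (op_comp T (K n)).

Definition outerOp n T := op_comp (complK n) (op_comp T (complK n)).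

Let finite_nets_inner n T : finite_nets (innerOp n T).
Proof. exact: finite_nets_compr. Qed.

Let finite_nets_outer n T : finite_nets (T - outerOp n T).
Proof.
have -> : T - outerOp n T =
    (1 *: op_comp (K n) T + op_comp T (K n)) + (-1) *: innerOp n T.
  apply: op_eqP => x; rewrite opBE !opDE !opZE scale1r scaleN1r.
  rewrite /outerOp /innerOp !op_compE !complKE (op_sub T) (op_sub (K n)).
  by rewrite !opprB [T x + _]addrC -addrA subrK addrAC.
apply: finite_netsD; last exact: finite_netsZ.
apply: finite_netsD; last exact: finite_nets_compl.
by apply: finite_netsZ; exact: finite_nets_compr.
Qed.

Lemma innerOp_cvg T (e : R) : finite_nets T -> 0 < e ->
  exists N, forall n, (N <= n)%N -> rnorm (T - innerOp n T) <= e.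
Proof.
(* With [K = K n], [T - K T K = (I - K) T + K T (I - K)], and the factor [K] costs at most 2. *)
move=> nT e0; have e3 : 0 < e / 3 by rewrite divr_gt0.
have [N hN] := complK_left nT e3; have [M hM] := complK_right nT e3.
exists (maxn N M) => n; rewrite geq_max => /andP[/hN h1 /hM h2].
apply: op_norm_le => x x1; rewrite opBE !op_compE.
have -> : T x - K n (T (K n x)) = op_comp (complK n) T x +
    K n (op_comp T (complK n) x).
  by rewrite !op_compE !complKE op_sub (op_sub (K n)) addrA subrK.
rewrite (le_trans (rnormD _ _))//.
have b1 (S : bounded_op X X) : rnorm (S x) <= rnorm S.
  by rewrite (le_trans (op_normM _ _))// ler_piMr ?rnorm_ge0.
have := b1 (op_comp (complK n) T); have := b1 (op_comp T (complK n)).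
have := K_le2 n (op_comp T (complK n) x).
by move: h1 h2 (rnorm (K n _)) => + + t; lra.
Qed.

(** Both terms are split at region [n.+1]. The first lives inside and is controlled by the inner
    part of [x]; the second lives outside and is controlled by the outer part, as [n.+1 <= m]. Each
    part errs by [5 * eps n], and [powR_plane] doubles this. *)
Lemma inner_outer_norm n m S T : (n < m)%N -> rnorm S <= 1 -> rnorm T <= 1 ->
  rnorm (innerOp n S + outerOp m T) <= 1 + 10 * eps n.
Proof.
move=> nm S1 T1; apply: op_norm_le => x x1; rewrite opDE /innerOp /outerOp !op_compE.
set u := K n x; set w := complK m x; set y := _ + _.
have contr (V : bounded_op X X) (z : X) : rnorm V <= 1 -> rnorm (V z) <= rnorm z.
  by move=> V1; rewrite (le_trans (op_normM _ _))// ler_piMl ?rnorm_ge0.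
have emn : eps m <= eps n by exact/eps_mono/ltnW.
have en := eps_gt0 n; have em := eps_gt0 m.
have u2 : rnorm (S u) <= 2.
  rewrite (le_trans (contr S u S1))// (le_trans (K_le2 _ _))//.
  by rewrite ler_piMr.
have w2 : rnorm (T w) <= 2.
  rewrite (le_trans (contr T w T1))// (le_trans (complK_le2 _ _))//.
  by rewrite ler_piMr.
have epsM k (z : X) : rnorm z <= 2 -> eps k * rnorm z <= 2 * eps k.
  by move=> z2; rewrite mulrC ler_wpM2r// ltW.
have epsX k : eps k * rnorm x <= eps k by rewrite ler_piMr// ltW.
have ay : inner n.+1 y <= inner n.+1 x + 5 * eps n.
  rewrite (le_trans (innerD _ _ _))//.
  have h1 := le_trans (inner_le n.+1 (K n (S u))) (K_le n (S u)).
  have h2 := le_trans (inner_mono (complK m (T w)) nm) (KC_inner m (T w)).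
  have h3 := le_trans (inner_le n.+1 (S u)) (contr S u S1).
  have h4 := K_le n x.
  have h5 := epsM n _ u2; have h6 := epsM m _ w2; have h7 := epsX n.
  rewrite -/u in h4; have h34 := le_trans h3 (le_trans h4 (lerD (lexx _) h7)).
  apply: le_trans (lerD (le_trans h1 (lerD h34 h5)) (le_trans h2 h6)) _.
  exact: inner_eps_le.
have oy : outer n.+1 y <= outer n.+1 x + 5 * eps n.
  rewrite (le_trans (outerD _ _ _))//.
  have h1 := K_outer n (S u).
  have h2 := le_trans (outer_le n.+1 (complK m (T w))) (KC_le m (T w)).
  have h3 := le_trans (outer_le m (T w)) (contr T w T1).
  have h4 := KC_le m x; have h8 := outer_mono x nm.
  have h5 := epsM n _ u2; have h6 := epsM m _ w2; have h7 := epsX m.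
  rewrite -complKE -/w in h4; have h34 := le_trans h3 (le_trans h4 (lerD h8 h7)).
  rewrite addrC (le_trans (lerD (le_trans h2 (lerD h34 h6)) (le_trans h1 h5)))//.
  exact: outer_eps_le.
have e5 : 0 <= 5 * eps n by rewrite mulr_ge0// ltW.
apply: (@le_trans _ _ (rnorm x + 2 * (5 * eps n))).
  apply: le_root; first by rewrite addr_ge0 ?rnorm_ge0// mulr_ge0.
  rewrite (inner_outer n.+1 y).
  apply: (@le_trans _ _ ((inner n.+1 x + 5 * eps n) `^ p +
      (outer n.+1 x + 5 * eps n) `^ p)).
    by apply: lerD; apply: le_powR.
  apply: (le_trans (powR_plane p1 _ _ _)) => //.
  by rewrite -inner_outer powRK_root// ?rnorm_ge0.
by rewrite mulrA -natrM lerD2r.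
Qed.

Lemma cutoff_M_ideal : M_ideal (@compact_operators R X).
Proof.
apply: (@M_ideal_compact_operators R X X_complete innerOp outerOp 4).
- move=> n a S T; apply: op_eqP => x.
  by rewrite opDE opZE /innerOp !op_compE opDE opZE op_lin.
- move=> n S; apply: op_norm_le => x x1; rewrite !op_compE.
  have h1 := K_le2 n (S (K n x)); have h2 := op_normM S (K n x).
  have h3 := le_trans (K_le2 n x) (ler_wpM2l (ler0n R 2) x1).
  have h4 := ler_wpM2l (rnorm_ge0 S) h3; rewrite mulr1 in h4.
  rewrite (le_trans h1)// -[4]/((2 * 2)%:R) natrM -mulrA ler_wpM2l//.
  by rewrite (le_trans h2)// [leRHS]mulrC.
- exact: finite_nets_inner.
- exact: innerOp_cvg.
- move=> n a T; apply: op_eqP => x.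
  by rewrite opZE /outerOp !op_compE opZE op_scale.
- exact: finite_nets_outer.
- move=> d d0; have [N hN] := eps_small (divr_gt0 d0 (ltr0n R 10)).
  exists N => n m S T Nn nm S1 T1.
  rewrite (le_trans (inner_outer_norm nm S1 T1))// lerD2l.
  by have := hN n Nn; rewrite ltr_pdivlMr// mulrC => /ltW.
Qed.

End CutoffOperators.

(** * Almost isometric embedding into lp *)

Lemma ns_val_inj (R : realType) (L : lmodType R[i]) (N : normed_submod L) :
  injective (@ns_val R L N).
Proof. exact: val_inj. Qed.

Section AlmostIsometries.
Variables (R : realType) (X Z : normedModType R[i]).

Section Range.
Variables (T : X -> Z) (d : R).
Hypothesis T_linear : linear T.
Hypothesis d01 : 0 < d < 1.
Hypothesis T_lower : forall x, (1 - d) * rnorm x <= rnorm (T x).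
Hypothesis T_upper : forall x, rnorm (T x) <= (1 + d) * rnorm x.

Lemma range_submod : submod_closed (mem (range T)).
Proof.
have T0 : T 0 = 0.
  by have := T_linear (-1) 0 0; rewrite scaler0 addr0 scaleN1r addNr.
split=> [|a u v]; rewrite !inE; first by exists 0.
by move=> [x _ <-] [y _ <-]; exists (a *: x + y) => //; exact: T_linear.
Qed.

Let W := linear_subspace range_submod.

Let in_range x : T x \in mem (range T).
Proof. by rewrite inE; exists x. Qed.

Let N := NormedSubmod range_submod (@sub_normD R Z (range T))
  (@sub_normZ R Z (range T)) (@sub_norm_eq0 R Z (range T)).

Let to_range (x : X) : W := NsElt (N := N) (in_range x).

Let to_range_linear : linear to_range.
Proof. by move=> a x y; apply: ns_val_inj; exact: T_linear. Qed.

Let of_range_ex (w : W) : exists x, T x = ns_val w.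
Proof.
have : ns_val w \in mem (range T) by exact: (ns_valP w).
by rewrite inE => -[x _ Tx]; exists x.
Qed.

Let of_range (w : W) : X := projT1 (cid (of_range_ex w)).

Let of_rangeK w : T (of_range w) = ns_val w.
Proof. by rewrite /of_range; case: cid. Qed.

Let d1 : 0 < 1 - d. Proof. by case/andP: d01 => _; rewrite subr_gt0. Qed.

Let T_inj x y : T x = T y -> x = y.
Proof.
move=> Txy; apply/subr0_eq/rnorm_eq0/le_anti; rewrite rnorm_ge0 andbT.
rewrite -(ler_pM2l d1) mulr0 (le_trans (T_lower _))//.
have -> : T (x - y) = 0 by rewrite addrC -scaleN1r T_linear scaleN1r Txy addNr.
by rewrite rnorm0.
Qed.

Let of_range_linear : linear of_range.
Proof. by move=> a u v; apply: T_inj; rewrite T_linear !of_rangeK. Qed.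

Let of_range_bound w : rnorm (of_range w) <= (1 - d)^-1 * rnorm w.
Proof.
rewrite mulrC ler_pdivlMr// mulrC (le_trans (T_lower _))// of_rangeK.
by rewrite lexx.
Qed.

Lemma banach_mazur_range_le :
  (banach_mazur X (linear_subspace range_submod) <= ((1 + d) / (1 - d))%:E)%E.
Proof.
pose A : bounded_op X W := mk_op to_range_linear T_upper.
pose B : bounded_op W X := mk_op of_range_linear of_range_bound.
have dp : 0 < 1 + d by case/andP: d01 => d0 _; rewrite addr_gt0.
apply: (@le_trans _ _ (rnorm A * rnorm B)%:E).
  apply: ereal_inf_lbound; exists A, B; split=> //.
    by move=> x; apply: T_inj; rewrite of_rangeK.
  by move=> w; apply: ns_val_inj; rewrite /= of_rangeK.
rewrite lee_fin; apply: ler_pM; rewrite ?rnorm_ge0//.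
  apply: op_norm_le => x x1; apply: le_trans (T_upper x) _.
  by rewrite ler_piMr// ltW.
apply: op_norm_le => w w1; apply: le_trans (of_range_bound w) _.
by rewrite ler_piMr// invr_ge0 ltW.
Qed.

End Range.

Lemma almost_isometries_embed :
  (forall d : R, 0 < d < 1 -> exists T : X -> Z,
    [/\ linear T, (forall x, (1 - d) * rnorm x <= rnorm (T x)) &
      forall x, rnorm (T x) <= (1 + d) * rnorm x]) ->
  embeds_almost_isometrically X Z.
Proof.
(* Then [(1 + d) / (1 - d) = 1 + 2 * e / 3]. *)
move=> h e e0; pose d := e / (3 + e).
have e3 : 0 < 3 + e by rewrite addr_gt0.
have d01 : 0 < d < 1 by rewrite divr_gt0//= ltr_pdivrMr// mul1r ltrDr.
have [T [lT lowT upT]] := h d d01.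
exists (range T), (range_submod lT).
apply: le_lt_trans (banach_mazur_range_le lT d01 lowT upT) _.
have d1 : 0 < 1 - d by case/andP: d01 => _; rewrite subr_gt0.
rewrite lte_fin ltr_pdivrMr//.
have : d * (3 + e) = e by rewrite divfK// gt_eqF.
case/andP: d01; nra.
Qed.

End AlmostIsometries.

(** * Sampling Bergman functions on a countable partition *)

Section Discretization.
Variables (R : realType) (p : R).
Hypothesis p1 : 1 <= p.
Local Notation C := R[i].
Local Notation rn z := (rnorm (z : C^o)).
Local Notation mR := (measurableTypeR R).
Local Notation area := (area R).
Local Notation norm f := (bergman_norm p f).
Local Notation pt w := (w.1 +i* w.2).
Implicit Types f : C -> C^o.

Let p0 : 0 < p. Proof. exact: lt_le_trans p1. Qed.

Let box (q : rat * rat * nat) : set (mR * mR) :=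
  ball (ratr q.1.1 : R) (q.2.+1%:R^-1) `*` ball (ratr q.1.2 : R) (q.2.+1%:R^-1).

Let measurable_rat_box q : measurable (box q).
Proof. by apply: measurableX; exact: measurable_ball. Qed.

Let box_small (w : mR * mR) (d : R) : 0 < d -> exists2 q, box q w &
  forall v, box q v -> rn (pt v - pt w) < d.
Proof.
move=> d0; have d4 : 0 < d / 4 by rewrite divr_gt0.
have [n _ /(_ n (leqnn n)) /= hn] := near_infty_natSinv_lt (PosNum d4).
have e0 : 0 < n.+1%:R^-1 :> R by rewrite invr_gt0.
have near_rat (x : R) : exists q : rat, `|ratr q - x| < n.+1%:R^-1.
  have /rat_in_itvoo[q] : x < x + n.+1%:R^-1 by rewrite ltrDl.
  rewrite in_itv/= => /andP[q1 q2]; exists q.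
  by rewrite gtr0_norm ?subr_gt0// ltrBlDl.
have [a ha] := near_rat w.1; have [b hb] := near_rat w.2.
exists (a, b, n); first by split; rewrite /ball/=.
move=> v [/=]; rewrite /ball/= => va vb.
rewrite (le_lt_trans (rn_ptB _ _))//.
have h1 : `|v.1 - w.1| < d / 2.
  rewrite -(subrKA (ratr a)) (le_lt_trans (ler_normD _ _))//.
  by rewrite [`|v.1 - _|]distrC; move: (n.+1%:R^-1) hn ha va => t; lra.
have h2 : `|v.2 - w.2| < d / 2.
  rewrite -(subrKA (ratr b)) (le_lt_trans (ler_normD _ _))//.
  by rewrite [`|v.2 - _|]distrC; move: (n.+1%:R^-1) hn hb vb => t; lra.
lra.
Qed.

(** The uniform Lipschitz bound puts every point of the disk in a rational box on which the unit
    ball oscillates by at most [e]. There are countably many such boxes, and removing from each its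
    predecessors makes them disjoint. *)
Lemma bergman_partition (e : R) : 0 < e ->
  exists (E : nat -> set (mR * mR)) (z : nat -> C),
    [/\ forall k, measurable (E k), trivIset setT E, \bigcup_k E k = disk 1 &
      forall k f w, f \in bergman_function p -> E k w ->
        rn (f (pt w) - f (z k)) <= e * norm f].
Proof.
move=> e0.
pose good (A : set (mR * mR)) := A `<=` disk 1 /\
  forall f v w, f \in bergman_function p -> A v -> A w ->
    rn (f (pt w) - f (pt v)) <= e * norm f.
pose F n : set (mR * mR) :=
  if unpickle n is Some q then (if `[< good (box q) >] then box q else set0)
  else set0.
have mF n : measurable (F n).
  rewrite /F; case: unpickle => [q|]; last exact: measurable0.
  by case: asboolP => _; [exact: measurable_rat_box|exact: measurable0].
have gF n : good (F n).
  rewrite /F; case: unpickle => [q|]; last by split.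
  by case: asboolP => // _; split.
have FD : \bigcup_n F n = disk 1.
  apply/seteqP; split=> [w [n _ /(gF n).1]//|w Dw].
  have wr : rn (pt w) < 1 by [].
  pose r := (1 - rn (pt w)) / 4.
  have r0 : 0 < r by rewrite divr_gt0// subr_gt0.
  have [K K0 hK] := bergman_lipschitz p1 r0.
  pose d := Num.min (r / 2) (e / (2 * K)).
  have d0 : 0 < d.
    rewrite lt_min; apply/andP; split; apply: divr_gt0 => //; exact: mulr_gt0.
  have [q qw hq] := box_small w d0.
  have gq : good (box q).
    split=> [v /hq vw|f u v bf /hq uw /hq vw].
      have dr : d <= r / 2 by rewrite ge_min lexx.
      have := rnD (pt v - pt w) (pt w); rewrite subrK /disk/=.
      move: dr vw wr; rewrite /r; lra.
    have zr : rn (pt w) + 2 * r < 1 by rewrite /r; lra.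
    have near y : rn (pt y - pt w) < d ->
        rn (f (pt y) - f (pt w)) <= e / 2 * norm f.
      move=> yw; have yr : rn (pt y - pt w) <= r / 2.
        by rewrite ltW// (lt_le_trans yw)// ge_min lexx.
      rewrite (le_trans (hK f _ _ bf zr yr))// ler_wpM2r ?bergman_norm_ge0//.
      have : rn (pt y - pt w) <= e / (2 * K).
        by rewrite ltW// (lt_le_trans yw)// ge_min lexx orbT.
      by rewrite ler_pdivlMr ?mulr_gt0// ler_pdivlMr// mulrA mulrC -mulrA mulrC.
    rewrite -(subrKA (f (pt w))) (le_trans (rnD _ _))//.
    rewrite [rn (f (pt w) - _)]rn_distC (le_trans (lerD (near v vw) (near u uw)))//.
    by rewrite -mulrDl -splitr.
  have [k hk] : exists k, unpickle k = Some q by eexists; exact: pickleK.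
  by exists k => //; rewrite /F hk; case: asboolP.
(* Some cells may have become empty; they get the sample point 0, about which nothing is claimed. *)
have /choice[z hz] : forall k, exists y, forall w, seqDU F k w ->
    exists2 v, F k v & y = pt v.
  move=> k; have [[v vk]|ne] := pselect (exists v, seqDU F k v).
    by exists (pt v) => w _; exists v => //; exact: (subset_seqDU vk).
  by exists 0 => w wk; exfalso; apply: ne; exists w.
exists (seqDU F), z; split.
- by move=> k; apply: measurableD => //; exact: bigsetU_measurable.
- exact: trivIset_seqDU.
- by rewrite -FD -seqDU_bigcup_eq.
- move=> k f w bf wk; have [v vk ->] := hz k w wk.
  by apply: (gF k).2 => //; exact: (subset_seqDU wk).
Qed.

Section StepFunctions.
Variables (E : nat -> set (mR * mR)) (z : nat -> C).
Hypothesis mE : forall k, measurable (E k).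
Hypothesis tE : trivIset setT E.
Hypothesis ED : \bigcup_k E k = disk 1.

Let E_disk k : E k `<=` disk 1.
Proof. by rewrite -ED; exact: bigcup_sup. Qed.

Let area_fin k : area (E k) \is a fin_num.
Proof.
rewrite ge0_fin_numE// (@le_lt_trans _ _ (area (disk 1)))//.
  by apply: le_measure; rewrite ?inE; [exact: mE|exact: measurable_disk|exact: E_disk].
by rewrite (le_lt_trans (area_disk_le ler01))// ltry.
Qed.

(** The default 1 lies outside the open disk, so [f (cell w) = 0] off the disk for every Bergman
    function. *)
Let cell (w : mR * mR) : C :=
  if pselect (exists k, E k w) is left h then z (projT1 (cid h)) else 1.

Let cellE k w : E k w -> cell w = z k.
Proof.
move=> Ek; rewrite /cell; case: pselect => [h|]; last by case; exists k.
case: cid => j /= Ej; congr z.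
by apply: contrapT => /eqP jk; have /trivIsetP/(_ j k I I jk) := tE;
  move=> /seteqP[/(_ w (conj Ej Ek))].
Qed.

Let cellF w : ~ disk 1 w -> cell w = 1.
Proof.
move=> nD; rewrite /cell; case: pselect => // -[k Ek].
by exfalso; apply: nD; exact: E_disk Ek.
Qed.

Definition sample f (k : nat) : C^o := (fine (area (E k)) `^ p^-1)%:C * f (z k).

Lemma sample_linear : linear sample.
Proof.
move=> a f g; apply/funext => k.
change ((fine (area (E k)) `^ p^-1)%:C * (a * f (z k) + g (z k)) =
  a * ((fine (area (E k)) `^ p^-1)%:C * f (z k)) +
  (fine (area (E k)) `^ p^-1)%:C * g (z k)).
by ring.
Qed.

Let step f w : R := rn (f (cell w)).

Let not_unit_disk1 : ~ unit_disk (1 : C).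
Proof. by move/unit_diskE; rewrite rn1 ltxx. Qed.

Let stepF f w : f \in bergman_function p -> ~ disk 1 w -> step f w = 0.
Proof.
by move=> /bergmanP[_ f0 _] nD; rewrite /step cellF// f0// rn0.
Qed.

Let measurable_step f : f \in bergman_function p -> measurable_fun setT (step f).
Proof.
move=> bf; have <- : \bigcup_k E k `|` ~` disk 1 = setT by rewrite ED setUv.
have mD := @measurable_disk R 1.
apply/measurable_funU; [exact: bigcupT_measurable|exact: measurableC|].
split.
  apply/measurable_fun_bigcup => // k.
  apply: (@eq_measurable_fun _ _ _ _ _ (cst (rn (f (z k))))) => //.
  by move=> w /set_mem Ek; rewrite /step (cellE Ek).
apply: (@eq_measurable_fun _ _ _ _ _ (cst (0 : R))) => //.
by move=> w /set_mem nD; rewrite stepF.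
Qed.

Lemma lp_series_sample f : f \in bergman_function p ->
  lp_series p (sample f) = pint area p (step f).
Proof.
move=> bf; rewrite pint.unlock.
have -> : (\int[area]_w (step f w `^ p)%:E =
    \int[area]_(w in \bigcup_k E k) (step f w `^ p)%:E)%E.
  rewrite ED [RHS]integral_mkcond; apply: eq_integral => w _; rewrite patchE.
  case: ifPn => // /negP; rewrite inE => nD.
  by rewrite stepF// powR0// gt_eqF.
rewrite ge0_integral_bigcup//; last 2 first.
- apply/measurable_EFinP/measurable_funTS/measurable_powRp.
  exact: measurable_step.
- by move=> w _; rewrite lee_fin powR_ge0.
apply: eq_eseriesr => k _.
rewrite (eq_integral (cst (rn (f (z k)) `^ p)%:E)); last first.
  by move=> w /set_mem Ek; rewrite /step (cellE Ek).
rewrite integral_cst// -(fineK (area_fin k)) -EFinM; congr EFin.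
rewrite /sample rnM rnC ?powR_ge0// powRM ?powR_ge0 ?rn_ge0//.
by rewrite powR_rootK ?fine_ge0// mulrC.
Qed.

Variable e : R.
Hypothesis e0 : 0 < e.
Hypothesis osc : forall k f w, f \in bergman_function p -> E k w ->
  rn (f (pt w) - f (z k)) <= e * norm f.

(** The sample has the norm of the step function, which differs from the modulus of [f] by at most
    [e * norm f] on a set of area at most 4; the factor is [4 ^ (1 / p) <= 4]. *)
Lemma sample_almost_isometric f : f \in bergman_function p ->
  sample f \in p_summable p /\ `|lp_norm p (sample f) - norm f| <= 4 * e * norm f.
Proof.
move=> bf; have [lf nf] := bergman_lpfun p1 bf.
have en0 : 0 <= e * norm f by rewrite mulr_ge0 ?bergman_norm_ge0// ltW.
have mD := @measurable_disk R 1.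
pose err (w : mR * mR) : R := e * norm f * \1_(disk 1) w.
have pe : (pint area p err <= ((e * norm f) `^ p * 4)%:E)%E.
  rewrite pint_indic// EFinM lee_wpmul2l ?lee_fin ?powR_ge0//.
  by have := area_disk_le (@ler01 R); rewrite expr1n mulr1.
have lerr : lpfun area p err.
  split.
  - by apply: measurable_funM => //; exact: measurable_indic.
  - by move=> w; rewrite mulr_ge0.
  - by rewrite (le_lt_trans pe)// ltry.
have nerr : pnorm area p err <= 4 * e * norm f.
  rewrite (le_trans (pnorm_le_root p1 _ pe)) ?mulr_ge0 ?powR_ge0//.
  rewrite powRM ?powR_ge0// powRK_root// mulrC -mulrA ler_wpM2r//.
  by apply: ler1_powR; rewrite ?ler1n// invf_le1.
have diff w : `|step f w - modulus f w| <= err w.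
  have [Dw|nD] := pselect (disk 1 w); last first.
    have [_ f0 _] := bergmanP bf.
    rewrite stepF// /modulus f0; last by move/unit_diskE.
    by rewrite rn0 subrr normr0 mulr_ge0.
  have [k _ Ek] : (\bigcup_k E k) w by rewrite ED.
  rewrite /err indicE mem_set// mulr1 /step (cellE Ek) /modulus.
  have := osc bf Ek.
  have := rnD (f (pt w) - f (z k)) (f (z k)).
  have := rnD (f (z k) - f (pt w)) (f (pt w)).
  rewrite !subrK rn_distC ler_norml; move: (e * norm f) => q; lra.
have ms := measurable_step bf; have mf : measurable_fun setT (modulus f) by case: lf.
have [ls n1] : lpfun area p (step f) /\
    pnorm area p (step f) <= pnorm area p (modulus f) + pnorm area p err.
  apply: (lpfun_triangle p1 lf lerr ms) => w; rewrite rn_ge0/=.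
  by have := diff w; rewrite ler_norml => /andP[_]; rewrite lerBlDl.
have [_ n2] : lpfun area p (modulus f) /\
    pnorm area p (modulus f) <= pnorm area p (step f) + pnorm area p err.
  apply: (lpfun_triangle p1 ls lerr mf) => w; rewrite rn_ge0/=.
  by have := diff w; rewrite ler_norml => /andP[+ _]; rewrite lerBrDl lerBlDr.
have [_ _ soo] := ls.
split; first by apply/asboolP; rewrite lp_series_sample.
have -> : lp_norm p (sample f) = pnorm area p (step f).
  by rewrite /lp_norm lp_series_sample.
rewrite nf in nerr *; rewrite ler_norml; apply/andP; split.
  by rewrite lerBrDl lerBlDr (le_trans n2)// lerD2l.
by rewrite lerBlDl (le_trans n1)// lerD2l.
Qed.

End StepFunctions.

Theorem bergman_embeds_lp :
  embeds_almost_isometrically (bergman_space p1) (lp_space p1).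
Proof.
apply: almost_isometries_embed => d /andP[d0 _].
have d4 : 0 < d / 4 by rewrite divr_gt0.
have [E [z [mE tE ED osc]]] := bergman_partition d4.
have key (f : bergman_space p1) := sample_almost_isometric mE tE ED d4 osc (ns_valP f).
pose T (f : bergman_space p1) : lp_space p1 := NsElt (N := lp p1) (key f).1.
have nT (f : bergman_space p1) : rnorm (T f) = lp_norm p (sample E z (ns_val f)) by [].
have nX (f : bergman_space p1) : rnorm f = norm (ns_val f) by [].
have dE : 4 * (d / 4) = d by rewrite mulrCA mulfV ?mulr1.
exists T; split.
- move=> a f g; apply: ns_val_inj.
  exact: (sample_linear E z a (ns_val f) (ns_val g)).
- move=> f; rewrite nT nX; have := (key f).2; rewrite dE ler_norml => /andP[+ _].
  by rewrite mulrBl mul1r lerBrDl.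
- move=> f; rewrite nT nX; have := (key f).2; rewrite dE ler_norml => /andP[_].
  by rewrite mulrDl mul1r lerBlDl.
Qed.

End Discretization.

(** * Dilations and cutoff operators on the Bergman space *)

Section FiniteNets.
Variable R : realType.
Local Notation C := R[i].
Local Notation rn z := (rnorm (z : C^o)).

Lemma real_net (b e : R) : 0 < e ->
  exists s : seq R, forall x, `|x| <= b -> exists2 y, y \in s & `|x - y| < e.
Proof.
move=> e0; pose N := (Num.bound (2 * `|b| / e)).+1.
exists [seq i%:R * e - b | i <- iota 0 N] => x xb.
have b0 : 0 <= b := le_trans (normr_ge0 x) xb.
have xb0 : 0 <= (x + b) / e.
  by rewrite divr_ge0 ?(ltW e0)//; move: xb; rewrite ler_norml; lra.
have /andP[h1 h2] := truncn_itv xb0; set i := Num.truncn _ in h1 h2.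
exists (i%:R * e - b).
  apply/mapP; exists i => //; rewrite mem_iota add0n leq0n /= ltnS -(ler_nat R).
  apply: (le_trans h1); apply: (@le_trans _ _ (2 * `|b| / e)).
    rewrite ler_wpM2r ?invr_ge0 ?(ltW e0)// ger0_norm//.
    by move: xb; rewrite ler_norml; lra.
  by rewrite ltW// archi_boundP// divr_ge0 ?mulr_ge0 ?(ltW e0).
rewrite ler_pdivlMr// in h1; rewrite ltr_pdivrMr// -natr1 mulrDl mul1r in h2.
by rewrite ltr_norml; lra.
Qed.

Lemma complex_net (b e : R) : 0 < e ->
  exists s : seq C, forall z, rn z <= b -> exists2 y, y \in s & rn (z - y) < e.
Proof.
move=> e0; have e2 : 0 < e / 2 by rewrite divr_gt0.
have [s hs] := real_net b e2.
exists [seq x +i* y | x <- s, y <- s] => z zb.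
have b0 : 0 <= b := le_trans (rn_ge0 z) zb.
have zE := rn_sqE z.
have [|x xs hx] := hs (complex.Re z).
  rewrite (le_trans _ zb)// -(@ler_pXn2r _ 2)// ?nnegrE ?rn_ge0//.
  by rewrite zE real_normK ?num_real// lerDl sqr_ge0.
have [|y ys hy] := hs (complex.Im z).
  rewrite (le_trans _ zb)// -(@ler_pXn2r _ 2)// ?nnegrE ?rn_ge0//.
  by rewrite zE real_normK ?num_real// lerDr sqr_ge0.
exists (x +i* y); first exact: allpairs_f.
case: z hx hy {zb zE} => u v /= hx hy.
by rewrite (le_lt_trans (rn_pair _ _))//; lra.
Qed.

(** Induction on [P], splitting [A] according to the value at one index; [A] varies so that the
    representatives [u] stay in the original set. *)
Lemma finite_values (T I : eqType) (F : I -> T -> C) (P : seq I) (b e : R) :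
  0 < e -> forall A : set T, (forall i t, i \in P -> A t -> rn (F i t) <= b) ->
  exists s : seq T, forall t, A t -> exists2 u, u \in s & A u /\
    forall i, i \in P -> rn (F i t - F i u) < e.
Proof.
move=> e0; elim: P => [|i P ih] A bA.
  have [[u Au]|nA] := pselect (exists u, A u).
    by exists [:: u] => t At; exists u; rewrite ?inE.
  by exists [::] => t At; exfalso; apply: nA; exists t.
have e2 : 0 < e / 2 by rewrite divr_gt0.
have [cs hcs] := complex_net b e2.
have [s hs] : exists s : seq T, forall c t, c \in cs -> A t -> rn (F i t - c) < e / 2 ->
    exists2 u, u \in s & A u /\ forall j, j \in i :: P -> rn (F j t - F j u) < e.
  elim: cs {hcs} => [|c cs [s hs]]; first by exists [::].
  have [|s' hs'] := ih (A `&` [set t | rn (F i t - c) < e / 2]).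
    by move=> j t jP [At _]; apply: bA; rewrite // inE jP orbT.
  exists (s' ++ s) => d t; rewrite inE => /orP[/eqP->|dc] At td.
    have [u us' [[Au /= uc] hu]] := hs' t (conj At td).
    exists u; first by rewrite mem_cat us'.
    split=> // j; rewrite inE => /orP[/eqP->|/hu//].
    rewrite -(subrKA c) (le_lt_trans (rnD _ _))// [e]splitr ltrD//.
    by rewrite rn_distC.
  have [u us hu] := hs d t dc At td.
  by exists u; rewrite // mem_cat us orbT.
exists s => t At; have [c cc tc] := hcs (F i t) (bA i t (mem_head _ _) At).
exact: hs cc At tc.
Qed.

End FiniteNets.

(** * Dilations of a single function *)

Section Dilations.
Variables (R : realType) (p : R).
Hypothesis p1 : 1 <= p.
Local Notation C := R[i].
Local Notation rn z := (rnorm (z : C^o)).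
Local Notation mR := (measurableTypeR R).
Local Notation area := (area R).
Local Notation norm f := (bergman_norm p f).
Local Notation pt w := (w.1 +i* w.2).
Implicit Types f : C -> C^o.

Let p0 : 0 < p. Proof. exact: lt_le_trans p1. Qed.

(** Comparison with squares says nothing about thin annuli; this exact ratio makes their area
    small. *)
Lemma area_disk_scale (s : R) : 0 < s ->
  area (disk s) = ((s ^+ 2)%:E * area (disk 1))%E.
Proof.
move=> s0; have ms := @measurable_disk R s; have m1 := @measurable_disk R 1.
have I1 : (\int[area]_w (\1_(disk s) w)%:E = area (disk s))%E.
  by rewrite integral_indic// setIT.
have h : (\int[area]_w (\1_(disk s) (s * w.1, s * w.2))%:E =
    (s ^- 2)%:E * area (disk s))%E.
  rewrite -I1; apply: (@area_dilation R s (fun w => (\1_(disk s) w)%:E) s0).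
    by apply/measurable_EFinP; exact: measurable_indic.
  by move=> w; rewrite lee_fin.
have E : (\int[area]_w (\1_(disk s) (s * w.1, s * w.2))%:E = area (disk 1))%E.
  rewrite -[disk 1 in RHS]setIT -(integral_indic area measurableT)//.
  apply: eq_integral => w _; congr EFin; rewrite !indicE; congr (nat_of_bool _)%:R.
  have ptE : (s * w.1) +i* (s * w.2) = s%:C * pt w.
    by apply/eqP; rewrite eq_complex/= !mul0r subr0 addr0 !eqxx.
  apply/idP/idP; rewrite !inE /disk/= ptE;
  by rewrite rnM rnC ?(ltW s0)// gtr_pMr.
by rewrite -E h muleA -EFinM mulfV ?mul1e// expf_neq0// gt_eqF.
Qed.

Lemma area_annulus_le (s : R) : 0 < s < 1 ->
  (area (disk 1 `\` disk s) <= (4 * (1 - s ^+ 2))%:E)%E.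
Proof.
move=> /andP[s0 s1]; have ms := @measurable_disk R s.
have m1 := @measurable_disk R 1.
have a1 : (area (disk 1) <= 4%:E)%E.
  by have := area_disk_le (@ler01 R); rewrite expr1n mulr1.
have f1 : area (disk 1) \is a fin_num.
  by rewrite ge0_fin_numE// (le_lt_trans a1)// ltry.
rewrite measureD//; last by rewrite -ge0_fin_numE.
have -> : disk 1 `&` disk s = disk s.
  by apply: setIidr => w; rewrite /disk/= => h; exact: lt_trans s1.
change ((area (disk 1) - area (disk s) <= (4 * (1 - s ^+ 2))%:E)%E).
rewrite (area_disk_scale s0); move: a1; rewrite -(fineK f1); move: (fine _) => b.
rewrite lee_fin -EFinM => b4; change ((b - s ^+ 2 * b)%:E <= (4 * (1 - s ^+ 2))%:E)%E.
rewrite lee_fin -{1}[b]mul1r -mulrBl mulrC ler_wpM2r//.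
by rewrite subr_ge0 expr_le1// ltW.
Qed.

Lemma pnorm_indic_le (A : set (mR * mR)) (c a : R) : measurable A -> 0 <= c ->
  0 <= a -> (area A <= a%:E)%E ->
  lpfun area p (fun w => c * \1_A w) /\
  pnorm area p (fun w => c * \1_A w) <= c * a `^ p^-1.
Proof.
move=> mA c0 a0 Aa.
have pe : (pint area p (fun w => c * \1_A w)%R <= (c `^ p * a)%:E)%E.
  by rewrite pint_indic// EFinM lee_wpmul2l ?lee_fin ?powR_ge0.
split.
  split; last by rewrite (le_lt_trans pe)// ltry.
  - by apply: measurable_funM => //; exact: measurable_indic.
  - by move=> w; rewrite mulr_ge0.
rewrite (le_trans (pnorm_le_root p1 _ pe)) ?mulr_ge0 ?powR_ge0//.
by rewrite powRM ?powR_ge0// powRK_root.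
Qed.

Let root4 : (4 : R) `^ p^-1 <= 4.
Proof. by apply: ler1_powR; rewrite ?ler1n// invf_le1. Qed.

Lemma pnorm_disk_le (r c : R) : r <= 1 -> 0 <= c ->
  lpfun area p (fun w => c * \1_(disk r) w) /\
  pnorm area p (fun w => c * \1_(disk r) w) <= 4 * c.
Proof.
move=> r1 c0; have mr := @measurable_disk R r; have m1 := @measurable_disk R 1.
have a1 : (area (disk r) <= 4%:E)%E.
  apply: (@le_trans _ _ (area (disk 1))).
    by apply: le_measure; rewrite ?inE// => w; rewrite /disk/= => h; exact: lt_le_trans r1.
  by have := area_disk_le (@ler01 R); rewrite expr1n mulr1.
have [l n] := pnorm_indic_le mr c0 (ler0n R 4) a1; split=> //.
by rewrite (le_trans n)// mulrC ler_wpM2r.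
Qed.

Lemma bergman_norm_sup f (c : R) : f \in bergman_function p -> 0 <= c ->
  (forall z, unit_disk z -> rn (f z) <= c) -> norm f <= 4 * c.
Proof.
move=> bf c0 fc; have [lf ->] := bergman_lpfun p1 bf.
have [l n] := pnorm_disk_le (lexx 1) c0; apply: le_trans n.
have mf : measurable_fun setT (modulus f) by case: lf.
apply: (lpfun_le p1 mf l _).2 => w; rewrite rn_ge0/=.
have [Dw|nD] := pselect (disk 1 w).
  by rewrite indicE mem_set// mulr1; apply: fc; exact/unit_diskE.
have [_ f0 _] := bergmanP bf.
rewrite indicE memNset// mulr0 /modulus f0 ?rn0//.
by move/unit_diskE.
Qed.

(** The extension by 0 has to be imposed again, because [s z] can lie in the disk when [z] does
    not. *)
Definition dilate (s : R) f (z : C) : C^o :=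
  if rn z < 1 then f (s%:C * z) else 0.

Lemma dilateT s f z : unit_disk z -> dilate s f z = f (s%:C * z).
Proof. by move=> /unit_diskE zr; rewrite /dilate zr. Qed.

Lemma dilateF s f z : ~ unit_disk z -> dilate s f z = 0.
Proof. by move=> nD; rewrite /dilate; case: ifPn => // /unit_diskE. Qed.

Lemma dilate_disk (s : R) (z : C) : 0 < s <= 1 -> rn z < 1 -> rn (s%:C * z) < 1.
Proof.
move=> /andP[s0 s1] zr; rewrite rnM rnC ?(ltW s0)//.
by rewrite (le_lt_trans _ zr)// ler_piMl ?rn_ge0.
Qed.

Lemma dilate_analytic s f : 0 < s <= 1 -> analytic_on (@unit_disk R) f ->
  analytic_on (@unit_disk R) (dilate s f).
Proof.
move=> /andP[s0 s1] /analytic_onP Af; apply/analytic_onP => w /unit_diskE wr.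
have [|t [M [b [t0 fb]]]] := Af (s%:C * w).
  by apply/unit_diskE/dilate_disk => //; rewrite s0.
pose t' := Num.min t ((1 - rn w) / 2).
have t'0 : 0 < t' by rewrite lt_min t0 divr_gt0// subr_gt0.
have t't : t' <= t by rewrite ge_min lexx.
have fb' := has_ps_le t'0 t't fb.
exists t', M, (fun k => b k * s%:C ^+ k); split=> // n h ht.
have whr : rn (w + h) < 1.
  have := rnD w h; have : t' <= (1 - rn w) / 2 by rewrite ge_min lexx orbT.
  move: ht wr; lra.
rewrite /dilate whr mulrDr.
under eq_bigr do rewrite -mulrA -exprMn.
have sh : rn (s%:C * h) <= rn h.
  by rewrite rnM rnC ?(ltW s0)// ler_piMl ?rn_ge0.
apply: (le_trans (fb' n (s%:C * h) (le_trans sh ht))).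
rewrite ler_wpM2l ?(has_ps_ge0 t'0 fb')//.
apply: lerXn2r; rewrite ?nnegrE ?divr_ge0 ?rn_ge0 ?(ltW t'0)//.
by rewrite ler_wpM2r// invr_ge0 ltW.
Qed.

(** The change of variables costs [s ^- 2], at most 4 as soon as [s >= 1/2]. *)
Lemma dilate_pint s f : 2^-1 <= s <= 1 -> f \in bergman_function p ->
  (pint area p (modulus (dilate s f)) <= 4%:E * pint area p (modulus f))%E.
Proof.
move=> /andP[s2 s1] bf; have [Af f0 _] := bergmanP bf.
have s0 : 0 < s by apply: lt_le_trans s2; rewrite invr_gt0.
have s01 : 0 < s <= 1 by rewrite s0.
have mf : measurable_fun setT (modulus f) by exact: measurable_modulus.
have md : measurable_fun setT (modulus (dilate s f)).
  by apply: measurable_modulus; [exact: dilate_analytic|exact: dilateF].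
have msc : measurable_fun setT (fun w : mR * mR => (s * w.1, s * w.2) : mR * mR).
  by apply/measurable_fun_pairP; split => /=; exact: measurable_funM.
have mfs : measurable_fun setT (fun w : mR * mR => modulus f (s * w.1, s * w.2)).
  exact: (measurableT_comp mf msc).
apply: (@le_trans _ _ (pint area p (fun w : mR * mR => modulus f (s * w.1, s * w.2)%R))%E).
  apply: pint_le => // w; rewrite rn_ge0 /modulus /=.
  have -> : (s * w.1) +i* (s * w.2) = s%:C * pt w.
    by apply/eqP; rewrite eq_complex/= !mul0r subr0 addr0 !eqxx.
  by rewrite /dilate; case: ifPn => _; rewrite ?rn0 ?rn_ge0.
rewrite pint.unlock.
rewrite (@area_dilation R s (fun w => (modulus f w `^ p)%:E) s0); last 2 first.
- exact/measurable_EFinP/measurable_powRp.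
- by move=> w; rewrite lee_fin powR_ge0.
rewrite lee_wpmul2r//.
  by apply: integral_ge0 => w _; rewrite lee_fin powR_ge0.
rewrite lee_fin -[leRHS]invrK lef_pV2 ?posrE ?exprn_gt0 ?invr_gt0//.
have -> : (4 : R)^-1 = 2^-1 ^+ 2 by rewrite exprVn -natrX.
by apply: lerXn2r; rewrite // nnegrE ?invr_ge0// ltW.
Qed.

Lemma dilate_bergman s f : 2^-1 <= s <= 1 -> f \in bergman_function p ->
  dilate s f \in bergman_function p /\ norm (dilate s f) <= 4 * norm f.
Proof.
move=> sb bf; have [Af f0 _] := bergmanP bf.
have [[_ _ foo] nf] := bergman_lpfun p1 bf.
have /andP[s2 s1] := sb.
have s01 : 0 < s <= 1 by rewrite s1 andbT (lt_le_trans _ s2)// invr_gt0.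
have ffin : pint area p (modulus f) \is a fin_num.
  by rewrite ge0_fin_numE// pint_ge0.
have h := dilate_pint sb bf; rewrite -(fineK ffin) -EFinM in h.
have bd : dilate s f \in bergman_function p.
  have doo := le_lt_trans h (ltry _).
  exact: (bergman_lpfunW p1 (dilate_analytic s01 Af) (@dilateF s f) doo).
split=> //; have [_ ->] := bergman_lpfun p1 bd.
rewrite (le_trans (pnorm_le_root p1 _ h))//.
  by rewrite mulr_ge0// fine_ge0// pint_ge0.
rewrite powRM ?fine_ge0 ?pint_ge0// nf /pnorm.
by rewrite ler_wpM2r ?powR_ge0.
Qed.

End Dilations.

(** * Dilations as compact operators and their accumulated errors *)

Section DilationOperators.
Variables (R : realType) (p : R).
Hypothesis p1 : 1 <= p.
Local Notation C := R[i].
Local Notation rn z := (rnorm (z : C^o)).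
Local Notation mR := (measurableTypeR R).
Local Notation area := (area R).
Local Notation norm f := (bergman_norm p f).
Local Notation pt w := (w.1 +i* w.2).
Local Notation X := (bergman_space p1).
Implicit Types f : C -> C^o.

Let p0 : 0 < p. Proof. exact: lt_le_trans p1. Qed.

Lemma bergman_space_complete : complete_norm X.
Proof.
move=> u cu; have [g bg hg] := bergman_complete p1 (fun n => ns_valP (u n)) cu.
by exists (NsElt (N := bergman p1) bg).
Qed.

Definition dilation_fun (s : R) (sb : 2^-1 <= s <= 1) (f : X) : X :=
  NsElt (N := bergman p1) (dilate_bergman p1 sb (ns_valP f)).1.

Lemma dilation_linear s (sb : 2^-1 <= s <= 1) : linear (dilation_fun sb).
Proof.
move=> a f g; apply: ns_val_inj; apply/funext => z.
change (dilate s (fun z => a * ns_val f z + ns_val g z) z =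
  a * dilate s (ns_val f) z + dilate s (ns_val g) z).
by rewrite /dilate; case: ifP => // _; rewrite mulr0 addr0.
Qed.

Lemma dilation_bound s (sb : 2^-1 <= s <= 1) (f : X) :
  rnorm (dilation_fun sb f) <= 4 * rnorm f.
Proof. exact: (dilate_bergman p1 sb (ns_valP f)).2. Qed.

Definition dilation s (sb : 2^-1 <= s <= 1) : bounded_op X X :=
  mk_op (dilation_linear sb) (dilation_bound sb).

Lemma bergman_functionB f g : f \in bergman_function p ->
  g \in bergman_function p -> f - g \in bergman_function p.
Proof.
move=> bf bg; have [_ h] := bergman_closed p1.
by have := h (-1) g f bg bf; rewrite scaleN1r addrC.
Qed.

Lemma dilate_close (r e : R) : r < 1 -> 0 < e -> exists s,
  [/\ 2^-1 <= s, s < 1 & forall f z, f \in bergman_function p -> rn z < r ->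
    rn (f (s%:C * z) - f z) <= e * norm f].
Proof.
move=> r1 e0; pose t := (1 - r) / 2; have t0 : 0 < t by rewrite divr_gt0// subr_gt0.
have [K K0 hK] := bergman_lipschitz p1 t0.
pose d := Num.min 2^-1 (Num.min (t / 2) (e / K)).
have d0 : 0 < d.
  by rewrite !lt_min; apply/and3P; split; rewrite ?invr_gt0//; exact: divr_gt0.
have d2 : d <= 2^-1 by rewrite ge_min lexx.
exists (1 - d); split; [by move: d2; lra|by rewrite gtrBl|].
move=> f z bf zr; have zz : (1 - d)%:C * z - z = - (d%:C * z).
  by rewrite rmorphB/= rmorph1 mulrBl mul1r addrAC subrr add0r.
have dz : rn ((1 - d)%:C * z - z) <= d.
  rewrite zz rnN rnM rnC ?(ltW d0)// ler_piMr ?(ltW d0)//.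
  by rewrite ltW// (lt_trans zr).
rewrite (le_trans (hK f z _ bf _ _))//.
- by rewrite /t mulrC divfK//; lra.
- by rewrite (le_trans dz)// !ge_min lexx orbT.
rewrite ler_wpM2r ?bergman_norm_ge0// mulrC -ler_pdivlMr// (le_trans dz)//.
by rewrite !ge_min lexx !orbT.
Qed.

Lemma dilate_bounded (s : R) : 2^-1 <= s < 1 -> exists2 c : R, 0 < c &
  forall f z, f \in bergman_function p -> rn z < 1 -> rn (f (s%:C * z)) <= c * norm f.
Proof.
move=> /andP[s2 s1]; have t0 : 0 < (1 - s) / 2 by rewrite divr_gt0// subr_gt0.
have [K K0 hK] := bergman_eval p1 t0; exists K => // f z bf zr.
apply: hK => //; have s0 : 0 <= s by apply: le_trans s2; rewrite invr_ge0.
have : rn (s%:C * z) <= s by rewrite rnM rnC// ler_piMr// ltW.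
by move: s1; lra.
Qed.

(** An Arzelà-Ascoli argument: [f (s z)] only sees the disk of radius [s], where the unit ball is
    uniformly Lipschitz, so values at finitely many points determine it up to [3 * e1] in the
    supremum norm, hence up to [12 * e1 < e] in norm. *)
Lemma dilation_finite_nets s (sb : 2^-1 <= s <= 1) : s < 1 ->
  finite_nets (dilation sb).
Proof.
move=> s1 e e0; have e16 : 4 * (3 * (e / 16)) < e by move: e0; lra.
have /andP[s2 _] := sb.
have s0 : 0 <= s by apply: le_trans s2; rewrite invr_ge0.
pose t := (1 - s) / 8; have t0 : 0 < t by rewrite divr_gt0// subr_gt0.
have st : s + t / 2 + 2 * t < 1 by rewrite /t; move: s1; lra.
have [K K0 hK] := bergman_lipschitz p1 t0; have [B B0 hB] := bergman_eval p1 t0.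
pose e1 := e / 16; have e10 : 0 < e1 by rewrite divr_gt0.
pose d := Num.min (t / 2) (e1 / K).
have d0 : 0 < d by rewrite lt_min; apply/andP; split; exact: divr_gt0.
have dt : d <= t / 2 by rewrite ge_min lexx.
have dK : K * d <= e1 by rewrite mulrC -ler_pdivlMr// ge_min lexx orbT.
have [cs hcs] := complex_net s d0.
(* Net points far from the disk of radius [s] are dropped: the uniform evaluation bound would not
   apply to them. *)
pose P := [seq c <- cs | rn c <= s + d].
have [|u hu] := @finite_values R X C (fun c (k : X) => ns_val k c) P B e1 e10
    [set k : X | rnorm k <= 1].
  move=> c f; rewrite mem_filter => /andP[cr _] f1.
  rewrite (le_trans (hB _ c (ns_valP f) _))//.
    move: cr dt; rewrite /t; move: s1; lra.
  by rewrite ler_piMr// ltW.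
exists [seq dilation sb k | k <- u] => f f1.
have [g gu [g1 fg]] := hu f f1.
exists (dilation sb g); first exact: map_f.
have bfg : dilate s (ns_val f) - dilate s (ns_val g) \in bergman_function p.
  exact: (bergman_functionB (dilate_bergman p1 sb (ns_valP f)).1
    (dilate_bergman p1 sb (ns_valP g)).1).
have e30 : 0 <= 3 * e1 by rewrite mulr_ge0// ltW.
have h : norm (dilate s (ns_val f) - dilate s (ns_val g)) <= 4 * (3 * e1).
  apply: (bergman_norm_sup p1 bfg e30) => z /[dup] Dz /unit_diskE zr.
  change (rn (dilate s (ns_val f) z - dilate s (ns_val g) z) <= 3 * e1).
  rewrite !dilateT//; set y := s%:C * z.
  have ys : rn y <= s by rewrite rnM rnC// ler_piMr// ltW.
  have [c cc yc] := hcs y ys.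
  have cP : c \in P.
    rewrite mem_filter cc andbT; have := rnD (c - y) y; rewrite subrK rn_distC.
    by move=> /le_trans; apply; rewrite addrC lerD// ltW.
  have cr : rn c + 2 * t < 1.
    move: cP; rewrite mem_filter => /andP[cP _]; apply: le_lt_trans st.
    by rewrite lerD2r (le_trans cP)// lerD2l.
  have yct : rn (y - c) <= t / 2 by rewrite (le_trans (ltW yc)).
  have osc (k : X) : rnorm k <= 1 -> rn (ns_val k y - ns_val k c) <= e1.
    move=> k1; apply: le_trans (hK _ _ _ (ns_valP k) cr yct) _.
    rewrite (le_trans _ dK)//.
    rewrite (@le_trans _ _ (K * rn (y - c)))//.
      by rewrite ler_piMr// mulr_ge0 ?rn_ge0// ltW.
    by rewrite ler_wpM2l ?(ltW K0)// ltW.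
  have h1 := osc f f1; have h2 := osc g g1; have h3 := fg c cP.
  have h4 := rnD (ns_val f y - ns_val f c) (ns_val f c - ns_val g y).
  have h5 := rnD (ns_val f c - ns_val g c) (ns_val g c - ns_val g y).
  rewrite addrA subrK in h4; rewrite addrA subrK in h5.
  rewrite [rn (ns_val g c - _)]rn_distC in h5.
  have -> : 3 * e1 = e1 + (e1 + e1) by ring.
  exact: le_trans h4 (lerD h1 (le_trans h5 (lerD (ltW h3) h2))).
change (norm (dilate s (ns_val f) - dilate s (ns_val g)) < e).
exact: le_lt_trans h e16.
Qed.

(** Three regions: on [disk r] the dilation is uniformly close to [f]; beyond [r'] it is bounded on
    an annulus of tiny area; in between nothing is claimed, and the whole dilation is kept as the
    cutoff term. *)
Lemma dilation_split (r e : R) : 0 < r < 1 -> 0 < e ->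
  exists s (sb : 2^-1 <= s <= 1) r', [/\ s < 1, r < r' < 1 &
    forall f, f \in bergman_function p -> exists E, [/\ lpfun area p E,
      pnorm area p E <= e * norm f & forall w,
      rn (dilate s f (pt w) - (\1_(disk r) w)%:C * f (pt w)) <=
      cutoff (disk r' `\` disk r) (modulus (dilate s f)) w + E w]].
Proof.
move=> /andP[r0 r1] e0.
have e8 : 0 < e / 8 by rewrite divr_gt0.
have [s [s2 s1 hs]] := dilate_close r1 e8.
have [c c0 hc] := dilate_bounded (s := s) (ltac:(by rewrite s2)).
have sb : 2^-1 <= s <= 1 by rewrite s2 ltW.
(* The sup bound [c] depends on [s], so [r'] is chosen after [s]: the annulus beyond it has area at
   most [q] and contributes [c * q ^ (1 / p) = e / 2]. The inner region contributes
   [4 * (e / 8)]. *)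
pose q := (e / (2 * c)) `^ p.
have ec0 : 0 < e / (2 * c) by rewrite divr_gt0// mulr_gt0.
have q0 : 0 < q by rewrite powR_gt0.
pose r' := Num.max ((1 + r) / 2) (1 - q / 8).
have rr' : r < r' by rewrite lt_max; apply/orP; left; lra.
have r'1 : r' < 1.
  by rewrite gt_max; apply/andP; split; [lra|rewrite gtrBl divr_gt0].
have r'0 := lt_trans r0 rr'.
have rq : 4 * (1 - r' ^+ 2) <= q.
  have : 1 - q / 8 <= r' by rewrite le_max lexx orbT.
  move: r'1 r'0; clear; nra.
have r'2 : 0 <= 4 * (1 - r' ^+ 2).
  by rewrite mulr_ge0// subr_ge0 expr_le1// ltW.
exists s, sb, r'; split; rewrite ?rr'//.
move=> f bf; have nf := bergman_norm_ge0 p f.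
have [Af f0 _] := bergmanP bf.
have mr := @measurable_disk R r; have mr' := @measurable_disk R r'.
have mA : measurable (disk 1 `\` disk r').
  by apply: measurableD => //; exact: measurable_disk.
have ef0 : 0 <= e / 8 * norm f by rewrite mulr_ge0// ltW.
have cf0 : 0 <= c * norm f by rewrite mulr_ge0// ltW.
have [l1 n1] := pnorm_disk_le p1 (ltW r1) ef0.
have r'01 : 0 < r' < 1 by rewrite r'0.
have [l2 n2] := pnorm_indic_le p1 mA cf0 r'2 (area_annulus_le r'01).
have [l3 n3] := lpfunD p1 l1 l2.
exists (fun w => e / 8 * norm f * \1_(disk r) w +
  c * norm f * \1_(disk 1 `\` disk r') w); split=> //.
  rewrite (le_trans n3)//.
  have n4 : (4 * (1 - r' ^+ 2)) `^ p^-1 <= e / (2 * c).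
    rewrite -(powRK_root p0 (ltW ec0)) ge0_ler_powR ?nnegrE ?invr_ge0 ?(ltW p0)//.
    exact: powR_ge0.
  have n5 : c * norm f * (4 * (1 - r' ^+ 2)) `^ p^-1 <= e / 2 * norm f.
    apply: (@le_trans _ _ (c * norm f * (e / (2 * c)))).
      by rewrite ler_wpM2l.
    by rewrite le_eqVlt; apply/orP; left; apply/eqP; field; rewrite gt_eqF.
  apply: (le_trans (lerD n1 (le_trans n2 n5))).
  by rewrite le_eqVlt; apply/orP; left; apply/eqP; field.
move=> w; rewrite !indicE.
have [wr|nwr] := pselect (disk r w).
  have w1 : rn (pt w) < 1 by exact: lt_trans r1.
  rewrite mem_set// memNset; last by move=> [_]; apply; exact: lt_trans rr'.
  rewrite mul1r !mulr1 mulr0 addr0 cutoffF; last by case.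
  by rewrite add0r /dilate w1 hs.
rewrite [w \in disk r]memNset// mul0r subr0 mulr0 add0r.
have [wr'|nwr'] := pselect (disk r' w).
  rewrite cutoffT; last by split.
  by rewrite lerDl mulr_ge0.
have [w1|nw1] := pselect (disk 1 w); last first.
  rewrite dilateF ?rn0; last by move/unit_diskE.
  by apply: addr_ge0; [apply: mulr_ge0 => //; exact: rn_ge0|exact: mulr_ge0].
rewrite cutoffF; last by case.
rewrite add0r mem_set// mulr1 dilateT; last exact/unit_diskE.
exact: hc.
Qed.

(* The large errors of the successive dilations are supported by disjoint
   annuli, so that the p-th powers of their norms add up. *)
Lemma dilation_sum N : forall r e : R, 0 < r < 1 -> 0 < e ->
  exists (Q : bounded_op X X) r' (phi : mR * mR -> R),
  [/\ finite_nets Q, r < r' < 1, (forall w, 0 <= phi w <= N%:R),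
     forall w, disk r w -> phi w = N%:R & forall w, ~ disk r' w -> phi w = 0] /\
  forall f : X, exists G E, [/\ lpfun area p G, lpfun area p E,
     (forall w, ~ disk r' w -> G w = 0) /\
     (pint area p G <= (4 * rnorm f `^ p * N%:R)%:E)%E,
     pnorm area p E <= e * rnorm f &
     forall w, rn (ns_val (Q f) (pt w) - (phi w)%:C * ns_val f (pt w)) <= G w + E w].
Proof.
elim: N => [|N ih] r e r01 e0.
  have /andP[r0 r1] := r01.
  exists 0, ((1 + r) / 2), (fun=> 0); split.
    split=> //; [exact: finite_nets0|by apply/andP; split; lra|].
    by move=> w; rewrite lexx.
  move=> f; exists (fun=> 0), (fun=> 0); split=> //.
  - exact: lpfun0.
  - exact: lpfun0.
  - by split=> //; rewrite pint0// mulr0.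
  - by rewrite pnorm0// mulr_ge0 ?rnorm_ge0// ltW.
  - by move=> w; change (rn (0 - 0%:C * ns_val f (pt w)) <= 0 + 0); rewrite mul0r subr0 rn0 addr0.
have e2 : 0 < e / 2 by rewrite divr_gt0.
have [Q [r' [phi [[nQ rr' phiN phi1 phi0] hQ]]]] := ih r (e / 2) r01 e2.
have /andP[r0 r1] := r01; have /andP[rr r'1] := rr'.
have r'01 : 0 < r' < 1 by rewrite r'1 (lt_trans r0).
(* Starting from the outer radius [r'] of the previous annuli makes the new annulus disjoint from
   them. *)
have [s [sb [r'' [s1 rr'' hD]]]] := dilation_split r'01 e2.
have /andP[r'r'' r''1] := rr''.
have mr' := @measurable_disk R r'; have mr'' := @measurable_disk R r''.
exists (Q + dilation sb), r'', (fun w => phi w + \1_(disk r') w); split.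
  split.
  - exact: (finite_netsD nQ (@dilation_finite_nets s sb s1)).
  - by rewrite r''1 andbT (lt_trans rr).
  - move=> w; have /andP[h1 h2] := phiN w; apply/andP; split.
      by rewrite addr_ge0.
    by rewrite -natr1 lerD// indicE; case: (_ \in _).
  - move=> w wr; rewrite phi1// indicE mem_set ?natr1//.
    by rewrite /disk/= (lt_trans wr).
  - move=> w nw; have nw' : ~ disk r' w.
      by move=> h; apply: nw; rewrite /disk/= (lt_trans h).
    by rewrite phi0// indicE memNset// addr0.
move=> f; have [G [E [lG lE [G0 pG] nE hG]]] := hQ f.
have bf := ns_valP f; have [E1 [lE1 nE1 hE1]] := hD _ bf.
have bd := (dilate_bergman p1 sb bf).1; have [ld _] := bergman_lpfun p1 bd.
have [md _ _] := ld.
have mA : measurable (disk r'' `\` disk r') by exact: measurableD.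
pose G1 := cutoff (disk r'' `\` disk r') (modulus (dilate s (ns_val f))).
have [lG1 _] := lpfun_cutoff p1 mA ld.
have [lGG _] := lpfunD p1 lG lG1; have [lEE nEE] := lpfunD p1 lE lE1.
exists (fun w => G w + G1 w), (fun w => E w + E1 w); split=> //.
- split.
    move=> w nw; have nw' : ~ disk r' w.
      by move=> h; apply: nw; rewrite /disk/= (lt_trans h).
    by rewrite G0// /G1 cutoffF ?addr0// => -[].
  rewrite pint_disjoint//; [|by case: lG|by case: lG1|]; last first.
    move=> w; have [wr|nwr] := pselect (disk r' w); last by left; exact: G0.
    by right; rewrite /G1 cutoffF// => -[].
  rewrite -[N.+1%:R]natr1 mulrDr mulr1 EFinD; apply: leeD => //.
  have mG1 : measurable_fun setT G1 by case: lG1.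
  apply: (@le_trans _ _ (pint area p (modulus (dilate s (ns_val f))))).
    by apply: pint_le => // w; apply: cutoff_le; exact: rn_ge0.
  apply: (le_trans (dilate_pint p1 sb bf)).
  have [[_ _ foo] nf] := bergman_lpfun p1 bf.
  have ffin : pint area p (modulus (ns_val f)) \is a fin_num.
    by rewrite ge0_fin_numE// pint_ge0.
  by rewrite -(fineK ffin) -EFinM lee_fin rnorm_ns [ns_norm _ _]nf pnormXp.
- rewrite (le_trans nEE)// [e]splitr mulrDl lerD//.
- move=> w; rewrite opDE.
  change (rn (ns_val (Q f) (pt w) + dilate s (ns_val f) (pt w) -
    (phi w + \1_(disk r') w)%:C * ns_val f (pt w)) <= G w + G1 w + (E w + E1 w)).
  rewrite rmorphD/= mulrDl opprD addrACA (le_trans (rnD _ _))// addrACA.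
  by apply: lerD; [exact: hG|exact: hE1].
Qed.

End DilationOperators.

(** * Cutoff operators on the Bergman space *)

Section BergmanCutoffs.
Variables (R : realType) (p : R).
Hypothesis hp : 1 < p.
Let p1 : 1 <= p := ltW hp.
Local Notation C := R[i].
Local Notation rn z := (rnorm (z : C^o)).
Local Notation mR := (measurableTypeR R).
Local Notation area := (area R).
Local Notation pt w := (w.1 +i* w.2).
Local Notation X := (bergman_space p1).
Local Notation mod f := (modulus (ns_val f)).
Implicit Types f : X.

Let p0 : 0 < p. Proof. exact: lt_le_trans p1. Qed.

Let rnormE_mod f : rnorm f = pnorm area p (mod f).
Proof. exact: (bergman_lpfun p1 (ns_valP f)).2. Qed.

Let lp_mod f : lpfun area p (mod f).
Proof. exact: (bergman_lpfun p1 (ns_valP f)).1. Qed.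

Definition inner_norm r f := pnorm area p (cutoff (disk r) (mod f)).

Definition outer_norm r f := pnorm area p (cutoff (~` disk r) (mod f)).

Lemma bergman_cutoff_fun (r e : R) : 0 < r < 1 -> 0 < e ->
  exists (K : bounded_op X X) r' (psi : mR * mR -> R),
  [/\ finite_nets K, r < r' < 1, (forall w, 0 <= psi w <= 1),
     forall w, disk r w -> psi w = 1 & forall w, ~ disk r' w -> psi w = 0] /\
  forall f, exists g, [/\ lpfun area p g, pnorm area p g <= e * rnorm f &
    forall w, rn (ns_val (K f) (pt w) - (psi w)%:C * ns_val f (pt w)) <= g w].
Proof.
move=> r01 e0; have e2 : 0 < e / 2 by rewrite divr_gt0.
have ep : 0 < (e / 2) `^ p by rewrite powR_gt0.
(* This gives [4 * N < (N * e / 2) ^ p]: after division by [N], the annular errors have norm at most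
   [e / 2] times that of [f]. *)
have [k hk] := linear_lt_power hp (4 / (e / 2) `^ p).
set N : nat := k.+1 in hk; have N0 : 0 < N%:R :> R by rewrite ltr0n.
have [Q [r' [phi [[nQ rr' phiN phi1 phi0] hQ]]]] := dilation_sum p1 N r01 e2.
pose a : R := N%:R^-1; have a0 : 0 < a by rewrite invr_gt0.
exists (a%:C *: Q), r', (fun w => a * phi w); split.
  split.
  - exact: (finite_netsZ a%:C nQ).
  - exact: rr'.
  - move=> w; have /andP[h1 h2] := phiN w.
    by rewrite mulr_ge0 ?(ltW a0)//= mulrC ler_pdivrMr// mul1r.
  - by move=> w wr; rewrite phi1// mulVf// gt_eqF.
  - by move=> w nw; rewrite phi0// mulr0.
move=> f; have [G [E [lG lE [_ pG] nE hG]]] := hQ f.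
have [lGE nGE] := lpfunD p1 lG lE; have [laGE naGE] := lpfunZ p1 (ltW a0) lGE.
exists (fun w => a * (G w + E w)); split; [exact: laGE| |].
  have nf := rnorm_ge0 f.
  have c0 : 0 <= 4 * rnorm f `^ p * N%:R.
    by rewrite mulr_ge0// mulr_ge0// powR_ge0.
  have nG : pnorm area p G <= N%:R * (e / 2) * rnorm f.
    apply: (le_trans (pnorm_le_root p1 c0 pG)).
    have -> : 4 * rnorm f `^ p * N%:R = (4 * N%:R) * rnorm f `^ p by rewrite mulrAC.
    rewrite powRM ?powR_ge0 ?mulr_ge0// powRK_root// ler_wpM2r//.
    rewrite -[leRHS](powRK_root p0) ?mulr_ge0 ?(ltW e2) ?(ltW N0)//.
    rewrite ge0_ler_powR ?nnegrE ?invr_ge0 ?(ltW p0) ?mulr_ge0 ?powR_ge0//.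
    rewrite powRM ?(ltW N0) ?(ltW e2)// -ler_pdivrMr// mulrAC.
    exact: ltW.
    exact: ltW.
  rewrite naGE mulrC ler_pdivrMr// (le_trans nGE)// (le_trans (lerD nG nE))//.
  have N1 : 1 <= N%:R :> R by rewrite ler1n.
  have h : e / 2 * rnorm f <= e / 2 * rnorm f * N%:R.
    by rewrite ler_peMr// mulr_ge0// ltW.
  have -> : e * rnorm f * N%:R =
      N%:R * (e / 2) * rnorm f + e / 2 * rnorm f * N%:R by field.
  by rewrite lerD2l.
move=> w; rewrite opZE.
change (rn (a%:C * ns_val (Q f) (pt w) - (a * phi w)%:C * ns_val f (pt w)) <=
  a * (G w + E w)).
rewrite rmorphM/= -mulrA -mulrBr rnM rnC ?(ltW a0)//.
by rewrite ler_wpM2l ?(ltW a0).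
Qed.

(** The pointwise comparison with multiplication by [psi] becomes the four norm estimates of a
    cutoff operator. The radius [s] is left free beyond [r'], so that the next radius of a sequence
    may be larger than [r']. *)
Lemma bergman_cutoff (r e : R) : 0 < r < 1 -> 0 < e ->
  exists (K : bounded_op X X) r', [/\ finite_nets K, r < r' < 1 &
  forall f s, r' <= s ->
    [/\ rnorm (K f) <= inner_norm s f + e * rnorm f,
        rnorm (f - K f) <= outer_norm r f + e * rnorm f,
        outer_norm s (K f) <= e * rnorm f &
        inner_norm r (f - K f) <= e * rnorm f]].
Proof.
move=> r01 e0.
have [K [r' [psi [[nK rr' psi01 psi1 psi0] hK]]]] := bergman_cutoff_fun r01 e0.
exists K, r'; split=> // f s r's; have [g [lg ng hg]] := hK f.
have [_ g0 _] := lg.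
have lf := lp_mod f; have lKf := lp_mod (K f); have lfK := lp_mod (f - K f).
have [mf _ _] := lf; have [mKf _ _] := lKf; have [mfK _ _] := lfK.
have ms := @measurable_disk R s; have mr := @measurable_disk R r.
have msC := measurableC ms; have mrC := measurableC mr.
have m0 h (w : mR * mR) : 0 <= mod h w by exact: rn_ge0.
have psiC w : rn (psi w)%:C = psi w by rewrite rnC//; case/andP: (psi01 w).
have out w : ~ disk s w -> psi w = 0.
  by move=> nw; apply: psi0 => wr; apply: nw; exact: lt_le_trans r's.
have KfE w : mod (K f) w <= psi w * mod f w + g w.
  have := rnD (ns_val (K f) (pt w) - (psi w)%:C * ns_val f (pt w))
    ((psi w)%:C * ns_val f (pt w)).
  rewrite subrK => /le_trans; apply.
  by rewrite addrC rnM psiC lerD2l hg.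
have fKE w : mod (f - K f) w <= (1 - psi w) * mod f w + g w.
  change (rn (ns_val f (pt w) - ns_val (K f) (pt w)) <= (1 - psi w) * mod f w + g w).
  have -> : ns_val f (pt w) - ns_val (K f) (pt w) =
     (1 - psi w)%:C * ns_val f (pt w) -
     (ns_val (K f) (pt w) - (psi w)%:C * ns_val f (pt w)).
    by rewrite rmorphB rmorph1 mulrBl mul1r opprB addrA subrK.
  rewrite (le_trans (rnB _ _))// rnM rnC.
    by rewrite lerD2l hg.
  by rewrite subr_ge0; case/andP: (psi01 w).
split.
- have [lc _] := lpfun_cutoff p1 ms lf.
  rewrite rnormE_mod (le_trans (lpfun_triangle p1 lc lg mKf _).2) ?lerD2l//.
  move=> w; rewrite m0/= (le_trans (KfE w))// lerD2r.
  have [ws|nws] := pselect (disk s w).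
    by rewrite cutoffT// ler_piMl//; case/andP: (psi01 w).
  by rewrite cutoffF// out// mul0r.
- have [lc _] := lpfun_cutoff p1 mrC lf.
  rewrite rnormE_mod (le_trans (lpfun_triangle p1 lc lg mfK _).2) ?lerD2l//.
  move=> w; rewrite m0/= (le_trans (fKE w))// lerD2r.
  have [wr|nwr] := pselect (disk r w).
    by rewrite psi1// subrr mul0r cutoffF.
  by rewrite cutoffT// ler_piMl// gerBl; case/andP: (psi01 w).
- apply: le_trans ng; apply: (lpfun_le p1 _ lg _).2.
    exact: measurable_cutoff.
  move=> w; have [ws|nws] := pselect (disk s w).
    by rewrite cutoffF// lexx g0.
  by rewrite cutoffT// m0 (le_trans (KfE w))// out// mul0r add0r lexx.
- apply: le_trans ng; apply: (lpfun_le p1 _ lg _).2.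
    exact: measurable_cutoff.
  move=> w; have [wr|nwr] := pselect (disk r w).
    by rewrite cutoffT// m0 (le_trans (fKE w))// psi1// subrr mul0r add0r lexx.
  by rewrite cutoffF// lexx g0.
Qed.

Lemma inner_outer_norm_split r f :
  rnorm f `^ p = inner_norm r f `^ p + outer_norm r f `^ p.
Proof.
by rewrite rnormE_mod; apply: pnorm_cutoffC => //; exact: measurable_disk.
Qed.

Lemma pnorm_cutoffD (A : set (mR * mR)) (f g : X) : measurable A ->
  pnorm area p (cutoff A (mod (f + g))) <=
  pnorm area p (cutoff A (mod f)) + pnorm area p (cutoff A (mod g)).
Proof.
move=> mA.
have [lf _] := lpfun_cutoff p1 mA (lp_mod f).
have [lg _] := lpfun_cutoff p1 mA (lp_mod g).
have [[mfg _ _] _] := lpfun_cutoff p1 mA (lp_mod (f + g)).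
apply: (lpfun_triangle p1 lf lg mfg _).2 => w.
have [Aw|nAw] := pselect (A w); last by rewrite !cutoffF// addr0 lexx.
rewrite !cutoffT//; apply/andP; split; first exact: rn_ge0.
exact: (rnD (ns_val f (pt w)) (ns_val g (pt w))).
Qed.

Lemma pnorm_cutoff_sub (A B : set (mR * mR)) f : measurable A -> measurable B ->
  A `<=` B -> pnorm area p (cutoff A (mod f)) <= pnorm area p (cutoff B (mod f)).
Proof.
move=> mA mB AB; have [lB _] := lpfun_cutoff p1 mB (lp_mod f).
have [[mAf _ _] _] := lpfun_cutoff p1 mA (lp_mod f).
apply: (lpfun_le p1 mAf lB _).2 => w.
have m0 : 0 <= mod f w by exact: rn_ge0.
have [Aw|nAw] := pselect (A w).
  by rewrite !cutoffT ?m0 ?lexx//; exact: AB.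
by rewrite cutoffF// lexx; case/andP: (cutoff_le B m0).
Qed.

(** If all outer norms were at least [e], the p-th powers of the inner norms would be at most
    [rnorm f ^ p - e ^ p], and Fatou would give the same bound for [f] itself. *)
Lemma outer_norm_cvg0 (r : nat -> R) f (e : R) :
  (forall x, x < 1 -> exists N, forall n, (N <= n)%N -> x < r n) -> 0 < e ->
  exists n, outer_norm (r n) f < e.
Proof.
move=> hr e0; apply: contrapT => ne.
have oute n : e <= outer_norm (r n) f.
  by rewrite leNgt; apply/negP => h; apply: ne; exists n.
have md n := @measurable_disk R (r n).
have [mf _ foo] := lp_mod f.
pose c := fine (pint area p (mod f)) - e `^ p.
suff : (pint area p (mod f) <= c%:E)%E.
  rewrite -[pint _ _ _]fineK ?ge0_fin_numE ?pint_ge0// lee_fin /c.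
  by rewrite lerBrDr gerDl leNgt powR_gt0.
apply: (@pint_fatou _ _ _ area p p1 (fun n => cutoff (disk (r n)) (mod f)) _ _ 0%N).
- by move=> n; exact: measurable_cutoff.
- by move=> n w; apply: mulr_ge0 => //; exact: rn_ge0.
- by move=> w; exact: rn_ge0.
- move=> w d d0; have [Dw|nD] := pselect (disk 1 w).
    have [N hN] := hr _ Dw; exists N => n Nn.
    by rewrite cutoffT ?subrr ?normr0//; exact: hN.
  have [_ f0 _] := bergmanP (ns_valP f).
  exists 0%N => n _; have m0 : mod f w = 0.
    by rewrite /modulus f0 ?rn0//; move/unit_diskE.
  by rewrite /cutoff m0 mulr0 subrr normr0.
move=> n _; have [[_ _ ioo] _] := lpfun_cutoff p1 (md n) (lp_mod f).
rewrite -[pint _ _ _]fineK ?ge0_fin_numE ?pint_ge0// lee_fin.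
rewrite -(pnormXp area p1) /c -(pnormXp area p1 (mod f)) -rnormE_mod.
rewrite (inner_outer_norm_split (r n)) lerBrDr lerD2l.
by apply: le_powR => //; exact: ltW.
Qed.

Theorem bergman_M_ideal : M_ideal (@compact_operators R X).
Proof.
have /choice[F hF] : forall q : R * nat, exists Kr : bounded_op X X * R,
    0 < q.1 < 1 -> [/\ finite_nets Kr.1, q.1 < Kr.2 < 1 &
  forall f s, Kr.2 <= s ->
    [/\ rnorm (Kr.1 f) <= inner_norm s f + q.2.+1%:R^-1 * rnorm f,
        rnorm (f - Kr.1 f) <= outer_norm q.1 f + q.2.+1%:R^-1 * rnorm f,
        outer_norm s (Kr.1 f) <= q.2.+1%:R^-1 * rnorm f &
        inner_norm q.1 (f - Kr.1 f) <= q.2.+1%:R^-1 * rnorm f]].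
  move=> [r n] /=; have [r01|nr] := pselect (0 < r < 1); last by exists (0, 0).
  have n0 : 0 < n.+1%:R^-1 :> R by rewrite invr_gt0.
  by have [K [r' h]] := bergman_cutoff r01 n0; exists (K, r').
(* The first argument of the maximum is the radius required by the previous cutoff, the second
   forces the radii to tend to 1. *)
pose rs := fix rs n := if n is k.+1 then
  Num.max (F (rs k, k)).2 (1 - k.+2%:R^-1) else 2^-1.
have rs01 n : 0 < rs n < 1.
  elim: n => [|n /[dup] rs01 /andP[r0 r1]] /=.
    by rewrite invr_gt0 ltr0n invf_lt1// ltr1n.
  have [_ /andP[h1 h2] _] := hF (rs n, n) rs01.
  by rewrite lt_max (lt_trans r0 h1)/= gt_max h2/= gtrBl invr_gt0.
pose K n := (F (rs n, n)).1.
have hK n := hF (rs n, n) (rs01 n).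
have rsS n : rs n < rs n.+1.
  by have [_ /andP[h1 _] _] := hK n; rewrite /= lt_max h1.
have rs_mono n m : (n <= m)%N -> rs n <= rs m.
  move=> nm; rewrite -(subnK nm); elim: (m - n)%N => [|k ih]; first by rewrite add0n.
  by rewrite addSn (le_trans ih)// ltW// rsS.
have rs_cvg x : x < 1 -> exists N, forall n, (N <= n)%N -> x < rs n.
  move=> x1; have x0 : 0 < 1 - x by rewrite subr_gt0.
  have [N hN] := eps_small x0; exists N.+1 => n Nn.
  apply: lt_le_trans (rs_mono _ _ Nn); rewrite /= lt_max; apply/orP; right.
  by have := hN N.+1 (leqnSn N); rewrite ltrBrDl -ltrBrDr.
have md n := @measurable_disk R (rs n).
have spec n f := (let: And3 _ _ h := hK n in h) f (rs n.+1).
have le n : (F (rs n, n)).2 <= rs n.+1 by rewrite /= le_max lexx.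
have sub n m : (n <= m)%N -> disk (rs n) `<=` disk (rs m).
  by move=> nm w h; exact: lt_le_trans (rs_mono _ _ nm).
refine (@cutoff_M_ideal R p hp X (@bergman_space_complete R p p1)
  (fun n => inner_norm (rs n)) (fun n => outer_norm (rs n)) K
  _ _ _ _ _ _ _ _ _ _ _ _ _).
- by move=> n f; exact: pnorm_ge0.
- by move=> n f; exact: pnorm_ge0.
- by move=> n f; exact: inner_outer_norm_split.
- by move=> n f g; exact: pnorm_cutoffD.
- by move=> n f g; apply: pnorm_cutoffD; exact: measurableC.
- by move=> n m f nm; apply: pnorm_cutoff_sub => //; exact: sub.
- move=> n m f nm; apply: pnorm_cutoff_sub; [exact: measurableC|exact: measurableC|].
  by apply: subsetC; exact: sub.
- by move=> f e e0; exact: outer_norm_cvg0.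
- by move=> n; case: (hK n).
- by move=> n f; case: (spec n f (le n)).
- by move=> n f; case: (spec n f (le n)).
- by move=> n f; case: (spec n f (le n)).
- by move=> n f; case: (spec n f (le n)).
Qed.

End BergmanCutoffs.

Unset Implicit Arguments.

Theorem corollary5p8 (R : realType) (p : R) (hp : 1 < p) :
  embeds_almost_isometrically (bergman_space (ltW hp)) (lp_space (ltW hp)) /\
  M_ideal (@compact_operators R (bergman_space (ltW hp))).
Proof. by split; [exact: bergman_embeds_lp|exact: bergman_M_ideal]. Qed.
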